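(* Let $(M,\Delta,\varepsilon)$ be a discrete quantum group. Then $(M,\Delta,\varepsilon)$ is of Kac type if and only if there exists a $W^*$-morphism $s\colon M\to M^{op}$ such that (1) $\varphi\circ(s\,\overline{\otimes}\,\mathrm{id})\circ\Delta=\varepsilon$ for all diagonal states $\varphi\colon M^{op}\,\overline{\otimes}\,M\to\mathbb{C}$, and (2) $\varphi\circ(\mathrm{id}\,\overline{\otimes}\,s)\circ\Delta=\varepsilon$ for all diagonal states $\varphi\colon M\,\overline{\otimes}\,M^{op}\to\mathbb{C}$.
   Context: A $W^*$-morphism is a unital normal $*$-homomorphism between von Neumann algebras; $\overline{\otimes}$ is the von Neumann algebra tensor product; $M^{op}$ is $M$ with reversed multiplication (same $*$-operation and linear structure). A von Neumann algebra is hereditarily atomic if each of its von Neumann subalgebras is atomic (the supremum of its minimal projections is $1$); equivalently, it is isomorphic to an $\ell^\infty$-sum $\prod^{W^*}_{i\in I}M_{n_i}=\{(x_i)_{i\in I}: x_i\in M_{n_i}(\mathbb{C}),\ \sup_i\|x_i\|<\infty\}$ of full matrix algebras. A discrete quantum monoid $(M,\Delta,\varepsilon)$ is a hereditarily atomic von Neumann algebra $M$ with $W^*$-morphisms $\Delta\colon M\to M\,\overline{\otimes}\,M$ and $\varepsilon\colon M\to\mathbb{C}$ such that $(\Delta\,\overline{\otimes}\,\mathrm{id})\circ\Delta=(\mathrm{id}\,\overline{\otimes}\,\Delta)\circ\Delta$, $(\varepsilon\,\overline{\otimes}\,\mathrm{id})\circ\Delta=\mathrm{id}$ and $(\mathrm{id}\,\overline{\otimes}\,\varepsilon)\circ\Delta=\mathrm{id}$.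 For a von Neumann algebra $N$, a diagonal state on $N\,\overline{\otimes}\,N^{op}$ is a normal state $\mu\colon N\,\overline{\otimes}\,N^{op}\to\mathbb{C}$ with $\mu(p\otimes(1-p))=0$ for every projection $p\in N$. (For $N=M^{op}$ this defines diagonal states on $M^{op}\,\overline{\otimes}\,M$.) Write $M_{00}$ for the $*$-subalgebra of $M$ generated by its minimal projections; if $M=\prod^{W^*}_{i}M_{n_i}$ then $M_{00}=\bigoplus_i M_{n_i}$ (algebraic direct sum), with multiplier algebra $\mathrm{Mult}(M_{00})=\prod_i M_{n_i}$ (full algebraic product) and $\mathrm{Mult}(M_{00}\otimes M_{00})=\prod_{i,j}M_{n_i}\otimes M_{n_j}\supseteq M\,\overline{\otimes}\,M$. A discrete quantum monoid $(M,\Delta,\varepsilon)$ is called a discrete quantum group if $(M_{00},\Delta|_{M_{00}})$ is a multiplier Hopf $*$-algebra in the sense of Van Daele and $\varepsilon|_{M_{00}}$ is its (unique) counit. Here, for $A=M_{00}$, being a multiplier Hopf $*$-algebra means that $\Delta\colon A\to\mathrm{Mult}(A\otimes A)$ is a coassociative $*$-homomorphism such that $a\otimes b\mapsto\Delta(a)(1\otimes b)$ and $a\otimes b\mapsto(a\otimes1)\Delta(b)$ define bijections of $A\otimes A$ onto $A\otimes A$. Its antipode is the unique linear map $S\colon A\to A$ with $\mathrm{mult}\big((S\otimes\mathrm{id})(\Delta(a)(1\otimes b))\big)=\varepsilon(a)b$ and $\mathrm{mult}\big((\mathrm{id}\otimes S)((a\otimes1)\Delta(b))\big)=\varepsilon(b)a$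 for all $a,b\in A$; it is automatically anti-multiplicative and bijective. The discrete quantum group is of Kac type if its antipode is a $*$-map, i.e. $S(a^* )=S(a)^*$ for all $a\in M_{00}$. *)

(* Defs.v *)
From HB Require Import structures.
From mathcomp Require Import all_boot all_order all_algebra.
From mathcomp Require Import all_classical reals.
From mathcomp Require Import complex.

Set Implicit Arguments.
Unset Strict Implicit.
Unset Printing Implicit Defensive.

Import Order.TTheory GRing.Theory Num.Theory.

Local Open Scope classical_set_scope.
Local Open Scope ring_scope.

HB.mixin Record hasStar (C : numClosedFieldType) A of GRing.Algebra C A := {
  star : A -> A;
  starK : involutive star;
  starD : {morph star : x y / x + y};
  starZ : forall (c : C) x, star (c *: x) = c^* *: star x;
  starM : forall x y, star (x * y) = star y * star x }.

#[short(type="starAlgType")]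
HB.structure Definition StarAlgebra (C : numClosedFieldType) :=
  {A of GRing.Algebra C A & hasStar C A}.

Arguments star {C s} x : rename.

Section Scalars.
Variable C : numClosedFieldType.

Let cstar (x : C^o) : C^o := (x : C)^*.
Fact cstarK : involutive cstar. Proof. by move=> x; exact: conjCK. Qed.
Fact cstarD : {morph cstar : x y / x + y}.
Proof. by move=> x y; exact: rmorphD. Qed.
Fact cstarZ (c : C) x : cstar (c *: x) = c^* *: cstar x.
Proof. exact: rmorphM. Qed.
Fact cstarM x y : cstar (x * y) = cstar y * cstar x.
Proof. by rewrite mulrC; exact: rmorphM. Qed.

HB.instance Definition _ := hasStar.Build C C^o cstarK cstarD cstarZ cstarM.

End Scalars.

Section Matrices.
Variables (C : numClosedFieldType) (n : nat).

Let mstar (x : 'M[C]_n.+1) : 'M[C]_n.+1 := map_mx Num.conj x^T.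
Fact mstarK : involutive mstar.
Proof. by move=> x; apply/matrixP=> i j; rewrite !mxE conjCK. Qed.
Fact mstarD : {morph mstar : x y / x + y}.
Proof. by move=> x y; apply/matrixP=> i j; rewrite !mxE rmorphD. Qed.
Fact mstarZ (c : C) x : mstar (c *: x) = c^* *: mstar x.
Proof. by apply/matrixP=> i j; rewrite !mxE rmorphM. Qed.
Fact mstarM x y : mstar (x * y) = mstar y * mstar x.
Proof. by rewrite /mstar -!mulmxE trmx_mul map_mxM. Qed.

HB.instance Definition _ :=
  hasStar.Build C 'M[C]_n.+1 mstarK mstarD mstarZ mstarM.

End Matrices.

(* A^op : same linear structure and involution, reversed multiplication. *)
Definition opalg (C : numClosedFieldType) (A : starAlgType C) : Type := A.

Section Opposite.
Variables (C : numClosedFieldType) (A : starAlgType C).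

HB.instance Definition _ := GRing.NzRing.copy (opalg A) (A^c)%type.
HB.instance Definition _ := GRing.Lmodule.copy (opalg A) A.
Fact opalg_scaleAl (c : C) (x y : opalg A) :
  c *: (x * y : opalg A) = ((c *: x : opalg A) : (A^c)%type) * y.
Proof. exact: (@scalerAr C A c y x). Qed.
HB.instance Definition _ :=
  GRing.Lmodule_isLalgebra.Build C (opalg A) opalg_scaleAl.
Fact opalg_scaleAr (c : C) (x y : opalg A) : c *: (x * y) = x * (c *: y).
Proof. exact: (@scalerAl C A c y x). Qed.
HB.instance Definition _ :=
  GRing.Lalgebra_isAlgebra.Build C (opalg A) opalg_scaleAr.
Fact opalg_starM (x y : opalg A) :
  star ((x * y : opalg A) : A) = (star (y : A) : opalg A) * (star (x : A)).
Proof. exact: (@starM C A y x). Qed.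
HB.instance Definition _ := hasStar.Build C (opalg A)
  (@starK C A) (@starD C A) (@starZ C A) opalg_starM.

Lemma opalgM (x y : A) : (x : opalg A) * (y : opalg A) = (y * x : A).
Proof. by []. Qed.

End Opposite.

(* A finite-dimensional *-algebra with a distinguished basis.  The basis serves
   only to write down tensor products. *)
Record fdalg (C : numClosedFieldType) := FdAlg {
  fdsort :> starAlgType C;
  bas : finType;
  bvec : bas -> fdsort;
  bcoef : bas -> fdsort -> C;
  bcoef_linear : forall t, linear_for *%R (bcoef t);
  bcoef_bvec : forall s t, bcoef t (bvec s) = (s == t)%:R;
  bcoefK : forall x, \sum_t bcoef t x *: bvec t = x }.

Section FdAlgTheory.
Variables (C : numClosedFieldType) (A : fdalg C).

HB.instance Definition _ (t : bas A) :=
  GRing.isLinear.Build C A C *%R (@bcoef C A t) (@bcoef_linear C A t).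

Lemma bcoef_inj (x y : A) : (forall t, bcoef t x = bcoef t y) -> x = y.
Proof.
by move=> xy; rewrite -(bcoefK x) -(bcoefK y); apply: eq_bigr => t _; rewrite xy.
Qed.

Definition mop : fdalg C.
Proof.
exact: (@FdAlg C (opalg A) (bas A) (@bvec C A) (@bcoef C A)
  (@bcoef_linear C A) (@bcoef_bvec C A) (@bcoefK C A)).
Defined.

End FdAlgTheory.

Section MatrixBlock.
Variables (C : numClosedFieldType) (n : nat).

Let mvec (t : 'I_n.+1 * 'I_n.+1) : 'M[C]_n.+1 := delta_mx t.1 t.2.
Let mcoef (t : 'I_n.+1 * 'I_n.+1) (x : 'M[C]_n.+1) : C := x t.1 t.2.
Fact mcoef_linear t : linear_for *%R (mcoef t).
Proof. by move=> c x y; rewrite /mcoef !mxE. Qed.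
Fact mcoef_mvec s t : mcoef t (mvec s) = (s == t)%:R.
Proof. by case: s t => [i j] [k l]; rewrite /mcoef /mvec mxE !(eq_sym k, eq_sym l). Qed.
Fact mcoefK x : \sum_t mcoef t x *: mvec t = x.
Proof.
rewrite [RHS]matrix_sum_delta pair_big /=.
by apply: eq_bigr => -[].
Qed.

Definition matblock : fdalg C := FdAlg mcoef_linear mcoef_mvec mcoefK.

End MatrixBlock.

Definition tens (C : numClosedFieldType) (A B : fdalg C) : Type :=
  {ffun bas A * bas B -> C^o}.

Section Tensor.
Variables (C : numClosedFieldType) (A B : fdalg C).

HB.instance Definition _ :=
  GRing.Lmodule.copy (tens A B) {ffun bas A * bas B -> C^o}.

Definition ten (a : A) (b : B) : tens A B :=
  [ffun p => bcoef p.1 a * bcoef p.2 b].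
Definition tens_mul (X Y : tens A B) : tens A B :=
  \sum_p \sum_q (X p * Y q) *:
    ten (bvec p.1 * bvec q.1) (bvec p.2 * bvec q.2).
Definition tens_star (X : tens A B) : tens A B :=
  \sum_p (X p)^* *: ten (star (bvec p.1)) (star (bvec p.2)).

Lemma tenPl c a a' b : ten (c *: a + a') b = c *: ten a b + ten a' b.
Proof. by apply/ffunP=> p; rewrite !ffunE linearP mulrDl -mulrA. Qed.
Lemma tenPr c a b b' : ten a (c *: b + b') = c *: ten a b + ten a b'.
Proof. by apply/ffunP=> p; rewrite !ffunE linearP mulrDr mulrCA. Qed.
Lemma tensE (X : tens A B) : X = \sum_p X p *: ten (bvec p.1) (bvec p.2).
Proof.
apply/ffunP=> p; rewrite sum_ffunE (bigD1 p) //= big1 => [|q qp].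
  by rewrite !ffunE !bcoef_bvec !eqxx mulr1 addr0; exact/esym/mulr1.
rewrite !ffunE !bcoef_bvec -natrM mulnb -[_ && _]/(q == p).
by rewrite (negbTE qp) scaler0.
Qed.

Lemma tens_ind (P : tens A B -> Prop) : P 0 ->
  (forall c X Y, P X -> P Y -> P (c *: X + Y)) ->
  (forall a b, P (ten a b)) -> forall X, P X.
Proof.
move=> P0 PD Pt X; rewrite (tensE X); elim/big_rec: _ => // p Y _; exact: PD.
Qed.

Fact tens_mulPl c X X' Y :
  tens_mul (c *: X + X') Y = c *: tens_mul X Y + tens_mul X' Y.
Proof.
rewrite /tens_mul scaler_sumr -big_split; apply: eq_bigr => p _ /=.
rewrite scaler_sumr -big_split; apply: eq_bigr => q _ /=.
by rewrite !ffunE mulrDl scalerDl scalerA -mulrA.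
Qed.
Fact tens_mulPr c X Y Y' :
  tens_mul X (c *: Y + Y') = c *: tens_mul X Y + tens_mul X Y'.
Proof.
rewrite /tens_mul scaler_sumr -big_split; apply: eq_bigr => p _ /=.
rewrite scaler_sumr -big_split; apply: eq_bigr => q _ /=.
by rewrite !ffunE mulrDr scalerDl scalerA mulrCA.
Qed.

Lemma ten_suml (J : finType) (c : J -> C) (u : J -> A) b :
  ten (\sum_j c j *: u j) b = \sum_j c j *: ten (u j) b.
Proof.
apply/ffunP=> p; rewrite sum_ffunE !ffunE linear_sum mulr_suml.
by apply: eq_bigr => j _; rewrite !ffunE linearZ -mulrA.
Qed.
Lemma ten_sumr (J : finType) (c : J -> C) a (u : J -> B) :
  ten a (\sum_j c j *: u j) = \sum_j c j *: ten a (u j).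
Proof.
apply/ffunP=> p; rewrite sum_ffunE !ffunE linear_sum mulr_sumr.
by apply: eq_bigr => j _; rewrite !ffunE linearZ mulrCA.
Qed.

Lemma tens_mul_ten a b a' b' :
  tens_mul (ten a b) (ten a' b') = ten (a * a') (b * b').
Proof.
pose f (x x' : A) (y y' : B) := ten (x * x') (y * y').
have step1 x' y y' : f a x' y y' = \sum_s bcoef s a *: f (bvec s) x' y y'.
  rewrite /f -{1}(bcoefK a) mulr_suml.
  under eq_bigr => s _ do rewrite -scalerAl.
  exact: ten_suml.
have step2 x y y' : f x a' y y' = \sum_s bcoef s a' *: f x (bvec s) y y'.
  rewrite /f -{1}(bcoefK a') mulr_sumr.
  under eq_bigr => s _ do rewrite -scalerAr.
  exact: ten_suml.
have step3 x x' y' : f x x' b y' = \sum_s bcoef s b *: f x x' (bvec s) y'.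
  rewrite /f -{1}(bcoefK b) mulr_suml.
  under eq_bigr => s _ do rewrite -scalerAl.
  exact: ten_sumr.
have step4 x x' y : f x x' y b' = \sum_s bcoef s b' *: f x x' y (bvec s).
  rewrite /f -{1}(bcoefK b') mulr_sumr.
  under eq_bigr => s _ do rewrite -scalerAr.
  exact: ten_sumr.
rewrite -/(f a a' b b') /tens_mul.
transitivity (\sum_(p : bas A * bas B) (bcoef p.1 a * bcoef p.2 b) *:
   f (bvec p.1) a' (bvec p.2) b'); last first.
  rewrite step1 (eq_bigr _ (fun s _ => congr1 _ (step3 _ _ _))).
  under [RHS]eq_bigr => s _ do rewrite scaler_sumr.
  rewrite pair_big; apply: eq_bigr => p _.
  by rewrite scalerA.
apply: eq_bigr => p _.
rewrite step2 (eq_bigr _ (fun s _ => congr1 _ (step4 _ _ _))).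
under [X in _ = _ *: X]eq_bigr => s _ do rewrite scaler_sumr.
rewrite pair_big scaler_sumr; apply: eq_bigr => q _.
by rewrite !ffunE !scalerA !mulrA.
Qed.

Fact tens_mulA : associative tens_mul.
Proof.
move=> X Y Z.
have m0l U : tens_mul 0 U = 0.
  by have := tens_mulPl (-1) U U U; rewrite !scaleN1r !addNr.
have m0r U : tens_mul U 0 = 0.
  by have := tens_mulPr (-1) U U U; rewrite !scaleN1r !addNr.
elim/tens_ind: X => [|c X X' IH IH'|a b]; first by rewrite !m0l.
  by rewrite !tens_mulPl IH IH'.
elim/tens_ind: Y => [|c Y Y' IH IH'|a' b']; first by rewrite m0l m0r m0l.
  by rewrite tens_mulPl !tens_mulPr tens_mulPl IH IH'.
elim/tens_ind: Z => [|c Z Z' IH IH'|a'' b'']; first by rewrite !m0r.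
  by rewrite !tens_mulPr IH IH'.
by rewrite !tens_mul_ten !mulrA.
Qed.

Fact tens_mul1l : left_id (ten 1 1) tens_mul.
Proof.
move=> X; elim/tens_ind: X => [|c X X' IH IH'|a b].
- by have := tens_mulPr (-1) (ten 1 1) 0 0; rewrite !scaleN1r !addNr.
- by rewrite tens_mulPr IH IH'.
- by rewrite tens_mul_ten !mul1r.
Qed.
Fact tens_mul1r : right_id (ten 1 1) tens_mul.
Proof.
move=> X; elim/tens_ind: X => [|c X X' IH IH'|a b].
- by have := tens_mulPl (-1) 0 0 (ten 1 1); rewrite !scaleN1r !addNr.
- by rewrite tens_mulPl IH IH'.
- by rewrite tens_mul_ten !mulr1.
Qed.
Fact tens_mulDl : left_distributive tens_mul +%R.
Proof. by move=> X X' Y; have := tens_mulPl 1 X X' Y; rewrite !scale1r. Qed.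
Fact tens_mulDr : right_distributive tens_mul +%R.
Proof. by move=> X Y Y'; have := tens_mulPr 1 X Y Y'; rewrite !scale1r. Qed.
Fact tens_1_neq0 : ten 1 1 != 0.
Proof.
have nz (D : fdalg C) : exists t : bas D, bcoef t (1 : D) != 0.
  apply/existsP; apply: contraT; rewrite negb_exists => /forallP D0.
  have /eqP := oner_neq0 D; case; apply: bcoef_inj => t.
  by rewrite linear0; apply/eqP; have := D0 t; rewrite negbK.
have [s sA] := nz A; have [t tB] := nz B.
apply/eqP=> /ffunP/(_ (s, t)); rewrite !ffunE /=.
by apply/eqP; rewrite mulf_neq0.
Qed.

HB.instance Definition _ := GRing.Zmodule_isNzRing.Build (tens A B)
  tens_mulA tens_mul1l tens_mul1r tens_mulDl tens_mulDr tens_1_neq0.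

Fact tens_scaleAl (c : C) (X Y : tens A B) :
  c *: (X * Y : tens A B) = (c *: X : tens A B) * Y.
Proof.
have /= := tens_mulPl c X 0 Y; rewrite addr0 => /esym e; rewrite -[LHS]addr0.
have z : tens_mul 0 Y = 0.
  by have := tens_mulPl (-1) 0 0 Y; rewrite !scaleN1r !addNr.
by rewrite -[in LHS]z.
Qed.
HB.instance Definition _ :=
  GRing.Lmodule_isLalgebra.Build C (tens A B) tens_scaleAl.
Fact tens_scaleAr (c : C) (X Y : tens A B) : c *: (X * Y) = X * (c *: Y).
Proof.
have /= := tens_mulPr c X Y 0; rewrite addr0 => /esym e; rewrite -[LHS]addr0.
have z : tens_mul X 0 = 0.
  by have := tens_mulPr (-1) X 0 0; rewrite !scaleN1r !addNr.
by rewrite -[in LHS]z.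
Qed.
HB.instance Definition _ :=
  GRing.Lalgebra_isAlgebra.Build C (tens A B) tens_scaleAr.

Fact tens_starP c X Y :
  tens_star (c *: X + Y) = c^* *: tens_star X + tens_star Y.
Proof.
rewrite /tens_star scaler_sumr -big_split; apply: eq_bigr => p _ /=.
by rewrite !ffunE rmorphD rmorphM scalerDl scalerA.
Qed.
Fact tens_star_ten a b : tens_star (ten a b) = ten (star a) (star b).
Proof.
have starsum (D : fdalg C) (x : D) :
    star x = \sum_t (bcoef t x)^* *: star (bvec t).
  rewrite -{1}(bcoefK x); elim/big_rec2: _ => [|t y1 y2 _ e].
    by apply: (addrI (star (0 : D))); rewrite -starD !addr0.
  by rewrite starD starZ e.
rewrite (starsum _ a) (starsum _ b) ten_suml.
under eq_bigr => s _ do rewrite ten_sumr scaler_sumr.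
rewrite pair_big; apply: eq_bigr => p _.
by rewrite !ffunE rmorphM scalerA.
Qed.
Fact tens_star0 : tens_star 0 = 0.
Proof. by have := tens_starP (-1) 0 0; rewrite rmorphN1 !scaleN1r !addNr. Qed.
Fact tens_starZ (c : C) X : tens_star (c *: X) = c^* *: tens_star X.
Proof. by have := tens_starP c X 0; rewrite tens_star0 !addr0. Qed.
Fact tens_starD : {morph tens_star : X Y / X + Y}.
Proof. by move=> X Y; have := tens_starP 1 X Y; rewrite rmorph1 !scale1r. Qed.
Fact tens_starK : involutive tens_star.
Proof.
move=> X; elim/tens_ind: X => [|c X X' IH IH'|a b].
- by rewrite !tens_star0.
- by rewrite !tens_starP conjCK IH IH'.
- by rewrite !tens_star_ten !starK.
Qed.
Fact tens_starM X Y : tens_star (X * Y) = tens_star Y * tens_star X.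
Proof.
elim/tens_ind: X => [|c X X' IH IH'|a b].
- by rewrite mul0r tens_star0 mulr0.
- by rewrite mulrDl -scalerAl !tens_starP IH IH' mulrDr scalerAr.
elim/tens_ind: Y => [|c Y Y' IH IH'|a' b'].
- by rewrite mulr0 tens_star0 mul0r.
- by rewrite mulrDr -scalerAr !tens_starP IH IH' mulrDl scalerAl.
by rewrite [_ * _]tens_mul_ten !tens_star_ten [RHS]tens_mul_ten !starM.
Qed.
HB.instance Definition _ := hasStar.Build C (tens A B)
  tens_starK tens_starD tens_starZ tens_starM.

Let tcoef p (X : tens A B) : C := X p.
Let tvec (p : bas A * bas B) : tens A B := ten (bvec p.1) (bvec p.2).
Fact tcoef_linear p : linear_for *%R (tcoef p).
Proof. by move=> c X Y; rewrite /tcoef !ffunE. Qed.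
Fact tcoef_tvec p q : tcoef q (tvec p) = (p == q)%:R.
Proof. by rewrite /tcoef ffunE !bcoef_bvec -natrM mulnb. Qed.
Fact tcoefK X : \sum_p tcoef p X *: tvec p = X.
Proof. by rewrite -tensE. Qed.

Definition mten : fdalg C := FdAlg tcoef_linear tcoef_tvec tcoefK.

End Tensor.

(* The full algebraic product of a family of blocks.  It contains the
   l^oo-sum [bdd F] and the algebraic direct sum [fin F], and it is the
   multiplier algebra of the latter.  The index type is pointed only to make
   the product a nonzero ring. *)
Definition prodalg (C : numClosedFieldType) (I : pointedType)
  (F : I -> fdalg C) : Type := forall i, F i.

Section Product.
Variables (C : numClosedFieldType) (I : pointedType) (F : I -> fdalg C).

HB.instance Definition _ := gen_eqMixin (prodalg F).
HB.instance Definition _ := gen_choiceMixin (prodalg F).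

Let padd (x y : prodalg F) : prodalg F := fun i => x i + y i.
Let popp (x : prodalg F) : prodalg F := fun i => - x i.
Let pzero : prodalg F := fun i => 0.
Let pmul (x y : prodalg F) : prodalg F := fun i => x i * y i.
Let pone : prodalg F := fun i => 1.
Let pscale (c : C) (x : prodalg F) : prodalg F := fun i => c *: x i.
Let pstar (x : prodalg F) : prodalg F := fun i => star (x i).

Fact prod_addA : associative padd.
Proof. by move=> x y z; apply/functional_extensionality_dep=> i; exact: addrA. Qed.
Fact prod_addC : commutative padd.
Proof. by move=> x y; apply/functional_extensionality_dep=> i; exact: addrC. Qed.
Fact prod_add0 : left_id pzero padd.
Proof. by move=> x; apply/functional_extensionality_dep=> i; exact: add0r. Qed.
Fact prod_addN : left_inverse pzero popp padd.
Proof. by move=> x; apply/functional_extensionality_dep=> i; exact: addNr. Qed.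
HB.instance Definition _ := GRing.isZmodule.Build (prodalg F)
  prod_addA prod_addC prod_add0 prod_addN.

Fact prod_mulA : associative pmul.
Proof. by move=> x y z; apply/functional_extensionality_dep=> i; exact: mulrA. Qed.
Fact prod_mul1l : left_id pone pmul.
Proof. by move=> x; apply/functional_extensionality_dep=> i; exact: mul1r. Qed.
Fact prod_mul1r : right_id pone pmul.
Proof. by move=> x; apply/functional_extensionality_dep=> i; exact: mulr1. Qed.
Fact prod_mulDl : left_distributive pmul +%R.
Proof. by move=> x y z; apply/functional_extensionality_dep=> i; exact: mulrDl. Qed.
Fact prod_mulDr : right_distributive pmul +%R.
Proof. by move=> x y z; apply/functional_extensionality_dep=> i; exact: mulrDr. Qed.
Fact prod_1_neq0 : pone != 0.
Proof.
by apply/eqP=> /(congr1 (fun x : prodalg F => x point)) /eqP; rewrite (negbTE (oner_neq0 _)).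
Qed.
HB.instance Definition _ := GRing.Zmodule_isNzRing.Build (prodalg F)
  prod_mulA prod_mul1l prod_mul1r prod_mulDl prod_mulDr prod_1_neq0.

Fact prod_scaleA a b x : pscale a (pscale b x) = pscale (a * b) x.
Proof. by apply/functional_extensionality_dep=> i; exact: scalerA. Qed.
Fact prod_scale1 : left_id 1 pscale.
Proof. by move=> x; apply/functional_extensionality_dep=> i; exact: scale1r. Qed.
Fact prod_scaleDr : right_distributive pscale +%R.
Proof. by move=> c x y; apply/functional_extensionality_dep=> i; exact: scalerDr. Qed.
Fact prod_scaleDl x : {morph pscale^~ x : a b / a + b}.
Proof. by move=> a b; apply/functional_extensionality_dep=> i; exact: scalerDl. Qed.
HB.instance Definition _ := GRing.Zmodule_isLmodule.Build C (prodalg F)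
  prod_scaleA prod_scale1 prod_scaleDr prod_scaleDl.

Fact prod_scaleAl (c : C) (x y : prodalg F) : c *: (x * y) = c *: x * y.
Proof. by apply/functional_extensionality_dep=> i; exact: scalerAl. Qed.
HB.instance Definition _ :=
  GRing.Lmodule_isLalgebra.Build C (prodalg F) prod_scaleAl.
Fact prod_scaleAr (c : C) (x y : prodalg F) : c *: (x * y) = x * (c *: y).
Proof. by apply/functional_extensionality_dep=> i; exact: scalerAr. Qed.
HB.instance Definition _ :=
  GRing.Lalgebra_isAlgebra.Build C (prodalg F) prod_scaleAr.

Fact prod_starK : involutive pstar.
Proof. by move=> x; apply/functional_extensionality_dep=> i; exact: starK. Qed.
Fact prod_starD : {morph pstar : x y / x + y}.
Proof. by move=> x y; apply/functional_extensionality_dep=> i; exact: starD. Qed.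
Fact prod_starZ (c : C) x : pstar (c *: x) = c^* *: pstar x.
Proof. by apply/functional_extensionality_dep=> i; exact: starZ. Qed.
Fact prod_starM x y : pstar (x * y) = pstar y * pstar x.
Proof. by apply/functional_extensionality_dep=> i; exact: starM. Qed.
HB.instance Definition _ := hasStar.Build C (prodalg F)
  prod_starK prod_starD prod_starZ prod_starM.

End Product.

(* A von Neumann algebra is given as a *-subalgebra M of an ambient *-algebra.
   A map out of M is a function on the ambient algebra of which only the
   values on M matter. *)
Section Morphisms.
Variables (C : numClosedFieldType) (A B : starAlgType C).
Implicit Types (M D : set A) (N : set B) (f : A -> B).

Definition linear_on M f := forall (c : C) x y, M x -> M y ->
  f (c *: x + y) = c *: f x + f y.
Definition multiplicative_on M f := forall x y, M x -> M y ->
  f (x * y) = f x * f y.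
Definition star_on M f := forall x, M x -> f (star x) = star (f x).

End Morphisms.

Section Order.
Variables (C : numClosedFieldType) (A : starAlgType C).
Implicit Types (M D : set A) (x y : A).

Definition le_in M x y := exists2 z, M z & y - x = star z * z.
Definition selfadjoint M := [set x | M x /\ star x = x].
Definition projection M := [set p | [/\ M p, star p = p & p * p = p]].
Definition lub_in M D x :=
  [/\ selfadjoint M x, (forall d, D d -> le_in M d x)
    & forall y, selfadjoint M y -> (forall d, D d -> le_in M d y) -> le_in M x y].
Definition directed_in M D := D !=set0 /\
  forall x y, D x -> D y -> exists z, [/\ D z, le_in M x z & le_in M y z].

End Order.

Section Normality.
Variables (C : numClosedFieldType) (A B : starAlgType C).
Implicit Types (M : set A) (N : set B) (f : A -> B).

Definition normal_on M N f := forall (D : set A) x,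
  D `<=` selfadjoint M -> directed_in M D -> lub_in M D x ->
  lub_in N (f @` D) (f x).

(* unital normal *-homomorphism M -> N *)
Definition wmorphism M N f :=
  [/\ set_fun M N f, linear_on M f, multiplicative_on M f, star_on M f
    & f 1 = 1 /\ normal_on M N f].

End Normality.

Section States.
Variables (C : numClosedFieldType) (A : starAlgType C).

Definition normal_state (M : set A) (mu : A -> C^o) :=
  [/\ linear_on M mu, (forall x, M x -> 0 <= (mu (star x * x) : C)),
      mu 1 = 1 & normal_on M setT mu].

End States.

Section Families.
Variables (C : numClosedFieldType).

Definition op_fam (I : pointedType) (F : I -> fdalg C) : I -> fdalg C :=
  fun i => mop (F i).
Definition ten_fam (I J : pointedType) (F : I -> fdalg C) (G : J -> fdalg C) :
    (I * J)%type -> fdalg C :=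
  fun ij => mten (F ij.1) (G ij.2).

(* For the C*-norm of a block, |x| <= c iff x^* x <= c^2. *)
Definition bdd (I : pointedType) (F : I -> fdalg C) : set (prodalg F) :=
  [set x | exists2 c : C, 0 <= c &
    forall i, le_in setT (star (x i) * x i) ((c ^+ 2) *: 1)].

Definition fin (I : pointedType) (F : I -> fdalg C) : set (prodalg F) :=
  [set x | finite_set [set i | x i != 0]].

Section TwoLegs.
Variables (I J : pointedType) (F : I -> fdalg C) (G : J -> fdalg C).

Definition ten_el (x : prodalg F) (y : prodalg G) : prodalg (ten_fam F G) :=
  fun ij => ten (x ij.1) (y ij.2).

Definition entry (X : prodalg (ten_fam F G)) i j (s : bas (F i)) (t : bas (G j)) :
  C := bcoef ((s, t) : bas (mten (F i) (G j))) (X (i, j)).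

(* Slices of X along the coordinate functional of a basis vector of a block. *)
Definition slicel (X : prodalg (ten_fam F G)) j (t : bas (G j)) : prodalg F :=
  fun i => \sum_s entry X s t *: bvec s.
Definition slicer (X : prodalg (ten_fam F G)) i (s : bas (F i)) : prodalg G :=
  fun j => \sum_t entry X s t *: bvec t.

(* (eps (x) id) and (id (x) eps), after identifying C (x) M = M = M (x) C. *)
Definition ten_fun_l (eps : prodalg F -> C^o) (X : prodalg (ten_fam F G)) :
  prodalg G := fun j => \sum_t (eps (slicel X t) : C) *: bvec t.
Definition ten_fun_r (eps : prodalg G -> C^o) (X : prodalg (ten_fam F G)) :
  prodalg F := fun i => \sum_s (eps (slicer X s) : C) *: bvec s.

End TwoLegs.

(* (f (x) id) and (id (x) f).  Since each block of G is finite-dimensional, the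
   part of X lying over a block j of G is the finite sum of the
   slicel X t (x) bvec t, on which f (x) id is given by applying f to the
   slices; for f a normal *-homomorphism this is its von Neumann tensor product
   with the identity, and on finitely supported X it is the algebraic tensor
   product of linear maps. *)
Definition ten_map_l (I I' J : pointedType) (F : I -> fdalg C)
    (F' : I' -> fdalg C) (G : J -> fdalg C) (f : prodalg F -> prodalg F')
    (X : prodalg (ten_fam F G)) : prodalg (ten_fam F' G) :=
  fun ij => \sum_t ten (f (slicel X t) ij.1) (bvec t).
Definition ten_map_r (I J J' : pointedType) (F : I -> fdalg C)
    (G : J -> fdalg C) (G' : J' -> fdalg C) (f : prodalg G -> prodalg G')
    (X : prodalg (ten_fam F G)) : prodalg (ten_fam F G') :=
  fun ij => \sum_s ten (bvec s) (f (slicer X s) ij.2).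

(* The canonical identification (F (x) G) (x) H = F (x) (G (x) H). *)
Definition reassoc (I J K : pointedType) (F : I -> fdalg C) (G : J -> fdalg C)
    (H : K -> fdalg C) (X : prodalg (ten_fam (ten_fam F G) H)) :
    prodalg (ten_fam F (ten_fam G H)) :=
  fun k => \sum_(p : bas (ten_fam F (ten_fam G H) k))
    entry X ((p.1, p.2.1) : bas (ten_fam F G (k.1, k.2.1))) p.2.2 *: bvec p.

(* multiplication A (x) A -> A, a (x) b |-> a b *)
Definition mult_map (I : pointedType) (F : I -> fdalg C)
    (X : prodalg (ten_fam F F)) : prodalg F :=
  fun i => \sum_(p : bas (F i) * bas (F i))
    entry X p.1 p.2 *: (bvec p.1 * bvec p.2).

End Families.

Section DiscreteQuantumGroups.
Variables (C : numClosedFieldType) (I : pointedType) (n : I -> nat).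

(* M = l^oo-sum of the M_(n i + 1)(C) *)
Definition mat_fam : I -> fdalg C := fun i => matblock C (n i).

Local Notation M := mat_fam.
Local Notation MM := (ten_fam M M).
Local Notation Mop := (op_fam M).

Section Structure.
Variables (Delta : prodalg M -> prodalg MM) (eps : prodalg M -> C^o).

Definition discrete_quantum_monoid :=
  [/\ wmorphism (@bdd C I M) (@bdd C _ MM) Delta,
      wmorphism (@bdd C I M) setT eps,
      (forall x, bdd x ->
         reassoc (ten_map_l Delta (Delta x)) = ten_map_r Delta (Delta x)),
      (forall x, bdd x -> ten_fun_l eps (Delta x) = x)
    & (forall x, bdd x -> ten_fun_r eps (Delta x) = x)].

(* T is the linear map a (x) b |-> t a b, and it is a bijection of A (x) A *)
Definition bijective_extension (t : prodalg M -> prodalg M -> prodalg MM) :=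
  exists T : prodalg MM -> prodalg MM,
    [/\ linear_on (@fin C _ MM) T,
        (forall a b, fin a -> fin b -> T (ten_el a b) = t a b)
      & set_bij (@fin C _ MM) (@fin C _ MM) T].

(* Coassociativity is meant in the multiplier sense:
   (a (x) 1 (x) 1) (Delta (x) id)(Delta(b)(1 (x) c))
     = (id (x) Delta)((a (x) 1) Delta(b)) (1 (x) 1 (x) c). *)
Definition multiplier_hopf_star_algebra :=
  [/\ linear_on (@fin C I M) Delta,
      multiplicative_on (@fin C I M) Delta /\ star_on (@fin C I M) Delta,
      (forall a b c, fin a -> fin b -> fin c ->
         reassoc (ten_el (ten_el a 1) 1
                    * ten_map_l Delta (Delta b * ten_el 1 c))
         = ten_map_r Delta (ten_el a 1 * Delta b) * ten_el 1 (ten_el 1 c)),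
      bijective_extension (fun a b => Delta a * ten_el 1 b)
    & bijective_extension (fun a b => ten_el a 1 * Delta b)].

Definition is_counit :=
  [/\ linear_on (@fin C I M) eps, multiplicative_on (@fin C I M) eps,
      (forall a b, fin a -> fin b ->
         ten_fun_l eps (Delta a * ten_el 1 b) = a * b)
    & (forall a b, fin a -> fin b ->
         ten_fun_r eps (ten_el a 1 * Delta b) = a * b)].

Definition discrete_quantum_group :=
  [/\ discrete_quantum_monoid, multiplier_hopf_star_algebra & is_counit].

Definition is_antipode (S : prodalg M -> prodalg M) :=
  [/\ set_fun (@fin C I M) (@fin C I M) S, linear_on (@fin C I M) S,
      (forall a b, fin a -> fin b ->
         mult_map (ten_map_l S (Delta a * ten_el 1 b)) = (eps a : C) *: b)
    & (forall a b, fin a -> fin b ->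
         mult_map (ten_map_r S (ten_el a 1 * Delta b)) = (eps b : C) *: a)].

Definition kac_type := exists2 S, is_antipode S & star_on (@fin C I M) S.

End Structure.

(* Diagonal states on M (x) M^op and on M^op (x) M. *)
Definition diagonal_state_r (mu : prodalg (ten_fam M Mop) -> C^o) :=
  normal_state (@bdd C _ (ten_fam M Mop)) mu /\
  forall p : prodalg M, projection (@bdd C I M) p ->
    mu (ten_el p ((1 - p : prodalg M) : prodalg Mop)) = 0.
Definition diagonal_state_l (mu : prodalg (ten_fam Mop M) -> C^o) :=
  normal_state (@bdd C _ (ten_fam Mop M)) mu /\
  forall p : prodalg Mop, projection (@bdd C I Mop) p ->
    mu (ten_el p ((1 - p : prodalg Mop) : prodalg M)) = 0.

End DiscreteQuantumGroups.

(* Main.v *)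
From HB Require Import structures.
Require Import Defs.
From mathcomp Require Import all_boot all_order all_algebra.
From mathcomp Require Import all_classical reals.
From mathcomp Require Import complex.
From mathcomp Require Import mxtens spectral.
From mathcomp Require Import ring.

(** Let A be the algebra of finitely supported families and e the unit of the
    block on which the counit lives: that block has size 1 and
    a e = e a = eps(a) e.

    The antipode is read off Delta(e).  By surjectivity of the Galois map
    a (x) b |-> (a (x) 1) Delta(b), every X in A (x) A satisfies
    X Delta(e) = (m(id (x) S)(X) (x) 1) Delta(e): both sides agree on
    X = (a (x) 1) Delta(b), since Delta(b) Delta(e) = eps(b) Delta(e)
    ([push_right_leg]; [push_left_leg] is the mirror image).  In particular
    (a (x) b) Delta(e) = (a S(b) (x) 1) Delta(e).  By injectivity of the same
    map, (x (x) 1) Delta(e) = 0 forces x = 0.  Hence S is anti-multiplicative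
    ([antipodeM]) and, if it preserves the involution, S o S = id
    ([antipodeK]).

    From Kac type to a morphism.  S is then a *-anti-automorphism of A, so it
    permutes the central projections of the blocks and extends to the whole
    product ([ext]); the extension s is its own inverse, so it preserves
    suprema and is a W*-morphism ([ext_wmorphism]).  For a diagonal state mu and
    a projection p one has mu(X (p (x) 1)) = mu(X (1 (x) p)), because
    p (x) (1 - p) and (1 - p) (x) p are null projections ([diag_legs]).  So mu
    vanishes on the blocks (i, j) with i <> j, and on the block (i, i) it only
    depends on the product of the two legs.  For (s (x) id) Delta(e) that
    product is eps(e) 1 = 1, so normality of mu gives
    mu((s (x) id) Delta(e)) = 1 ([diag_proj1]), and then Delta(a) Delta(e) =
    eps(a) Delta(e) gives mu((s (x) id) Delta(a)) = eps(a) ([state_of_counit]).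

    From a morphism to Kac type.  For each block i, the functional sending X to
    the normalized trace of the product of the legs of X_(i,i) is a diagonal
    state w ([diag_vector_l], [diag_vector_r]); its normality rests on limits of
    bounded monotone nets of matrices ([matlike_limit]).  It satisfies
    w(X X^* ) = tr(m m^* ) where m is the product of the legs of X.  With
    X = (s (x) id) Delta(a), the hypothesis on w gives both tr(m) = eps(a) and
    tr(m m^* ) = eps(a a^* ) = |eps(a)|^2, so m has variance zero and
    m = eps(a) 1 ([legs_product_l]).  This is the antipode identity for s.  That
    s maps A to A follows from (1 (x) 1_i) Delta(e) being finitely supported
    ([morphism_fin]). *)

Set Implicit Arguments.
Unset Strict Implicit.
Unset Printing Implicit Defensive.

Import Order.TTheory GRing.Theory Num.Theory.

Local Open Scope classical_set_scope.
Local Open Scope ring_scope.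

(** * Star algebras *)

Section StarTheory.
Variables (C : numClosedFieldType) (A : starAlgType C).
Implicit Types x y : A.

Lemma star0 : star (0 : A) = 0.
Proof. by apply: (addrI (star (0 : A))); rewrite -starD !addr0. Qed.
Lemma starN x : star (- x) = - star x.
Proof. by apply: (addrI (star x)); rewrite -starD !subrr star0. Qed.
Lemma starB x y : star (x - y) = star x - star y.
Proof. by rewrite starD starN. Qed.
Lemma star1 : star (1 : A) = 1.
Proof. by rewrite -[LHS]mulr1 -{2}(starK 1) -starM mulr1 starK. Qed.
Lemma star_sum (J : Type) (r : seq J) (P : pred J) (u : J -> A) :
  star (\sum_(j <- r | P j) u j) = \sum_(j <- r | P j) star (u j).
Proof. by elim/big_rec2: _ => [|j y1 y2 _ <-]; rewrite ?star0 ?starD. Qed.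

Definition pos x := exists z, x = star z * z.

Lemma pos_starM x : pos (star x * x). Proof. by exists x. Qed.
Lemma pos0 : pos (0 : A). Proof. by exists 0; rewrite mulr0. Qed.
Lemma pos_herm x : pos x -> star x = x.
Proof. by case=> z ->; rewrite starM starK. Qed.
Lemma pos_conj x y : pos x -> pos (star y * x * y).
Proof. by case=> z ->; exists (z * y); rewrite starM !mulrA. Qed.
Lemma pos_scale (c : C) x : 0 <= c -> pos x -> pos (c *: x).
Proof.
move=> c0 [z ->]; exists (sqrtC c *: z).
by rewrite starZ -scalerAl -scalerAr scalerA geC0_conj ?sqrtC_ge0// -expr2 sqrtCK.
Qed.
Lemma pos_scale1 (c : C) : 0 <= c -> pos (c *: (1 : A)).
Proof. by move=> c0; apply: pos_scale => //; exists 1; rewrite star1 mulr1. Qed.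
Lemma le_inT x y : le_in setT x y <-> pos (y - x).
Proof. by split=> [[z _ ->]|[z ez]]; exists z. Qed.

End StarTheory.

(** * Positive matrices *)

Section ConjugateTranspose.
Variable C : numClosedFieldType.

Definition adjmx m n (h : 'M[C]_(m, n)) : 'M[C]_(n, m) := map_mx Num.conj h^T.

Lemma adjmxK m n (h : 'M[C]_(m, n)) : adjmx (adjmx h) = h.
Proof. by apply/matrixP=> i j; rewrite !mxE conjCK. Qed.
Lemma adjmxM m n p (h : 'M[C]_(m, n)) (k : 'M[C]_(n, p)) :
  adjmx (h *m k) = adjmx k *m adjmx h.
Proof. by rewrite /adjmx trmx_mul map_mxM. Qed.

End ConjugateTranspose.

Section PositiveMatrices.
Variables (C : numClosedFieldType) (n : nat).
Implicit Types (h : 'M[C]_n.+1) (v : 'rV[C]_n.+1).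

Definition qform h v : C := (v *m h *m adjmx v) 0 0.

Lemma starmxE h : star h = adjmx h. Proof. by []. Qed.

Lemma qformE h v : qform h v = \sum_i \sum_j v 0 i * h i j * (v 0 j)^*.
Proof.
rewrite /qform mxE exchange_big; apply: eq_bigr => j _.
by rewrite !mxE mulr_suml.
Qed.

Lemma qformB h k v : qform (h - k) v = qform h v - qform k v.
Proof. by rewrite /qform mulmxBr mulmxBl mxE [in X in _ + X]mxE. Qed.
Lemma qformD h k v : qform (h + k) v = qform h v + qform k v.
Proof. by rewrite /qform mulmxDr mulmxDl mxE. Qed.

Lemma qform_two h p q (w : C) :
  qform h (delta_mx 0 p + w *: delta_mx 0 q)
  = h p p + h q q * `|w| ^+ 2 + w^* * h p q + w * h q p.
Proof.
rewrite /qform /adjmx linearD linearZ /= map_mxD map_mxZ !trmx_delta !map_delta_mx.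
rewrite !mulmxDr !mulmxDl -!scalemxAr -!scalemxAl.
rewrite -!rowE -!colE !mxE normCK; ring.
Qed.

(** Summing over the fourth roots of unity extracts the coefficient of the
    conjugate; this is the polarization identity in the form used below. *)
Lemma sum_i4 (a b u w : C) :
  \sum_(k < 4) 'i ^+ k * (a + b * `|'i ^+ k| ^+ 2 + ('i ^+ k)^* * u + 'i ^+ k * w)
  = 4 * u.
Proof.
rewrite !big_ord_recl big_ord0 /= /bump /= !add1n.
have i2 : 'i ^+ 2 = -1 :> C := sqrCi C.
have -> : 'i ^+ 3 = - 'i :> C by rewrite exprS i2 mulrN1.
rewrite i2 expr0 expr1 !rmorphN /= !normrN normCi conjCi conjC1 normr1 expr1n.
transitivity (4 * u + ('i ^+ 2 + 1) * (2 * w - 2 * u)); first by ring.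
by rewrite i2 addNr mul0r addr0.
Qed.

Lemma qform_polar h p q :
  h p q = 4^-1 * \sum_(k < 4) 'i ^+ k *
     qform h (delta_mx 0 p + 'i ^+ k *: delta_mx 0 q).
Proof.
by under eq_bigr do rewrite qform_two; rewrite sum_i4 mulKf ?pnatr_eq0.
Qed.

(** The form is real at e_p + e_q and at e_p + i e_q, which gives the real and
    the imaginary part of the entry (p, q). *)
Lemma qform_ge0_herm h : (forall v, 0 <= qform h v) -> star h = h.
Proof.
move=> h0; apply/matrixP=> q p; rewrite starmxE !mxE.
have r w := CrealP (ger0_real (h0 (delta_mx 0 p + w *: delta_mx 0 q))).
have d i : (h i i)^* = h i i.
  apply: CrealP; apply: ger0_real.
  by have := h0 (delta_mx 0 i + 0 *: delta_mx 0 i);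
     rewrite qform_two conjC0 !(mul0r, normr0, addr0) expr0n mulr0 addr0.
have e1 := r 1; have ei := r 'i.
move: e1 ei; rewrite !qform_two !rmorphD !rmorphM /= !d conjCK conjCi conjC1.
rewrite normr1 normCi !expr1n conjC1 !mulr1 !mul1r => e1 ei.
have i0 : 'i != 0 :> C by exact: neq0Ci.
have {}e1 : (h p q)^* + (h q p)^* = h p q + h q p.
  by apply: (addrI (h p p + h q q)); rewrite !addrA.
have {}ei : (h p q)^* - (h q p)^* = h q p - h p q.
  apply: (mulfI i0); apply/eqP; rewrite -subr_eq0.
  by move/eqP: ei; rewrite -subr_eq0 rmorphN /= conjCi => /eqP <-; apply/eqP; ring.
have two0 : 2 != 0 :> C by rewrite pnatr_eq0.
apply: (mulfI two0).
rewrite -[LHS]/(2 * (h p q)^* ).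
have -> : 2 * (h p q)^* = ((h p q)^* + (h q p)^*) + ((h p q)^* - (h q p)^*) by ring.
by rewrite e1 ei; ring.
Qed.

(** Diagonalize: the eigenvalues are values of the form, so they have square
    roots. *)
Lemma posmxP h : pos h <-> forall v, 0 <= qform h v.
Proof.
split=> [[z ->] v|h0].
  rewrite /qform -mulmxE mulmxA -mulmxA starmxE.
  rewrite -[in z *m _](adjmxK z) -adjmxM.
  rewrite mxE; apply: sumr_ge0 => i _.
  by rewrite [X in _ * X]mxE [X in _ * X^*]mxE mul_conjC_ge0.
have hh := qform_ge0_herm h0.
have hn : h \is normalmx.
  by apply/normalmxP; rewrite -[map_mx _ _]/(adjmx h) -starmxE hh.
move/orthomx_spectralP: hn => hE.
set P := spectralmx h in hE; set sp := spectral_diag h in hE.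
have Pu : P \is unitarymx by exact: spectral_unitarymx.
have PP : P *m adjmx P = 1%:M.
  by move/unitarymxP: Pu.
rewrite invmx_unitary // -[map_mx _ _]/(adjmx P) in hE.
have sp0 i : 0 <= sp 0 i.
  have := h0 (row i P); rewrite /qform -row_mul.
  have -> : P *m h = diag_mx sp *m P.
    by rewrite {1}hE !mulmxA PP mul1mx.
  have -> : adjmx (row i P) = col i (adjmx P).
    by apply/matrixP=> a b; rewrite !mxE.
  have cm : P *m col i (adjmx P) = col i 1%:M by rewrite !colE mulmxA PP.
  rewrite row_mul -mulmxA cm row_diag_mx.
  by rewrite -scalemxAl -rowE !mxE !eqxx mulr1.
exists (diag_mx (map_mx sqrtC sp) *m P); rewrite starmxE adjmxM -mulmxE.
rewrite !mulmxA -(mulmxA (adjmx P)) {1}hE; congr (_ *m _ *m _).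
have -> : adjmx (diag_mx (map_mx sqrtC sp)) = diag_mx (map_mx sqrtC sp).
  apply/matrixP=> i j; rewrite !mxE eq_sym.
  case: eqVneq => [->|_]; last by rewrite !mulr0n conjC0.
  by rewrite !mulr1n geC0_conj ?sqrtC_ge0.
rewrite mulmx_diag; congr diag_mx; apply/rowP=> i.
by rewrite !mxE -expr2 sqrtCK.
Qed.

Lemma posmx_add h k : pos h -> pos k -> pos (h + k).
Proof. by rewrite !posmxP => h0 k0 v; rewrite qformD addr_ge0. Qed.

Lemma herm_qform_real h v : star h = h -> qform h v \is Num.real.
Proof.
move=> hh; apply/CrealP.
have : adjmx (v *m h *m adjmx v) = v *m h *m adjmx v.
  by rewrite !adjmxM adjmxK -starmxE hh mulmxA.
by move=> /matrixP /(_ 0 0); rewrite /adjmx [LHS]mxE [X in X^*]mxE.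
Qed.

Lemma qform1 v : qform 1 v = \sum_i `|v 0 i| ^+ 2.
Proof.
rewrite /qform mulmx1 mxE; apply: eq_bigr => i _.
by rewrite !mxE normCK.
Qed.

Lemma qformZ (c : C) h v : qform (c *: h) v = c * qform h v.
Proof. by rewrite /qform -scalemxAr -scalemxAl mxE. Qed.

(** The inequality 2|v_i||v_j| <= |v_i|^2 + |v_j|^2 bounds each term of the form. *)
Lemma hermmx_bounded h : star h = h ->
  pos ((\sum_i \sum_j `|h i j|) *: 1 - h).
Proof.
move=> hh; apply/posmxP=> v; rewrite qformB qformZ subr_ge0.
apply: le_trans (real_ler_norm (herm_qform_real v hh)) _.
rewrite qformE; apply: le_trans (ler_norm_sum _ _ _) _.
rewrite mulr_suml; apply: ler_sum => i _.
apply: le_trans (ler_norm_sum _ _ _) _.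
rewrite mulr_suml; apply: ler_sum => j _.
rewrite !normrM norm_conjC (mulrC `|v 0 i|) -mulrA ler_wpM2l //.
have bnd k : `|v 0 k| ^+ 2 <= qform 1 v.
  rewrite qform1 (bigD1 k) //= lerDl; apply: sumr_ge0 => l _; exact: exprn_ge0.
have : 0 <= (`|v 0 i| - `|v 0 j|) ^+ 2.
  by rewrite real_exprn_even_ge0 // rpredB // normr_real.
rewrite sqrrB => sq.
rewrite -(ler_pM2l (ltr0n C 2)).
apply: (@le_trans _ _ (`|v 0 i| ^+ 2 + `|v 0 j| ^+ 2)); last first.
  by rewrite mulr_natl mulr2n lerD.
by rewrite -subr_ge0; move: sq; congr (_ <= _); ring.
Qed.

Lemma mxfun_sum (f : 'M[C]_n.+1 -> C) : linear_for *%R f ->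
  forall h, f h = \sum_i \sum_j h i j * f (delta_mx i j).
Proof.
move=> fl h.
have f0 : f 0 = 0 by have := fl (-1) 0 0; rewrite scaler0 addr0 mulN1r addNr.
have fD x y : f (x + y) = f x + f y by have := fl 1 x y; rewrite scale1r mul1r.
have fZ c x : f (c *: x) = c * f x by have := fl c x 0; rewrite !addr0 f0 addr0.
rewrite {1}[h]matrix_sum_delta (big_morph f fD f0); apply: eq_bigr => i _.
by rewrite (big_morph f fD f0); apply: eq_bigr => j _; rewrite fZ.
Qed.

End PositiveMatrices.

Section ClosedHalfLine.
Variable C : numClosedFieldType.

Lemma small_eq0 (z : C) : (forall e, 0 < e -> `|z| <= e) -> z = 0.
Proof.
move=> ze; apply/eqP; rewrite -normr_le0; apply/negPn/negP=> z0.
have zp : 0 < `|z| by rewrite normr_gt0; apply: contraNneq z0 => ->; rewrite normr0.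
have := ze (`|z| / 2); rewrite divr_gt0 // => /(_ isT).
by rewrite ler_pdivlMr ?ltr0n // mulr_natr mulr2n gerDl (negbTE z0).
Qed.

Lemma ge0_closed (z : C) :
  (forall e, 0 < e -> exists2 w, 0 <= w & `|z - w| <= e) -> 0 <= z.
Proof.
move=> zw; suff -> : z = `|z| by [].
apply/eqP; rewrite -subr_eq0; apply/eqP/small_eq0 => e e0.
have [w w0 zwe] := zw (e / 2) (divr_gt0 e0 (ltr0n _ 2)).
have -> : z - `|z| = (z - w) + (`|w| - `|z|) by rewrite (ger0_norm w0); ring.
apply: le_trans (ler_normD _ _) _; rewrite (splitr e).
apply: lerD => //; apply: le_trans (ler_dist_dist _ _) _.
by rewrite distrC.
Qed.

End ClosedHalfLine.

(** * Monotone limits of matrices *)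

Section MonotoneLimit.
Variables (R : realType) (n : nat).
Local Notation C := R[i].
Local Notation Mat := 'M[C]_n.+1.
Implicit Types (D : set Mat) (d h L x : Mat).

Local Notation re := (@complex.Re R).
Local Notation toC r := (real_complex R r).

Lemma reK (z : C) : z \is Num.real -> toC (re z) = z.
Proof. by case: z => a b /complex_realP[r ->]. Qed.

(** The limit of a monotone family is defined entrywise, by polarization from
    the suprema of the quadratic forms. *)
Definition qsup D (v : 'rV[C]_n.+1) : C :=
  toC (sup [set re (qform d v) | d in D]).

Definition mxlim D : Mat :=
  \matrix_(p, q) (4^-1 * \sum_(k < 4) 'i ^+ k *
     qsup D (delta_mx 0 p + 'i ^+ k *: delta_mx 0 q)).

Hypotheses (D : set Mat) (x : Mat).
Hypothesis D0 : D !=set0.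
Hypothesis Dherm : forall d, D d -> star d = d.
Hypothesis Ddir : forall d e, D d -> D e ->
  exists f, [/\ D f, pos (f - d) & pos (f - e)].
Hypothesis Dx : forall d, D d -> pos (x - d).

Lemma pos_qform_le d h v : pos (h - d) -> qform d v <= qform h v.
Proof. by move=> /posmxP /(_ v); rewrite qformB subr_ge0. Qed.

Lemma qsup_has_sup v : has_sup [set re (qform d v) | d in D].
Proof.
split; first by case: D0 => d Dd; exists (re (qform d v)), d.
have [d0 Dd0] := D0; have hd := Dherm Dd0.
have xr : qform x v \is Num.real.
  rewrite -[x](subrK d0) qformD rpredD ?(herm_qform_real _ hd) //.
  by apply: ger0_real; move/posmxP: (Dx Dd0).
exists (re (qform x v)) => _ [d Dd <-].
by rewrite -lecR !reK ?(herm_qform_real _ (Dherm Dd)) //; apply: pos_qform_le; exact: Dx.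
Qed.

Lemma le_qsup d v : D d -> qform d v <= qsup D v.
Proof.
move=> Dd; rewrite -[X in X <= _]reK ?(herm_qform_real _ (Dherm Dd)) // lecR.
by apply: sup_upper_bound; [exact: qsup_has_sup | exists d].
Qed.

Lemma qsup_approx (e : R) v : 0 < e -> exists2 d, D d &
  qsup D v - qform d v <= toC e.
Proof.
move=> e0; have [_ [d Dd <-] le] := sup_adherent e0 (qsup_has_sup v).
exists d => //; rewrite -[qform d v]reK ?(herm_qform_real _ (Dherm Dd)) //.
by rewrite /qsup -rmorphB lecR lerBlDl addrC -lerBlDl ltW.
Qed.

(** Finitely many vectors are served by a single [d], by directedness. *)
Lemma qsup_approx_seq (e : R) (vs : seq 'rV[C]_n.+1) d0 : 0 < e -> D d0 ->
  exists2 d, D d & pos (d - d0) /\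
    {in vs, forall v, `|qsup D v - qform d v| <= toC e}.
Proof.
move=> e0 Dd0; elim: vs => [|v vs [d Dd [dd0 IH]]].
  by exists d0 => //; split=> [|v]; rewrite ?subrr; first exact: pos0.
have [d' Dd' le'] := qsup_approx v e0.
have [f [Df fd fd']] := Ddir Dd Dd'.
exists f => //; split.
  by rewrite -[f](subrK d) -addrA; exact: posmx_add.
have up w k : D k -> pos (f - k) -> qsup D w - qform k w <= toC e ->
    `|qsup D w - qform f w| <= toC e.
  move=> Dk fk; apply: le_trans.
  by rewrite ger0_norm ?subr_ge0 ?le_qsup // lerD2l lerN2 pos_qform_le.
move=> w; rewrite inE => /orP[/eqP->|/IH]; first exact: up le'.
by rewrite ger0_norm ?subr_ge0 ?le_qsup // => /(up _ _ Dd fd).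
Qed.

Lemma mxlim_approx (e : R) d0 : 0 < e -> D d0 ->
  exists2 d, D d & pos (d - d0) /\
    forall p q, `|mxlim D p q - d p q| <= toC e.
Proof.
move=> e0 Dd0.
pose w (t : 'I_n.+1 * 'I_n.+1 * 'I_4) : 'rV[C]_n.+1 :=
  delta_mx 0 t.1.1 + 'i ^+ t.2 *: delta_mx 0 t.1.2.
have [d Dd [dd0 le]] := qsup_approx_seq [seq w t | t : 'I_n.+1 * 'I_n.+1 * 'I_4] e0 Dd0.
exists d => //; split=> // p q.
rewrite (qform_polar d) mxE -mulrBr -sumrB normrM normfV normr_nat.
rewrite ler_pdivrMl ?ltr0n // mulr_natl.
apply: le_trans (ler_norm_sum _ _ _) _.
rewrite -[X in _ *+ X](card_ord 4) -sumr_const; apply: ler_sum => k _.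
rewrite -mulrBr normrM normrX normCi expr1n mul1r.
by apply: (le _ (map_f w (mem_enum _ (p, q, k)))).
Qed.

(** A linear functional is continuous for the entrywise distance, so closed
    conditions on the members of [D] beyond [d0] pass to the limit. *)
Lemma mxlim_ge0 (f : Mat -> C) (c : C) d0 : linear_for *%R f -> D d0 ->
  (forall d, D d -> pos (d - d0) -> 0 <= f d + c) -> 0 <= f (mxlim D) + c.
Proof.
move=> fl Dd0 fd; apply: ge0_closed => e e0.
pose K := \sum_i \sum_j `|f (delta_mx i j)|.
have K0 : 0 <= K by apply: sumr_ge0 => i _; apply: sumr_ge0.
have er : e \is Num.real by exact: gtr0_real.
have Kr : K \is Num.real by exact: ger0_real.
have K1 : 0 < K + 1 by rewrite ltr_wpDl.
pose r := re (e / (K + 1)).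
have rE : toC r = e / (K + 1).
  by rewrite reK // rpredM ?rpredV // rpredD // rpred1.
have r0 : 0 < r by rewrite -ltcR rE divr_gt0.
have [d Dd [dd0 le]] := mxlim_approx r0 Dd0.
exists (f d + c); first exact: fd.
rewrite opprD addrACA subrr addr0 !(mxfun_sum fl) -sumrB.
apply: (@le_trans _ _ (K * toC r)); last first.
  by rewrite rE mulrCA ger_pMr // ler_pdivrMr // mul1r lerDl.
apply: le_trans (ler_norm_sum _ _ _) _; rewrite mulr_suml.
apply: ler_sum => i _; rewrite -sumrB.
apply: le_trans (ler_norm_sum _ _ _) _; rewrite mulr_suml.
by apply: ler_sum => j _; rewrite -mulrBl normrM mulrC ler_wpM2l.
Qed.

Lemma qform_linear v : linear_for *%R (fun h : Mat => qform h v).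
Proof. by move=> c h k; rewrite qformD qformZ. Qed.

Lemma mxlim_ub d : D d -> pos (mxlim D - d).
Proof.
move=> Dd; apply/posmxP=> v; rewrite qformB.
apply: (mxlim_ge0 (qform_linear v) Dd) => d' _ /posmxP /(_ v).
by rewrite qformB.
Qed.

Lemma mxlim_le (f : Mat -> C) y : linear_for *%R f ->
  (forall d, D d -> f d <= y) -> f (mxlim D) <= y.
Proof.
move=> fl fy; have [d0 Dd0] := D0; rewrite -subr_ge0 addrC.
have gl : linear_for *%R (fun h => - f h).
  by move=> c h k; rewrite fl opprD mulrN.
by apply: (mxlim_ge0 gl Dd0) => d Dd _; rewrite addrC subr_ge0 fy.
Qed.

End MonotoneLimit.

(** * Blocks isomorphic to a full matrix algebra *)

Definition star_iso (C : numClosedFieldType) (A : starAlgType C) n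
    (f : A -> 'M[C]_n.+1) (g : 'M[C]_n.+1 -> A) :=
  [/\ cancel f g /\ cancel g f,
      (forall c x y, f (c *: x + y) = c *: f x + f y),
      (forall x y, f (x * y) = f x * f y)
    & forall x, f (star x) = star (f x)].

(** Positivity in a block (sums of squares are squares, hermitian elements are
    bounded, monotone limits exist) is transported from matrices along any such
    isomorphism; this covers opposites and tensor products. *)
Definition matlike (C : numClosedFieldType) (A : starAlgType C) :=
  exists n f g, @star_iso C A n f g.

Section StarIso.
Variables (C : numClosedFieldType) (A : starAlgType C) (n : nat).
Variables (f : A -> 'M[C]_n.+1) (g : 'M[C]_n.+1 -> A).
Hypothesis fg : star_iso f g.

Let fK : cancel f g. Proof. by case: fg => -[]. Qed.
Let gK : cancel g f. Proof. by case: fg => -[]. Qed.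
Let fL c x y : f (c *: x + y) = c *: f x + f y. Proof. by case: fg. Qed.
Let fM x y : f (x * y) = f x * f y. Proof. by case: fg. Qed.
Let fS x : f (star x) = star (f x). Proof. by case: fg. Qed.

Lemma iso0 : f 0 = 0.
Proof. by have := fL (-1) 0 0; rewrite scaler0 addr0 scaleN1r addNr. Qed.
Lemma isoD x y : f (x + y) = f x + f y.
Proof. by have := fL 1 x y; rewrite !scale1r. Qed.
Lemma isoZ c x : f (c *: x) = c *: f x.
Proof. by have := fL c x 0; rewrite !addr0 iso0 addr0. Qed.
Lemma isoB x y : f (x - y) = f x - f y.
Proof. by rewrite -scaleN1r addrC fL addrC scaleN1r. Qed.
Lemma iso1 : f 1 = 1.
Proof. by rewrite -[LHS]mulr1 -{1}(gK 1) -fM mul1r gK. Qed.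

Lemma iso_pos x : pos (f x) <-> pos x.
Proof.
split=> -[z]; last by move=> ->; exists (f z); rewrite fM fS.
move=> e; exists (g z); apply: (can_inj fK).
by rewrite e fM fS gK.
Qed.

Lemma iso_mop : matlike (opalg A).
Proof.
exists n, (fun x : opalg A => (f x)^T), (fun h => g h^T); split.
- by split=> x; rewrite ?trmxK ?fK ?gK ?trmxK.
- by move=> c x y; rewrite fL linearP.
- by move=> x y; rewrite opalgM fM -!mulmxE trmx_mul.
- by move=> x; rewrite fS; apply/matrixP=> i j; rewrite !mxE.
Qed.

End StarIso.

Lemma matlike_mop (C : numClosedFieldType) (A : fdalg C) :
  matlike A -> matlike (mop A).
Proof. by case=> n [f [g]]; exact: iso_mop. Qed.

Lemma matlike_matblock (C : numClosedFieldType) n : matlike (matblock C n).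
Proof. by exists n, id, id. Qed.

(** The Kronecker product identifies a tensor product of full matrix algebras
    with a full matrix algebra. *)
Section TensorIso.
Variables (C : numClosedFieldType) (A B : fdalg C) (m n : nat).
Variables (f : A -> 'M[C]_m.+1) (g : 'M[C]_m.+1 -> A).
Variables (f' : B -> 'M[C]_n.+1) (g' : 'M[C]_n.+1 -> B).
Hypotheses (fg : star_iso f g) (fg' : star_iso f' g').

Let N := (n + m * n.+1)%N.

Definition kron (X : tens A B) : 'M[C]_N.+1 :=
  \sum_p X p *: (tensmx (f (bvec p.1)) (f' (bvec p.2)) : 'M[C]_N.+1).
Definition unkron (h : 'M[C]_N.+1) : tens A B :=
  \sum_(i : 'I_m.+1 * 'I_n.+1) \sum_(j : 'I_m.+1 * 'I_n.+1)
    (h : 'M_(m.+1 * n.+1)) (mxtens_index i) (mxtens_index j)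
      *: ten (g (delta_mx i.1 j.1)) (g' (delta_mx i.2 j.2)).

Lemma kronP c X Y : kron (c *: X + Y) = c *: kron X + kron Y.
Proof.
rewrite /kron scaler_sumr -big_split; apply: eq_bigr => p _.
by rewrite !ffunE scalerDl scalerA.
Qed.

Lemma kron_ten a b : kron (ten a b) = tensmx (f a) (f' b).
Proof.
have f0 := iso0 fg; have fD := isoD fg; have fZ := isoZ fg.
have f0' := iso0 fg'; have fD' := isoD fg'; have fZ' := isoZ fg'.
apply/matrixP=> i j; rewrite /kron summxE mxE.
rewrite -{2}(bcoefK a) -{2}(bcoefK b).
rewrite (big_morph f fD f0) (big_morph f' fD' f0') !summxE big_distrlr pair_big /=.
apply: eq_bigr => p _; rewrite ffunE fZ fZ' !mxE.
by rewrite mulrACA.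
Qed.

Lemma unkronP c h k : unkron (c *: h + k) = c *: unkron h + unkron k.
Proof.
rewrite /unkron scaler_sumr -big_split; apply: eq_bigr => i _ /=.
rewrite scaler_sumr -big_split; apply: eq_bigr => j _ /=.
by rewrite !mxE scalerDl scalerA.
Qed.

Lemma kron0 : kron 0 = 0.
Proof. by have := kronP (-1) 0 0; rewrite scaler0 addr0 scaleN1r addNr. Qed.
Lemma unkron0 : unkron 0 = 0.
Proof. by have := unkronP (-1) 0 0; rewrite scaler0 addr0 scaleN1r addNr. Qed.

Lemma unkron_tens (h : 'M_m.+1) (k : 'M_n.+1) : unkron (tensmx h k) = ten (g h) (g' k).
Proof.
have gP (c : C) x y : g (c *: x + y) = c *: g x + g y.
  case: fg => -[fK gK] fL _ _; apply: (can_inj fK).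
  by rewrite fL !gK.
have gP' (c : C) x y : g' (c *: x + y) = c *: g' x + g' y.
  case: fg' => -[fK gK] fL _ _; apply: (can_inj fK).
  by rewrite fL !gK.
have gE (x : 'M_m.+1) : g x = \sum_p x p.1 p.2 *: g (delta_mx p.1 p.2).
  have g0 : g 0 = 0 by have := gP (-1) 0 0; rewrite scaler0 addr0 scaleN1r addNr.
  rewrite {1}[x]matrix_sum_delta pair_big /=.
  by elim/big_rec2: _ => [|p y z _ <-]; rewrite ?gP.
have gE' (x : 'M_n.+1) : g' x = \sum_p x p.1 p.2 *: g' (delta_mx p.1 p.2).
  have g0 : g' 0 = 0 by have := gP' (-1) 0 0; rewrite scaler0 addr0 scaleN1r addNr.
  rewrite {1}[x]matrix_sum_delta pair_big /=.
  by elim/big_rec2: _ => [|p y z _ <-]; rewrite ?gP'.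
rewrite (gE h) (gE' k) ten_suml.
under [RHS]eq_bigr do rewrite ten_sumr scaler_sumr.
rewrite /unkron !pair_big /=.
rewrite (reindex (fun q : ('I_m.+1 * 'I_m.+1) * ('I_n.+1 * 'I_n.+1) =>
   ((q.1.1, q.2.1), (q.1.2, q.2.2)))) /=; last first.
  by exists (fun q => ((q.1.1, q.2.1), (q.1.2, q.2.2))) => -[[? ?] [? ?]].
by apply: eq_bigr => q _; rewrite tensmxE scalerA.
Qed.

Lemma kron_iso : @star_iso C (tens A B) N kron unkron.
Proof.
have k0 := kron0; have kP := kronP.
have kD X Y : kron (X + Y) = kron X + kron Y.
  by have := kP 1 X Y; rewrite !scale1r.
have kZ c X : kron (c *: X) = c *: kron X by have := kP c X 0; rewrite !addr0 k0 addr0.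
case: fg fg' => -[fK gK] _ fM fS [[fK' gK'] _ fM' fS'].
split=> //; first split.
- move=> X; elim/tens_ind: X => [|c X Y IHX IHY|a b].
  + by rewrite k0 unkron0.
  + by rewrite kP unkronP IHX IHY.
  + by rewrite kron_ten unkron_tens fK fK'.
- move=> h; rewrite /unkron (big_morph kron kD k0) /=.
  transitivity (\sum_(i : 'I_(m.+1 * n.+1)) \sum_(j : 'I_(m.+1 * n.+1)) h i j *: (delta_mx i j : 'M[C]_N.+1)); last first.
    by rewrite [RHS]matrix_sum_delta.
  rewrite [RHS](reindex (@mxtens_index m.+1 n.+1)) /=; last first.
    by exists (@mxtens_unindex _ _) => k _; rewrite (mxtens_indexK, mxtens_unindexK).
  apply: eq_bigr => i _; rewrite (big_morph kron kD k0).
  rewrite [RHS](reindex (@mxtens_index m.+1 n.+1)) /=; last first.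
    by exists (@mxtens_unindex _ _) => k _; rewrite (mxtens_indexK, mxtens_unindexK).
  apply: eq_bigr => j _; rewrite kZ kron_ten gK gK'; congr (_ *: _).
  apply/matrixP=> s t.
  case: (mxtens_indexP (s : 'I_(m.+1 * n.+1))) => s1 s2.
  case: (mxtens_indexP (t : 'I_(m.+1 * n.+1))) => t1 t2.
  rewrite !mxE !mxtens_indexK !(can_eq (@mxtens_indexK _ _)).
  by case: i j => [i1 i2] [j1 j2]; rewrite !xpair_eqE -natrM mulnb andbACA.
- move=> X Y; elim/tens_ind: X => [|c X X' IH IH'|a b].
  + by rewrite mul0r k0 mul0r.
  + by rewrite mulrDl -scalerAl !kP IH IH' mulrDl scalerAl.
  elim/tens_ind: Y => [|c Y Y' IH IH'|a' b'].
  + by rewrite mulr0 k0 mulr0.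
  + by rewrite mulrDr -scalerAr !kP IH IH' mulrDr scalerAr.
  by rewrite [_ * _]tens_mul_ten !kron_ten fM fM' -!mulmxE; rewrite (tensmx_mul (f a) (f' b) (f a') (f' b')).
- elim/tens_ind => [|c X X' IH IH'|a b].
  + by rewrite star0 k0 star0.
  + by rewrite starD starZ !kP IH IH' starD starZ.
  rewrite [star _]tens_star_ten !kron_ten fS fS'.
  by apply/matrixP=> s t; rewrite !mxE rmorphM.
Qed.

End TensorIso.

Lemma matlike_mten (C : numClosedFieldType) (A B : fdalg C) :
  matlike A -> matlike B -> matlike (mten A B).
Proof.
move=> [m [f [g fg]]] [n [f' [g' fg']]].
exists (n + m * n.+1)%N, (kron f f'), (unkron g g'); exact: kron_iso.
Qed.

Section MatlikeTheory.
Variables (C : numClosedFieldType) (A : starAlgType C).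
Hypothesis Am : matlike A.
Implicit Types x y h : A.

Lemma pos_add x y : pos x -> pos y -> pos (x + y).
Proof.
have [n [f [g fg]]] := Am.
rewrite -(iso_pos fg x) -(iso_pos fg y) -(iso_pos fg (x + y)) (isoD fg).
exact: posmx_add.
Qed.

Lemma herm_bounded h : star h = h -> exists2 c : C, 0 <= c & pos (c *: 1 - h).
Proof.
have [n [f [g fg]]] := Am => hh.
exists (\sum_i \sum_j `|f h i j|).
  by apply: sumr_ge0 => i _; apply: sumr_ge0.
apply/(iso_pos fg); rewrite (isoB fg) (isoZ fg) (iso1 fg).
by apply: hermmx_bounded; case: fg => _ _ _ <-; rewrite hh.
Qed.

Lemma block_bounded x : exists2 c : C, 0 <= c & pos (c ^+ 2 *: 1 - star x * x).
Proof.
have [c c0 cx] : exists2 c : C, 0 <= c & pos (c *: 1 - star x * x).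
  by apply: herm_bounded; rewrite starM starK.
by exists (sqrtC c); rewrite ?sqrtC_ge0 ?sqrtCK.
Qed.

End MatlikeTheory.

(** The witness [L] is the norm limit.  Linear functionals of a block are norm
    continuous, hence the bound on each of them, which determines the limit without
    mentioning a norm. *)
Lemma matlike_limit (R : realType) (A : starAlgType R[i]) (D : set A) (x : A) :
  matlike A -> D !=set0 -> (forall d, D d -> star d = d) ->
  (forall d e, D d -> D e -> exists f, [/\ D f, pos (f - d) & pos (f - e)]) ->
  (forall d, D d -> pos (x - d)) ->
  exists L, (forall d, D d -> pos (L - d)) /\
    (forall (w : A -> R[i]) y, linear_for *%R w ->
       (forall d, D d -> w d <= y) -> w L <= y).
Proof.
case=> n [f [g fg]] [d0 Dd0] Dh Ddir Dx.
have [[fK gK] fL fM fS] := fg.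
have fp u v : pos (u - v) -> pos (f u - f v) by rewrite -(isoB fg) (iso_pos fg).
have D0' : f @` D !=set0 by exists (f d0), d0.
have Dh' d : (f @` D) d -> star d = d.
  by case=> e De <-; rewrite -fS Dh.
have Ddir' d e : (f @` D) d -> (f @` D) e ->
    exists k, [/\ (f @` D) k, pos (k - d) & pos (k - e)].
  move=> [d' Dd' <-] [e' De' <-]; have [k [Dk kd ke]] := Ddir _ _ Dd' De'.
  by exists (f k); split; [exists k | exact: fp | exact: fp].
have Dx' d : (f @` D) d -> pos (f x - d).
  by case=> e De <-; apply: fp; exact: Dx.
exists (g (mxlim (f @` D))); split=> [d Dd|w y wl wy].
  apply/(iso_pos fg); rewrite (isoB fg) gK.
  by apply: (mxlim_ub D0' Dh' Ddir' Dx'); exists d.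
have gl : linear_for *%R (w \o g).
  move=> c h k /=; rewrite -wl; congr w.
  by apply: (can_inj fK); rewrite fL !gK.
apply: (@mxlim_le R n (f @` D) (f x) D0' Dh' Ddir' Dx' (w \o g) y gl).
by move=> _ [d Dd <-] /=; rewrite fK; exact: wy.
Qed.

Section ProductFamily.
Variables (C : numClosedFieldType) (I : pointedType) (F : I -> fdalg C).
Implicit Types x y z : prodalg F.

Lemma prod_ext x y : (forall i, x i = y i) -> x = y.
Proof. exact: functional_extensionality_dep. Qed.

Lemma prodM x y i : (x * y) i = x i * y i. Proof. by []. Qed.
Lemma prodD x y i : (x + y) i = x i + y i. Proof. by []. Qed.
Lemma prodN x i : (- x) i = - x i. Proof. by []. Qed.
Lemma prodZ c x i : (c *: x) i = c *: x i. Proof. by []. Qed.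
Lemma prodS x i : (star x) i = star (x i). Proof. by []. Qed.
Lemma prod0 i : (0 : prodalg F) i = 0. Proof. by []. Qed.
Lemma prod1 i : (1 : prodalg F) i = 1. Proof. by []. Qed.
Definition prodE := (prodM, prodD, prodN, prodZ, prodS, prod0, prod1).
Lemma prod_sum (K : Type) (r : seq K) (P : pred K) (u : K -> prodalg F) i :
  (\sum_(k <- r | P k) u k) i = \sum_(k <- r | P k) u k i.
Proof. by elim/big_rec2: _ => // k y1 y2 _ <-. Qed.

Definition blk i (a : F i) : prodalg F :=
  @dfwith I (fun k => F k : Type) (fun k => 0) i a.

Lemma blkE i (a : F i) : blk a i = a. Proof. exact: dfwith_in. Qed.
Lemma blk_out i j (a : F i) : i != j -> blk a j = 0.
Proof. exact: dfwith_out. Qed.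
Lemma blkP i (a : F i) x :
  x i = a -> (forall j, i != j -> x j = 0) -> blk a = x.
Proof.
move=> xi xj; apply: prod_ext => j; have [<-|ij] := eqVneq i j.
  by rewrite blkE xi.
by rewrite blk_out // xj.
Qed.

Lemma blk_lin i c (a b : F i) : blk (c *: a + b) = c *: blk a + blk b.
Proof.
by apply: blkP => [|j ij]; rewrite !prodE ?blkE // !blk_out // scaler0 addr0.
Qed.
Lemma blk0 i : blk (0 : F i) = 0. Proof. exact: blkP. Qed.
Lemma blkM i (a b : F i) : blk a * blk b = blk (a * b).
Proof.
by apply/esym/blkP => [|j ij]; rewrite !prodE ?blkE // !blk_out // mulr0.
Qed.
Lemma blkS i (a : F i) : star (blk a) = blk (star a).
Proof.
by apply/esym/blkP => [|j ij]; rewrite !prodE ?blkE // !blk_out // star0.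
Qed.
Lemma Mblk i (a : F i) x : x * blk a = blk (x i * a).
Proof.
by apply/esym/blkP => [|j ij]; rewrite !prodE ?blkE // !blk_out // mulr0.
Qed.
Lemma blkMl i (a : F i) x : blk a * x = blk (a * x i).
Proof.
by apply/esym/blkP => [|j ij]; rewrite !prodE ?blkE // !blk_out // mul0r.
Qed.

(** ** Finitely supported families *)

Lemma fin0 : fin (0 : prodalg F).
Proof.
rewrite /fin /= (_ : [set _ | _] = set0); first exact: finite_set0.
by apply/seteqP; split=> // i /=; rewrite eqxx.
Qed.

Lemma fin_sub x y : (forall i, x i = 0 -> y i = 0) -> fin x -> fin y.
Proof.
move=> xy; apply: sub_finite_set => i /=.
by apply: contra_neq; exact: xy.
Qed.

Lemma finMl x y : fin y -> fin (x * y).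
Proof. by apply: fin_sub => i; rewrite prodM => ->; rewrite mulr0. Qed.
Lemma finMr x y : fin x -> fin (x * y).
Proof. by apply: fin_sub => i; rewrite prodM => ->; rewrite mul0r. Qed.
Lemma finS x : fin x -> fin (star x).
Proof. by apply: fin_sub => i; rewrite prodS => ->; rewrite star0. Qed.

Lemma fin_lin c x y : fin x -> fin y -> fin (c *: x + y).
Proof.
move=> xf yf; have : finite_set ([set i | x i != 0] `|` [set i | y i != 0]).
  by rewrite finite_setU.
apply: sub_finite_set => i /=; rewrite !prodE => n0.
case: (eqVneq (x i) 0) => xi; last by left.
by right; move: n0; rewrite xi scaler0 add0r.
Qed.

Lemma fin_blk i (a : F i) : fin (blk a).
Proof.
apply: sub_finite_set (finite_set1 i) => j /=.
move=> aj; apply/esym/eqP; apply: contraNT aj => ij.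
by rewrite blk_out // eqxx.
Qed.

Lemma fin_ind (P : prodalg F -> Prop) : P 0 ->
  (forall c x y, fin x -> fin y -> P x -> P y -> P (c *: x + y)) ->
  (forall i (a : F i), P (blk a)) -> forall x, fin x -> P x.
Proof.
move=> P0 PD Pb x /finite_seqP[s xs].
have {xs} : forall i, x i != 0 -> i \in s.
  by move=> i xi; have : [set i | x i != 0] i by []; rewrite xs.
elim: s x => [|i s IH] x xs.
  rewrite (_ : x = 0) //; apply: prod_ext => i.
  by apply/eqP; apply: contraT => /xs.
have e : x = 1 *: blk (x i) + (x - blk (x i)) by rewrite scale1r addrC subrK.
have ys j : (x - blk (x i)) j != 0 -> j \in s.
  rewrite !prodE; have [<-|ij] := eqVneq i j; first by rewrite blkE subrr eqxx.
  by rewrite blk_out // subr0 => /xs; rewrite inE eq_sym (negbTE ij).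
rewrite e; apply: PD; [exact: fin_blk| |exact: Pb|exact: IH].
apply/(@sub_finite_set _ _ [set` s]); first by move=> j /= /ys.
exact: finite_seq.
Qed.

End ProductFamily.

Arguments blk {C I F i} a.

(** ** Bounded families of matrix-like blocks *)

Section Bounded.
Variables (C : numClosedFieldType) (I : pointedType) (F : I -> fdalg C).
Hypothesis Fm : forall i, matlike (F i).
Implicit Types x y z p : prodalg F.
Local Notation bdd := (@bdd C I F).
Local Notation fin := (@fin C I F).

Lemma bddP x : bdd x <->
  exists2 c : C, 0 <= c & forall i, pos (c *: 1 - star (x i) * x i).
Proof.
split=> -[c c0 cx].
  exists (c ^+ 2) => [|i]; first exact: exprn_ge0.
  exact/le_inT/cx.
exists (sqrtC c); first by rewrite sqrtC_ge0.
by move=> i; apply/le_inT; rewrite sqrtCK.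
Qed.

Lemma bdd0 : bdd 0.
Proof.
apply/bddP; exists 0 => // i.
by rewrite prodE mulr0 scale0r subrr; exact: pos0.
Qed.

Lemma parallelogram (A : starAlgType C) (u v : A) :
  2 *: (star u * u) + 2 *: (star v * v) =
  star (u + v) * (u + v) + star (u - v) * (u - v).
Proof.
rewrite starD starB !mulrDl !mulrDr !mulNr !mulrN opprK.
rewrite [RHS]addrACA [X in _ = X + _]addrACA [X in _ = _ + X]addrACA.
by rewrite !subrr addr0 add0r -!mulr2n -!scaler_nat.
Qed.

(** The parallelogram law bounds a sum. *)
Lemma bddD x y : bdd x -> bdd y -> bdd (x + y).
Proof.
move=> /bddP[a a0 ax] /bddP[b b0 bx]; apply/bddP.
exists (2 * a + 2 * b) => [|i]; first by rewrite addr_ge0 ?mulr_ge0.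
have -> : (2 * a + 2 * b) *: 1 - star ((x + y) i) * (x + y) i =
   2 *: (a *: 1 - star (x i) * x i) + 2 *: (b *: 1 - star (y i) * y i)
   + star (x i - y i) * (x i - y i).
  rewrite prodE !scalerBr !scalerA scalerDl [X in _ = X + _]addrACA -opprD.
  by rewrite parallelogram opprD -!addrA addNr addr0.
by do !apply: pos_add => //; [exact: pos_scale|exact: pos_scale|exact: pos_starM].
Qed.

Lemma bddZ c x : bdd x -> bdd (c *: x).
Proof.
move=> /bddP[a a0 ax]; apply/bddP.
exists (`|c| ^+ 2 * a) => [|i]; first by rewrite mulr_ge0 // exprn_ge0.
rewrite prodE starZ -scalerAl -scalerAr scalerA -normCKC -scalerA -scalerBr.
by apply: pos_scale => //; exact: exprn_ge0.
Qed.

Lemma bdd_lin c x y : bdd x -> bdd y -> bdd (c *: x + y).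
Proof. by move=> bx by_; apply: bddD => //; exact: bddZ. Qed.

Lemma bddN x : bdd x -> bdd (- x).
Proof. by rewrite -scaleN1r; exact: bddZ. Qed.

Lemma bddB x y : bdd x -> bdd y -> bdd (x - y).
Proof. by move=> bx by_; apply: bddD => //; exact: bddN. Qed.

Lemma bddM x y : bdd x -> bdd y -> bdd (x * y).
Proof.
move=> /bddP[a a0 ax] /bddP[b b0 bx]; apply/bddP.
exists (a * b) => [|i]; first exact: mulr_ge0.
have -> : (a * b) *: 1 - star ((x * y) i) * (x * y) i =
   a *: (b *: 1 - star (y i) * y i)
   + star (y i) * (a *: 1 - star (x i) * x i) * y i.
  rewrite prodE starM scalerBr scalerA mulrBr mulrBl -scalerAr mulr1 -scalerAl.
  by rewrite addrA subrK !mulrA.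
by apply: pos_add => //; [exact: pos_scale | exact: pos_conj].
Qed.

(** With h = x x^* and x^* x <= a one has h^2 <= a h, whence
    a (a - h) = (a - h)^2 + (a h - h^2) >= 0. *)
Lemma bddS x : bdd x -> bdd (star x).
Proof.
move=> /bddP[a a0 ax]; apply/bddP.
(* The bound must be invertible, hence [a + 1]. *)
exists (a + 1) => [|i]; first exact: addr_ge0.
have a1 : 0 < a + 1 by rewrite ltr_wpDl.
rewrite prodE starK; set h := x i * star (x i).
have {}ax : pos ((a + 1) *: 1 - star (x i) * x i).
  rewrite scalerDl scale1r addrAC; apply: pos_add => //.
  by exists 1; rewrite star1 mulr1.
move: (a + 1) a1 ax => {a0}a a1 ax.
have hh : star h = h by rewrite /h starM starK.
have -> : a *: 1 - h = a^-1 *: (star (a *: 1 - h) * (a *: 1 - h)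
    + star (star (x i)) * (a *: 1 - star (x i) * x i) * star (x i)).
  rewrite starK starB hh starZ geC0_conj ?(ltW a1) // star1.
  have -> : x i * (a *: 1 - star (x i) * x i) * star (x i) = a *: h - h * h.
    by rewrite mulrBr mulrBl -scalerAr mulr1 -scalerAl /h !mulrA.
  rewrite !mulrBr !mulrBl -!scalerAl -!scalerAr !mul1r mulr1 subrK.
  by rewrite -scalerBr scalerA mulVf ?scale1r // gt_eqF.
apply: pos_scale; first by rewrite invr_ge0 ltW.
by apply: pos_add => //; [exact: pos_starM | exact: pos_conj].
Qed.

(** A projection satisfies 1 - p^* p = (1 - p)^* (1 - p). *)
Lemma bdd_proj p : star p = p -> p * p = p -> bdd p.
Proof.
move=> ps pp; apply/bddP; exists 1 => // i.
exists (1 - p i); have -> : star (p i) = p i by rewrite -prodS ps.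
have pi : p i * p i = p i by rewrite -prodM pp.
have si : star (p i) = p i by rewrite -prodS ps.
by rewrite starB star1 si scale1r mulrBr mulr1 mulrBl mul1r pi subrr subr0.
Qed.

Lemma bdd1 : bdd 1.
Proof. by apply: bdd_proj; rewrite ?star1 ?mulr1. Qed.

Lemma bdd_blk i (a : F i) : bdd (blk a).
Proof.
have [c c0 ca] := block_bounded (Fm i) a.
apply/bddP; exists (c ^+ 2) => [|j]; first exact: exprn_ge0.
have [<-|ij] := eqVneq i j; first by rewrite blkE.
by rewrite blk_out // mulr0 subr0; apply: pos_scale1; exact: exprn_ge0.
Qed.

Lemma fin_bdd x : fin x -> bdd x.
Proof.
move: x; apply: fin_ind => [|c x y _ _|i a]; first exact: bdd0.
  exact: bdd_lin.
exact: bdd_blk.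
Qed.

(** Blockwise positivity of a bounded element: the square roots of the blocks
    are uniformly bounded, since h <= (h^2 + 1) / 2. *)
Lemma pos_bdd x : bdd x -> (forall i, pos (x i)) -> exists2 z, bdd z & x = star z * z.
Proof.
move=> /bddP[a a0 ax] xp.
have [z zx] : exists z : prodalg F, forall i, x i = star (z i) * z i.
  by exists (fun i => projT1 (cid (xp i))) => i; case: cid.
exists z; last by apply: prod_ext.
apply/bddP; exists ((a + 1) / 2) => [|i].
  by rewrite divr_ge0 // addr_ge0.
rewrite -zx; set h := x i.
have hh : star h = h by exact: pos_herm.
have -> : ((a + 1) / 2) *: 1 - h
    = 2^-1 *: ((a *: 1 - star h * h) + star (1 - h) * (1 - h)).
  rewrite starB star1 hh mulrBr mulr1 mulrBl mul1r.
  have -> : 1 - h - (h - h * h) = h * h + (1 - 2 *: h).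
    by rewrite opprB addrC -addrA; congr (_ + _); rewrite addrCA scaler_nat mulr2n opprD.
  rewrite addrA subrK addrA scalerBr scalerA mulVf ?pnatr_eq0 // scale1r.
  have -> : a *: 1 + 1 = (a + 1) *: 1 :> F i by rewrite scalerDl scale1r.
  by rewrite scalerA mulrC.
apply: pos_scale; first by rewrite invr_ge0.
by apply: pos_add => //; exact: pos_starM.
Qed.

Lemma le_bdd x y : bdd (y - x) -> (forall i, pos ((y - x) i)) -> le_in bdd x y.
Proof. by move=> b p; have [z bz e] := pos_bdd b p; exists z. Qed.

(** ** Finite cut-offs *)

Definition cut (s : seq I) : prodalg F := fun i => if i \in s then 1 else 0.

Lemma cut_proj s : star (cut s) = cut s /\ cut s * cut s = cut s.
Proof.
split; apply: prod_ext => i; rewrite prodE /cut; case: ifP => _;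
  by rewrite ?star1 ?star0 ?mulr1 ?mulr0.
Qed.
Lemma bdd_cut s : bdd (cut s).
Proof. by have [a b] := cut_proj s; exact: bdd_proj. Qed.
Lemma cut_cons i s : i \notin s -> cut (i :: s) = blk (1 : F i) + cut s.
Proof.
move=> si; apply: prod_ext => j; rewrite prodE /cut inE.
have [->|ij] := eqVneq j i; first by rewrite blkE (negbTE si) addr0.
by rewrite blk_out ?add0r // eq_sym.
Qed.

(** The cut-offs increase to 1: an upper bound dominates 1 in each block, and
    then globally because it is bounded. *)
Lemma lub_cut : [/\ range cut `<=` selfadjoint bdd, directed_in bdd (range cut)
  & lub_in bdd (range cut) 1].
Proof.
have le01 s t : {subset s <= t} -> le_in bdd (cut s) (cut t).
  move=> st; apply: le_bdd => [|i]; first by apply: bddB; exact: bdd_cut.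
  rewrite !prodE /cut; have := st i; case: (i \in s) => [->//|_].
    by rewrite subrr; exact: pos0.
  by case: ifP => _; rewrite subr0; [exists 1; rewrite star1 mulr1|exact: pos0].
split=> [_ [s _ <-]||].
- by split; [exact: bdd_cut | case: (cut_proj s)].
- split; first by exists (cut [::]), [::].
  move=> _ _ [s _ <-] [t _ <-]; exists (cut (s ++ t)); split; first by exists (s ++ t).
  - by apply: le01 => i; rewrite mem_cat => ->.
  - by apply: le01 => i; rewrite mem_cat => ->; rewrite orbT.
- split; first by split; [exact: bdd1 | rewrite star1].
  + move=> _ [s _ <-]; exists (1 - cut s); first exact: bddB bdd1 (bdd_cut s).
    have [cs cc] := cut_proj s.
    by rewrite starB star1 cs mulrBr mulr1 mulrBl mul1r cc subrr subr0.
  + move=> y [yb _] yu; apply: le_bdd => [|i]; first exact: bddB yb bdd1.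
    have [|z _] := yu (cut [:: i]); first by exists [:: i].
    move=> /(congr1 (fun x : prodalg F => x i)).
    by rewrite !prodE /cut inE eqxx => ->; exists (z i).
Qed.

End Bounded.

Arguments fin0 {C I F}.
Arguments bdd0 {C I F}.
Arguments bdd1 {C I F}.
Arguments cut {C I F} s.
Arguments bdd_cut {C I F} s.

(** * Tensor products of families *)

(* Coordinates of elementary tensors stay in the form read by [ten_bcoef]. *)
Arguments bcoef : simpl never.
Arguments bvec : simpl never.

Definition lin_closed (C : numClosedFieldType) (A : starAlgType C) (U : set A) :=
  U 0 /\ forall c x y, U x -> U y -> U (c *: x + y).

Section LinearSums.
Variables (C : numClosedFieldType) (A B : starAlgType C) (U : set A) (f : A -> B).
Hypotheses (Ul : lin_closed U) (fl : linear_on U f).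

Lemma lin_closed_sum (K : finType) (c : K -> C) (u : K -> A) :
  (forall k, U (u k)) -> U (\sum_k c k *: u k).
Proof. by move=> Uu; elim/big_rec: _ => [|k x _ Ux]; [case: Ul|apply: Ul.2]. Qed.

Lemma linear_on0 : f 0 = 0.
Proof.
case: Ul => U0 _; have := fl (-1) U0 U0.
by rewrite scaler0 addr0 scaleN1r addNr.
Qed.

Lemma linear_on_sum (K : finType) (c : K -> C) (u : K -> A) :
  (forall k, U (u k)) -> f (\sum_k c k *: u k) = \sum_k c k *: f (u k).
Proof.
move=> Uu; suff [] : U (\sum_k c k *: u k) /\ f (\sum_k c k *: u k) = \sum_k c k *: f (u k) by [].
elim/big_rec2: _ => [|k y1 y2 _ [U2 e]]; first by split; [case: Ul|exact: linear_on0].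
by split; [exact: Ul.2|rewrite fl // e].
Qed.
End LinearSums.

Section TenLemmas.
Variables (C : numClosedFieldType) (A B : fdalg C).

Lemma ten0l (b : B) : ten (0 : A) b = 0.
Proof. by apply/ffunP=> p; rewrite !ffunE linear0 mul0r. Qed.
Lemma ten0r (a : A) : ten a (0 : B) = 0.
Proof. by apply/ffunP=> p; rewrite !ffunE linear0 mulr0. Qed.
Lemma tenZl c (a : A) (b : B) : ten (c *: a) b = c *: ten a b.
Proof. by have := tenPl c a 0 b; rewrite ten0l !addr0. Qed.
Lemma tenZr c (a : A) (b : B) : ten a (c *: b) = c *: ten a b.
Proof. by have := tenPr c a b 0; rewrite ten0r !addr0. Qed.
Lemma tenM (a a' : A) (b b' : B) : ten a b * ten a' b' = ten (a * a') (b * b').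
Proof. exact: tens_mul_ten. Qed.
Lemma tenS (a : A) (b : B) : star (ten a b) = ten (star a) (star b).
Proof. exact: tens_star_ten. Qed.
Lemma ten11 : ten 1 1 = 1 :> mten A B. Proof. by []. Qed.
Lemma ten_bcoef (a : A) (b : B) s t :
  bcoef ((s, t) : bas (mten A B)) (ten a b) = bcoef s a * bcoef t b.
Proof. exact: ffunE. Qed.
Lemma tens_ext (X Y : mten A B) :
  (forall s t, bcoef ((s, t) : bas (mten A B)) X = bcoef ((s, t) : bas (mten A B)) Y) -> X = Y.
Proof. by move=> XY; apply: bcoef_inj => -[s t]; exact: XY. Qed.
End TenLemmas.

Section Slices.
Variables (C : numClosedFieldType) (I J : pointedType).
Variables (F : I -> fdalg C) (G : J -> fdalg C).
Implicit Types X Y : prodalg (ten_fam F G).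

Lemma ten_slicel X i j : X (i, j) = \sum_t ten (slicel X t i) (bvec t : G j).
Proof.
apply: tens_ext => s t; rewrite linear_sum /= (bigD1 t) //= big1 => [|t' nt].
  rewrite addr0 ten_bcoef bcoef_bvec eqxx mulr1 /slicel linear_sum (bigD1 s) //=.
  rewrite linearZ /= bcoef_bvec eqxx mulr1 big1 ?addr0 // => s' ns.
  by rewrite linearZ /= bcoef_bvec (negbTE ns) mulr0.
by rewrite ten_bcoef bcoef_bvec (negbTE nt) mulr0.
Qed.

Lemma ten_slicer X i j : X (i, j) = \sum_s ten (bvec s : F i) (slicer X s j).
Proof.
apply: tens_ext => s t; rewrite linear_sum /= (bigD1 s) //= big1 => [|s' ns].
  rewrite addr0 ten_bcoef bcoef_bvec eqxx mul1r /slicer linear_sum (bigD1 t) //=.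
  rewrite linearZ /= bcoef_bvec eqxx mulr1 big1 ?addr0 // => t' nt.
  by rewrite linearZ /= bcoef_bvec (negbTE nt) mulr0.
by rewrite ten_bcoef bcoef_bvec (negbTE ns) mul0r.
Qed.

Lemma slicel_ten (K : finType) X j (u : K -> prodalg F) (v : K -> G j) t :
  (forall i, X (i, j) = \sum_k ten (u k i) (v k)) ->
  slicel X t = \sum_k bcoef t (v k) *: u k.
Proof.
move=> XE; apply: prod_ext => i; rewrite prod_sum /slicel /entry XE.
under eq_bigr do rewrite linear_sum scaler_suml.
rewrite exchange_big; apply: eq_bigr => k _ /=.
rewrite prodE -[in RHS](bcoefK (u k i)) scaler_sumr; apply: eq_bigr => s _.
by rewrite ten_bcoef scalerA mulrC.
Qed.

Lemma slicer_ten (K : finType) X i (u : K -> F i) (v : K -> prodalg G) s :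
  (forall j, X (i, j) = \sum_k ten (u k) (v k j)) ->
  slicer X s = \sum_k bcoef s (u k) *: v k.
Proof.
move=> XE; apply: prod_ext => j; rewrite prod_sum /slicer /entry XE.
under eq_bigr do rewrite linear_sum scaler_suml.
rewrite exchange_big; apply: eq_bigr => k _ /=.
rewrite prodE -[in RHS](bcoefK (v k j)) scaler_sumr; apply: eq_bigr => t _.
by rewrite ten_bcoef scalerA.
Qed.

Definition slices_l (U : set (prodalg F)) : set (prodalg (ten_fam F G)) :=
  [set X | forall j (t : bas (G j)), U (slicel X t)].
Definition slices_r (U : set (prodalg G)) : set (prodalg (ten_fam F G)) :=
  [set X | forall i (s : bas (F i)), U (slicer X s)].

Lemma ten_elE (a : prodalg F) (b : prodalg G) i j :
  ten_el a b (i, j) = ten (a i) (b j).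
Proof. by []. Qed.
Lemma ten_elM (a a' : prodalg F) (b b' : prodalg G) :
  ten_el a b * ten_el a' b' = ten_el (a * a') (b * b').
Proof. by apply: prod_ext => -[i j]; rewrite prodE !ten_elE tenM. Qed.
Lemma ten_elS (a : prodalg F) (b : prodalg G) :
  star (ten_el a b) = ten_el (star a) (star b).
Proof. by apply: prod_ext => -[i j]; rewrite prodE !ten_elE tenS. Qed.
Lemma ten_elPl c (a a' : prodalg F) (b : prodalg G) :
  ten_el (c *: a + a') b = c *: ten_el a b + ten_el a' b.
Proof. by apply: prod_ext => -[i j]; rewrite !prodE !ten_elE !prodE tenPl. Qed.
Lemma ten_elPr c (a : prodalg F) (b b' : prodalg G) :
  ten_el a (c *: b + b') = c *: ten_el a b + ten_el a b'.
Proof. by apply: prod_ext => -[i j]; rewrite !prodE !ten_elE !prodE tenPr. Qed.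
Lemma ten_el_blk i j (a : F i) (b : G j) :
  ten_el (blk a) (blk b) = @blk C _ (ten_fam F G) (i, j) (ten a b).
Proof.
apply/esym/blkP => [|[k l] ne]; first by rewrite /ten_el /= !blkE.
rewrite ten_elE; have [e|ik] := eqVneq i k; last by rewrite (blk_out _ ik) ten0l.
have jl : j != l by apply: contraNneq ne => ->; rewrite e.
by rewrite (blk_out _ jl) ten0r.
Qed.

Lemma fin_ten_el (a : prodalg F) (b : prodalg G) : fin a -> fin b -> fin (ten_el a b).
Proof.
move=> af; move: b; apply: fin_ind => [|c x y _ _|j b].
- rewrite (_ : ten_el _ _ = 0); first exact: fin0.
  by apply: prod_ext => -[i j]; rewrite ten_elE ten0r.
- by rewrite ten_elPr; exact: fin_lin.
move: a af; apply: fin_ind => [|c x y _ _|i a].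
- rewrite (_ : ten_el _ _ = 0); first exact: fin0.
  by apply: prod_ext => -[i k]; rewrite ten_elE ten0l.
- by rewrite ten_elPl; exact: fin_lin.
by rewrite ten_el_blk; exact: fin_blk.
Qed.

(** The finitely supported families form the algebraic tensor square. *)
Lemma fin_ten_ind (P : prodalg (ten_fam F G) -> Prop) : P 0 ->
  (forall c X Y, fin X -> fin Y -> P X -> P Y -> P (c *: X + Y)) ->
  (forall a b, fin a -> fin b -> P (ten_el a b)) -> forall X, fin X -> P X.
Proof.
move=> P0 PD Pt; apply: fin_ind => // -[i j] X.
elim/(@tens_ind C (F i) (G j)): X => [|c X Y IHX IHY|a b].
- by rewrite blk0.
- by rewrite blk_lin; apply: PD => //; exact: fin_blk.
- by rewrite -ten_el_blk; apply: Pt; exact: fin_blk.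
Qed.

Lemma fin_slices_l X : fin X -> slices_l (@fin C I F) X.
Proof.
move=> Xf j t; have : finite_set (fst @` [set k | X k != 0]) by exact: finite_image.
apply: sub_finite_set => i /= n0; exists (i, j) => //.
apply: contra_neq n0 => Xij; rewrite /slicel big1 // => s _.
by rewrite /entry Xij linear0 scale0r.
Qed.
Lemma fin_slices_r X : fin X -> slices_r (@fin C J G) X.
Proof.
move=> Xf i s; have : finite_set (snd @` [set k | X k != 0]) by exact: finite_image.
apply: sub_finite_set => j /= n0; exists (i, j) => //.
apply: contra_neq n0 => Xij; rewrite /slicer big1 // => t _.
by rewrite /entry Xij linear0 scale0r.
Qed.

(** A slice over the block [j] only involves the column of [j]. *)
Lemma col_fin_slices_l X :
  (forall b, fin b -> fin (X * ten_el 1 b)) -> slices_l (@fin C I F) X.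
Proof.
move=> Xf j t; have := fin_slices_l (Xf _ (fin_blk (1 : G j))).
move=> /(_ j t); congr (fin _); apply: prod_ext => i.
by rewrite /slicel /entry prodE ten_elE blkE [ten _ _]ten11 mulr1.
Qed.
Lemma row_fin_slices_r X :
  (forall a, fin a -> fin (ten_el a 1 * X)) -> slices_r (@fin C J G) X.
Proof.
move=> Xf i s; have := fin_slices_r (Xf _ (fin_blk (1 : F i))).
move=> /(_ i s); congr (fin _); apply: prod_ext => j.
by rewrite /slicer /entry prodE ten_elE blkE [ten _ _]ten11 mul1r.
Qed.

End Slices.

Section LeftLeg.
Variables (C : numClosedFieldType) (I I' J : pointedType).
Variables (F : I -> fdalg C) (F' : I' -> fdalg C) (G : J -> fdalg C).
Variables (U : set (prodalg F)) (f : prodalg F -> prodalg F').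
Hypotheses (Ul : lin_closed U) (fl : linear_on U f).
Implicit Types X Y : prodalg (ten_fam F G).
Local Notation slU := (slices_l (G := G) U).
Local Notation fid := (@ten_map_l C I I' J F F' G f).

(** Slices are linear, so [f (x) id] does not depend on the decomposition of a
    column into elementary tensors.  All the algebraic properties of [f (x) id]
    below come from choosing a suitable decomposition. *)
Lemma ten_map_l_ten (K : finType) X j (u : K -> prodalg F) (v : K -> G j) i' :
  (forall k, U (u k)) -> (forall i, X (i, j) = \sum_k ten (u k i) (v k)) ->
  fid X (i', j) = \sum_k ten (f (u k) i') (v k).
Proof.
move=> Uu XE; rewrite /ten_map_l /=.
under eq_bigr => t _ do
  rewrite (slicel_ten _ XE) (linear_on_sum Ul fl) // prod_sum ten_suml.
rewrite exchange_big; apply: eq_bigr => k _ /=.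
rewrite -[in RHS](bcoefK (v k)) ten_sumr.
by apply: eq_bigr.
Qed.

Lemma slU_ten (K : finType) X j (u : K -> prodalg F) (v : K -> G j) (t : bas (G j)) :
  (forall k, U (u k)) -> (forall i, X (i, j) = \sum_k ten (u k i) (v k)) ->
  U (slicel X t).
Proof. by move=> Uu XE; rewrite (slicel_ten _ XE); exact: lin_closed_sum. Qed.

Lemma ten_map_l_el a b : U a -> fid (ten_el a b) = ten_el (f a) b.
Proof.
move=> Ua; apply: prod_ext => -[i j].
rewrite (@ten_map_l_ten unit _ j (fun=> a) (fun=> b j)) //= => [|i'].
  by rewrite (big_pred1 tt) // => -[].
by rewrite (big_pred1 tt) // => -[].
Qed.

Lemma ten_map_l_lin c X Y : slU X -> slU Y ->
  slU (c *: X + Y) /\ fid (c *: X + Y) = c *: fid X + fid Y.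
Proof.
move=> UX UY.
have XE j i : (c *: X + Y) (i, j) = \sum_(b : bool * bas (G j))
    ten (if b.1 then c *: slicel X b.2 i else slicel Y b.2 i) (bvec b.2).
  rewrite !prodE (ten_slicel X) (ten_slicel Y) scaler_sumr.
  rewrite -(pair_big xpredT xpredT (fun (b : bool) t =>
    ten (if b then c *: slicel X t i else slicel Y t i) (bvec t))) /=.
  rewrite big_bool /=; congr (_ + _).
  by apply: eq_bigr => t _; rewrite tenZl.
pose u j (b : bool * bas (G j)) := if b.1 then c *: slicel X b.2 else slicel Y b.2.
have Uu j b : U (@u j b).
  rewrite /u; case: b.1 => //; rewrite -[_ *: _]addr0.
  by apply: Ul.2 => //; case: Ul.
have {}XE j i : (c *: X + Y) (i, j) = \sum_b ten (@u j b i) (bvec b.2).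
  by rewrite XE; apply: eq_bigr => -[[] t] _.
split=> [j t|]; first exact: slU_ten (XE j).
apply: prod_ext => -[i j]; rewrite (ten_map_l_ten _ _ (XE j)) // !prodE.
rewrite /ten_map_l scaler_sumr -(pair_big xpredT xpredT (fun (b : bool) t =>
    ten (f (u j (b, t)) i) (bvec t))) big_bool /= /u /=; congr (_ + _).
apply: eq_bigr => t _; rewrite -tenZl; congr ten.
case: Ul => U0 _; have := fl c (UX j t) U0.
by rewrite addr0 (linear_on0 Ul fl) addr0 => ->.
Qed.

Lemma ten_map_lMel X b : slU X ->
  slU (X * ten_el 1 b) /\ fid (X * ten_el 1 b) = fid X * ten_el 1 b.
Proof.
move=> UX.
have XE j i : (X * ten_el 1 b) (i, j) = \sum_t ten (slicel X t i) (bvec t * b j).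
  rewrite prodE (ten_slicel X) ten_elE mulr_suml; apply: eq_bigr => t _.
  by rewrite tenM mulr1.
split=> [j t|]; first exact: slU_ten (XE j).
apply: prod_ext => -[i j]; rewrite (ten_map_l_ten _ _ (XE j)) // prodE mulr_suml.
by apply: eq_bigr => t _; rewrite ten_elE tenM mulr1.
Qed.

Lemma ten_map_lM X Y : (forall x y, U x -> U y -> U (x * y)) ->
  multiplicative_on U f -> slU X -> slU Y ->
  slU (X * Y) /\ fid (X * Y) = fid X * fid Y.
Proof.
move=> UM fM UX UY.
have XE j i : (X * Y) (i, j) = \sum_(p : bas (G j) * bas (G j))
    ten ((slicel X p.1 * slicel Y p.2) i) (bvec p.1 * bvec p.2).
  rewrite prodE (ten_slicel X) (ten_slicel Y) big_distrlr pair_big /=.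
  by apply: eq_bigr => p _; rewrite tenM.
have Uu j (p : bas (G j) * bas (G j)) : U (slicel X p.1 * slicel Y p.2) by exact: UM.
split=> [j t|]; first exact: slU_ten (XE j).
apply: prod_ext => -[i j]; rewrite (ten_map_l_ten _ _ (XE j)) // prodE.
rewrite /ten_map_l big_distrlr pair_big /=; apply: eq_bigr => p _.
by rewrite tenM fM.
Qed.

Lemma ten_map_lS X : (forall x, U x -> U (star x)) ->
  star_on U f -> slU X -> slU (star X) /\ fid (star X) = star (fid X).
Proof.
move=> US fS UX.
have XE j i : (star X) (i, j) = \sum_t ten (star (slicel X t) i) (star (bvec t)).
  rewrite prodE (ten_slicel X) star_sum; apply: eq_bigr => t _.
  by rewrite tenS.
have Uu j (t : bas (G j)) : U (star (slicel X t)) by exact: US.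
split=> [j t|]; first exact: (@slU_ten _ _ j (fun t => star (slicel X t)) (fun t => star (bvec t)) t).
apply: prod_ext => -[i j]; rewrite (@ten_map_l_ten _ _ j (fun t => star (slicel X t)) (fun t => star (bvec t))) //.
by rewrite prodE star_sum; apply: eq_bigr => t _; rewrite tenS fS.
Qed.

End LeftLeg.

Section RightLeg.
Variables (C : numClosedFieldType) (I J J' : pointedType).
Variables (F : I -> fdalg C) (G : J -> fdalg C) (G' : J' -> fdalg C).
Variables (U : set (prodalg G)) (f : prodalg G -> prodalg G').
Hypotheses (Ul : lin_closed U) (fl : linear_on U f).
Implicit Types X Y : prodalg (ten_fam F G).
Local Notation slU := (slices_r (F := F) U).
Local Notation idf := (@ten_map_r C I J J' F G G' f).

Lemma ten_map_r_ten (K : finType) X i (u : K -> F i) (v : K -> prodalg G) j' :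
  (forall k, U (v k)) -> (forall j, X (i, j) = \sum_k ten (u k) (v k j)) ->
  idf X (i, j') = \sum_k ten (u k) (f (v k) j').
Proof.
move=> Uv XE; rewrite /ten_map_r /=.
under eq_bigr => t _ do
  rewrite (slicer_ten _ XE) (linear_on_sum Ul fl) // prod_sum ten_sumr.
rewrite exchange_big; apply: eq_bigr => k _ /=.
rewrite -[in RHS](bcoefK (u k)) ten_suml.
by apply: eq_bigr.
Qed.

Lemma slUr_ten (K : finType) X i (u : K -> F i) (v : K -> prodalg G) (s : bas (F i)) :
  (forall k, U (v k)) -> (forall j, X (i, j) = \sum_k ten (u k) (v k j)) ->
  U (slicer X s).
Proof. by move=> Uu XE; rewrite (slicer_ten _ XE); exact: lin_closed_sum. Qed.

Lemma ten_map_r_el a b : U b -> idf (ten_el a b) = ten_el a (f b).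
Proof.
move=> Ub; apply: prod_ext => -[i j].
rewrite (@ten_map_r_ten unit _ i (fun=> a i) (fun=> b)) //= => [|j'].
  by rewrite (big_pred1 tt) // => -[].
by rewrite (big_pred1 tt) // => -[].
Qed.

Lemma ten_map_r_lin c X Y : slU X -> slU Y ->
  slU (c *: X + Y) /\ idf (c *: X + Y) = c *: idf X + idf Y.
Proof.
move=> UX UY.
pose v i (b : bool * bas (F i)) := if b.1 then c *: slicer X b.2 else slicer Y b.2.
have Uv i b : U (@v i b).
  rewrite /v; case: b.1 => //; rewrite -[_ *: _]addr0.
  by apply: Ul.2 => //; case: Ul.
have XE i j : (c *: X + Y) (i, j) = \sum_b ten (bvec b.2) (@v i b j).
  rewrite !prodE (ten_slicer X) (ten_slicer Y) scaler_sumr.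
  rewrite -(pair_big xpredT xpredT (fun (b : bool) t =>
    ten (bvec t) (v i (b, t) j))) /=.
  rewrite big_bool /= /v /=; congr (_ + _).
  by apply: eq_bigr => t _; rewrite tenZr.
split=> [i t|]; first exact: slUr_ten (XE i).
apply: prod_ext => -[i j]; rewrite (ten_map_r_ten _ _ (XE i)) // !prodE.
rewrite /ten_map_r scaler_sumr -(pair_big xpredT xpredT (fun (b : bool) t =>
    ten (bvec t) (f (v i (b, t)) j))) big_bool /= /v /=; congr (_ + _).
apply: eq_bigr => t _; rewrite -tenZr; congr ten.
case: Ul => U0 _; have := fl c (UX i t) U0.
by rewrite addr0 (linear_on0 Ul fl) addr0 => ->.
Qed.

Lemma ten_map_relM X a : slU X ->
  slU (ten_el a 1 * X) /\ idf (ten_el a 1 * X) = ten_el a 1 * idf X.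
Proof.
move=> UX.
have XE i j : (ten_el a 1 * X) (i, j) = \sum_t ten (a i * bvec t) (slicer X t j).
  rewrite prodE (ten_slicer X) ten_elE mulr_sumr; apply: eq_bigr => t _.
  by rewrite tenM mul1r.
split=> [i t|]; first exact: slUr_ten (XE i).
apply: prod_ext => -[i j]; rewrite (ten_map_r_ten _ _ (XE i)) // prodE mulr_sumr.
by apply: eq_bigr => t _; rewrite ten_elE tenM mul1r.
Qed.

Lemma ten_map_rM X Y : (forall x y, U x -> U y -> U (x * y)) ->
  multiplicative_on U f -> slU X -> slU Y ->
  slU (X * Y) /\ idf (X * Y) = idf X * idf Y.
Proof.
move=> UM fM UX UY.
have XE i j : (X * Y) (i, j) = \sum_(p : bas (F i) * bas (F i))
    ten (bvec p.1 * bvec p.2) ((slicer X p.1 * slicer Y p.2) j).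
  rewrite prodE (ten_slicer X) (ten_slicer Y) big_distrlr pair_big /=.
  by apply: eq_bigr => p _; rewrite tenM.
have Uu i (p : bas (F i) * bas (F i)) : U (slicer X p.1 * slicer Y p.2) by exact: UM.
split=> [i t|]; first exact: slUr_ten (XE i).
apply: prod_ext => -[i j]; rewrite (ten_map_r_ten _ _ (XE i)) // prodE.
rewrite /ten_map_r big_distrlr pair_big /=; apply: eq_bigr => p _.
by rewrite tenM fM.
Qed.

Lemma ten_map_rS X : (forall x, U x -> U (star x)) ->
  star_on U f -> slU X -> slU (star X) /\ idf (star X) = star (idf X).
Proof.
move=> US fS UX.
have XE i j : (star X) (i, j) = \sum_t ten (star (bvec t)) (star (slicer X t) j).
  rewrite prodE (ten_slicer X) star_sum; apply: eq_bigr => t _.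
  by rewrite tenS.
have Uu i (t : bas (F i)) : U (star (slicer X t)) by exact: US.
split=> [i t|]; first exact: (@slUr_ten _ _ i (fun t => star (bvec t)) (fun t => star (slicer X t)) t).
apply: prod_ext => -[i j]; rewrite (@ten_map_r_ten _ _ i (fun t => star (bvec t)) (fun t => star (slicer X t))) //.
by rewrite prodE star_sum; apply: eq_bigr => t _; rewrite tenS fS.
Qed.

End RightLeg.

Section Multiplication.
Variables (C : numClosedFieldType) (I : pointedType) (F : I -> fdalg C).
Implicit Types X Y : prodalg (ten_fam F F).

Definition block_mult (A : fdalg C) (X : mten A A) : A :=
  \sum_(p : bas A * bas A) bcoef (p : bas (mten A A)) X *: (bvec p.1 * bvec p.2).

Lemma mult_mapE X i : mult_map X i = block_mult (X (i, i)).
Proof. by rewrite /mult_map /block_mult; apply: eq_bigr => -[]. Qed.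

Lemma block_mult_lin (A : fdalg C) c (X Y : mten A A) :
  block_mult (c *: X + Y) = c *: block_mult X + block_mult Y.
Proof.
rewrite /block_mult scaler_sumr -big_split; apply: eq_bigr => p _ /=.
by rewrite linearP scalerDl scalerA.
Qed.

Lemma block_mult_ten (A : fdalg C) (a b : A) : block_mult (ten a b) = a * b.
Proof.
rewrite -[a in RHS]bcoefK -[b in RHS]bcoefK big_distrlr pair_big /=.
by apply: eq_bigr => -[s t] _; rewrite ten_bcoef -scalerAl -scalerAr scalerA.
Qed.

Lemma mult_map_lin c X Y : mult_map (c *: X + Y) = c *: mult_map X + mult_map Y.
Proof. by apply: prod_ext => i; rewrite !prodE !mult_mapE block_mult_lin. Qed.

Lemma mult_map_el a b : mult_map (ten_el a b : prodalg (ten_fam F F)) = a * b.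
Proof. by apply: prod_ext => i; rewrite mult_mapE block_mult_ten. Qed.

Lemma block_multMr (A : fdalg C) (X : mten A A) (b : A) :
  block_mult (X * ten 1 b) = block_mult X * b.
Proof.
elim/(@tens_ind C A A): X => [|c X Y IHX IHY|a a'].
- by rewrite mul0r; have := block_mult_lin (-1) (0 : mten A A) 0; rewrite scaler0 addr0 scaleN1r addNr => ->; rewrite mul0r.
- by rewrite mulrDl -scalerAl !block_mult_lin IHX IHY mulrDl scalerAl.
- by rewrite tenM !block_mult_ten mulr1 mulrA.
Qed.

Lemma mult_mapMr X b : mult_map (X * ten_el 1 b) = mult_map X * b.
Proof. by apply: prod_ext => i; rewrite !prodE !mult_mapE prodE block_multMr. Qed.

Lemma block_multMl (A : fdalg C) (X : mten A A) (a : A) :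
  block_mult (ten a 1 * X) = a * block_mult X.
Proof.
elim/(@tens_ind C A A): X => [|c X Y IHX IHY|b b'].
- by rewrite mulr0; have := block_mult_lin (-1) (0 : mten A A) 0; rewrite scaler0 addr0 scaleN1r addNr => ->; rewrite mulr0.
- by rewrite mulrDr -scalerAr !block_mult_lin IHX IHY mulrDr scalerAr.
- by rewrite tenM !block_mult_ten mul1r mulrA.
Qed.

Lemma mult_mapMl X a : mult_map (ten_el a 1 * X) = a * mult_map X.
Proof. by apply: prod_ext => i; rewrite !prodE !mult_mapE prodE block_multMl. Qed.

End Multiplication.

(** * Normal states *)

Section Scalars.
Variable C : numClosedFieldType.

Lemma conj_from_real (a b : C) :
  a + b \is Num.real -> 'i * (a - b) \is Num.real -> b = a^*.
Proof.
move=> /CrealP; rewrite rmorphD /= => e1 /CrealP.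
rewrite rmorphM rmorphB /= conjCi mulNr -mulrN opprB => /(mulfI (neq0Ci C)) e2.
have two0 : 2 != 0 :> C by rewrite pnatr_eq0.
apply: (mulfI two0); transitivity ((a + b) - (a - b)); first by ring.
by rewrite -e1 -e2; ring.
Qed.

(** Otherwise a large negative multiple of the conjugate of [z], taken as [w],
    violates the bound. *)
Lemma real_part_bounded (A z : C) : 0 <= A ->
  (forall w, 0 <= A + (w * z + (w * z)^*)) -> z = 0.
Proof.
move=> A0 Aw; apply/eqP/negPn/negP=> z0.
have zz : 0 < `|z| ^+ 2 by rewrite exprn_gt0 // normr_gt0.
have := Aw (- (A + 1) / `|z| ^+ 2 * z^*).
have -> : - (A + 1) / `|z| ^+ 2 * z^* * z = - (A + 1).
  by rewrite -mulrA (mulrC _ z) -normCK mulfVK // gt_eqF.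
rewrite rmorphN rmorphD /= conjC1 geC0_conj // -opprD.
have -> : A - (A + 1 + (A + 1)) = - (A + 2) by ring.
rewrite oppr_ge0 => A2.
by have := lt_le_trans (ltr_wpDl A0 (ltr0n C 2)) A2; rewrite ltxx.
Qed.

End Scalars.

Section NormalStates.
Variables (C : numClosedFieldType) (K : pointedType) (H : K -> fdalg C).
Hypothesis Hm : forall k, matlike (H k).
Local Notation bdd := (@bdd C K H).
Variable mu : prodalg H -> C^o.
Hypothesis mu_state : normal_state bdd mu.
Implicit Types x y p q : prodalg H.
Local Notation m x := (mu x : C).

Lemma state_lin c x y : bdd x -> bdd y -> m (c *: x + y) = c * m x + m y.
Proof. by case: mu_state => ml _ _ _ bx by_; exact: ml. Qed.

Lemma state_ge0 x : bdd x -> 0 <= m (star x * x).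
Proof. by move=> bx; case: mu_state => _ mp _ _; exact: mp. Qed.

Lemma state1 : m 1 = 1. Proof. by case: mu_state. Qed.

Lemma state0 : m 0 = 0.
Proof.
have := state_lin (-1) bdd0 bdd0.
by rewrite scaler0 addr0 mulN1r addNr.
Qed.
Lemma stateD x y : bdd x -> bdd y -> m (x + y) = m x + m y.
Proof. by move=> bx by_; have := state_lin 1 bx by_; rewrite scale1r mul1r. Qed.
Lemma stateZ c x : bdd x -> m (c *: x) = c * m x.
Proof.
by move=> bx; have := state_lin c bx bdd0; rewrite addr0 state0 addr0.
Qed.
Lemma stateB x y : bdd x -> bdd y -> m (x - y) = m x - m y.
Proof.
move=> bx by_; rewrite -scaleN1r addrC state_lin //.
by rewrite mulN1r addrC.
Qed.

Lemma state_expand x y w : bdd x -> bdd y ->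
  0 <= m (star x * x) + w * m (star x * y) + w^* * m (star y * x)
       + `|w| ^+ 2 * m (star y * y).
Proof.
move=> bx by_; have bz : bdd (x + w *: y) by apply: bddD => //; exact: bddZ.
have := state_ge0 bz.
have sx := bddS Hm bx; have sy := bddS Hm by_.
have -> : star (x + w *: y) * (x + w *: y) =
    w *: (star x * y) + (w^* *: (star y * x) + ((`|w| ^+ 2) *: (star y * y) + star x * x)).
  rewrite starD starZ mulrDr !mulrDl -!scalerAl -!scalerAr scalerA -normCKC.
  by rewrite [LHS]addrC -addrA; congr (_ + _); rewrite addrA addrC.
rewrite !state_lin ?(bddD, bddM, bddZ) //; try by do ?[apply: bddD | apply: bddZ | apply: bddM].
by congr (_ <= _); ring.
Qed.

Lemma state_star x : bdd x -> m (star x) = (m x)^*.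
Proof.
move=> bx; have b1 := @bdd1 C K H; have bs := bddS Hm bx.
have pr y : bdd y -> m (star y * y) \is Num.real.
  by move=> by_; apply: ger0_real; exact: state_ge0.
have e w : w * m x + w^* * m (star x) \is Num.real.
  have /ger0_real := state_expand w b1 bx.
  rewrite star1 !mul1r mulr1 state1.
  rewrite -addrA -addrA rpredDl ?rpred1 // addrA rpredDr //.
  by rewrite rpredM ?pr // realX ?normr_real.
apply: conj_from_real; first by have := e 1; rewrite conjC1 !mul1r.
by have := e 'i; rewrite conjCi mulNr -mulrBr.
Qed.

(** The Cauchy--Schwarz inequality, in the degenerate case. *)
Lemma state_null_r x q : bdd x -> bdd q -> m (star q * q) = 0 -> m (x * q) = 0.
Proof.
move=> bx bq q0; have bs := bddS Hm bx; have bqs := bddS Hm bq.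
apply: (@real_part_bounded C (m (x * star x))) => [|w].
  by have := state_ge0 bs; rewrite starK.
have := state_expand w bs bq; rewrite starK q0 mulr0 addr0 rmorphM /=.
by rewrite -state_star ?starM ?addrA //; exact: bddM.
Qed.

Lemma state_null_l x q : bdd x -> bdd q -> m (star q * q) = 0 -> m (star q * x) = 0.
Proof.
move=> bx bq q0; have bs := bddS Hm bx; have bqs := bddS Hm bq.
have := state_null_r bs bq q0.
have -> : star x * q = star (star q * x) by rewrite starM starK.
rewrite state_star; last exact: bddM.
by move=> /(congr1 Num.conj); rewrite conjCK conjC0.
Qed.

Lemma state_cut_sup (y : C) : y \is Num.real ->
  (forall s, m (@cut _ _ H s) <= y) -> 1 <= y.
Proof.
move=> yr cy; case: mu_state => _ _ _ mn.
have [cs cd cl] := lub_cut Hm.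
have [_ _ lub] := mn _ _ cs cd cl.
have [|_ [_ [s _ <-] <-]|z _] := lub (y : C^o).
- by split=> //; apply/CrealP.
- exists (sqrtC (y - m (cut s))) => //.
  have d0 : 0 <= y - m (cut s) by rewrite subr_ge0.
  rewrite [RHS](_ : _ = (sqrtC (y - m (cut s)))^* * sqrtC (y - m (cut s)) :> C) //.
  by rewrite geC0_conj ?sqrtC_ge0 // -expr2 sqrtCK.
rewrite -[X in y - X]/(m 1) state1 -subr_ge0 => ->.
by rewrite [X in 0 <= X](_ : _ = z^* * z :> C) // mulrC mul_conjC_ge0.
Qed.

(** The cut-offs of [p] have the same measure as those of 1, which increase to 1
    by normality. *)
Lemma state_proj1 p : star p = p -> p * p = p ->
  (forall k, m (p * blk (1 : H k)) = m (blk (1 : H k))) -> m p = 1.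
Proof.
move=> ps pp pk; have bp := bdd_proj ps pp.
have b1 := @bdd1 C K H; have bc s := @bdd_cut C K H s.
have pr : m p \is Num.real.
  by apply: ger0_real; rewrite -pp -{1}ps; exact: state_ge0.
have pcut s : m (p * cut s) = m (cut s).
  elim: s => [|i s IH].
    rewrite (_ : cut [::] = 0) ?mulr0 //; exact: prod_ext.
  have [si|si] := boolP (i \in s).
    suff -> : @cut _ _ H (i :: s) = cut s by [].
    apply: prod_ext => j; rewrite /cut inE; case: eqVneq => // ->.
    by rewrite si.
  have bb := bdd_blk Hm (1 : H i).
  by rewrite cut_cons // mulrDr !stateD ?pk ?IH //; exact: bddM.
apply/eqP; rewrite eq_le; apply/andP; split.
  have bq := bddB Hm b1 bp.
  have := state_ge0 bq; rewrite starB star1 ps mulrBr mulr1 mulrBl mul1r pp subrr subr0.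
  by rewrite stateB // state1 subr_ge0.
apply: state_cut_sup => // s; rewrite -pcut -subr_ge0 -stateB //; last exact: bddM.
have [cs cc] := cut_proj H s.
have cp : p * cut s = cut s * p.
  by apply: prod_ext => i; rewrite !prodE /cut; case: ifP => _; rewrite ?(mulr1, mul1r, mulr0, mul0r).
have -> : p - p * cut s = star (p - p * cut s) * (p - p * cut s).
  have -> : p - p * cut s = p * (1 - cut s) by rewrite mulrBr mulr1.
  have rp : p * (1 - cut s) = (1 - cut s) * p.
    by rewrite mulrBr mulrBl cp mulr1 mul1r.
  have rr : (1 - cut s) * (1 - cut s) = 1 - cut s :> prodalg H.
    by rewrite mulrBr mulr1 mulrBl mul1r cc subrr subr0.
  by rewrite starM starB star1 cs ps -rp mulrA -(mulrA p _ p) -rp mulrA pp -mulrA rr.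
by apply: state_ge0; apply: bddB => //; exact: bddM.
Qed.

End NormalStates.

(** ** Vector functionals of a block are normal states *)

Section BlockState.
Variables (R : realType) (K : pointedType) (H : K -> fdalg R[i]).
Hypothesis Hm : forall k, matlike (H k).
Local Notation C := R[i].
Variables (k : K) (w : H k -> C).
Hypotheses (wl : linear_for *%R w) (w_ge0 : forall h, pos h -> 0 <= w h).
Hypothesis w1 : w 1 = 1.

Lemma block_fun_star h : w (star h) = (w h)^*.
Proof.
have wD x y : w (x + y) = w x + w y by have := wl 1 x y; rewrite scale1r mul1r.
have w0 : w 0 = 0 by have := wl (-1) 0 0; rewrite scaler0 addr0 mulN1r addNr.
have wZ c x : w (c *: x) = c * w x by have := wl c x 0; rewrite !addr0 w0 addr0.
have herm x : star x = x -> w x \is Num.real.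
  move=> sx; have [c c0 cx] := herm_bounded (Hm k) sx.
  have -> : w x = w (c *: 1) - w (c *: 1 - x).
    by rewrite -[in X in w X - _](subrK x (c *: 1)) wD addrAC subrr add0r.
  by rewrite rpredB // ger0_real // w_ge0 //; exact: pos_scale1.
apply: conj_from_real.
  by rewrite -wD; apply: herm; rewrite starD starK addrC.
rewrite -mulN1r -wZ -wD -wZ; apply: herm.
by rewrite scaleN1r starZ starB starK conjCi scaleNr -scalerN opprB.
Qed.

(** Normality: the set of [k]-th blocks of a bounded directed set has an upper
    bound [L] as tight as [w] can see, and replacing the [k]-th block of the
    supremum by [L] still gives an upper bound of the directed set. *)
Lemma block_normal_state :
  normal_state (@bdd C K H) (fun X => w (X k) : C^o).
Proof.
split=> [c x y _ _|x _||D x Dsa [D0 Dd] [xs xu xl]].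
- by rewrite wl.
- by apply: w_ge0; exact: pos_starM.
- by [].
have le_pos y z : le_in (@bdd C K H) y z -> pos (z k - y k).
  by move=> [t _ /(congr1 (fun u : prodalg H => u k)) e]; exists (t k).
have le_C (a b : C) : a <= b -> le_in [set: C^o] (a : C^o) (b : C^o).
  move=> ab; exists (sqrtC (b - a)) => //.
  rewrite [RHS](_ : _ = (sqrtC (b - a))^* * sqrtC (b - a) :> C) //.
  by rewrite geC0_conj ?sqrtC_ge0 ?subr_ge0 // -expr2 sqrtCK.
have wB y z : w (y - z) = w y - w z.
  by rewrite addrC -scaleN1r wl mulN1r addrC.
split.
- split=> //; rewrite [LHS](_ : _ = (w (x k))^*) //.
  by rewrite -block_fun_star; case: xs => _ {2}<-.
- move=> _ [d Dd' <-]; apply: le_C; rewrite -subr_ge0 -wB.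
  exact/w_ge0/le_pos/xu.
move=> y [_ ys] yu; apply: le_C.
have wy d : D d -> w (d k) <= y.
  move=> Dd'; have [|z _ e] := yu (w (d k)); first by exists d.
  rewrite -subr_ge0 [X in 0 <= X]e [X in 0 <= X](_ : _ = z^* * z :> C) //.
  by rewrite mulrC mul_conjC_ge0.
pose Dk := (fun d : prodalg H => d k) @` D.
have [||||L [Lu Lw]] := @matlike_limit R (H k) Dk (x k) (Hm k).
- by case: D0 => d Dd'; exists (d k), d.
- by move=> _ [d /Dsa[_ ds] <-]; rewrite -prodS ds.
- move=> _ _ [d Dd1 <-] [e De <-]; have [f [Df df ef]] := Dd _ _ Dd1 De.
  by exists (f k); split; [exists f|exact: le_pos|exact: le_pos].
- by move=> _ [d Dd' <-]; apply/le_pos/xu.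
apply: (le_trans _ (Lw w y wl _)); last by move=> _ [d Dd' <-]; exact: wy.
have [bx sx] := xs.
pose x' : prodalg H := x + blk (L - x k).
have x'k : x' k = L by rewrite /x' prodE blkE addrC subrK.
have sL : star L = L.
  case: D0 => d Dd'; have [_ sd] := Dsa _ Dd'.
  have /pos_herm : pos (L - d k) by apply: Lu; exists d.
  by rewrite starB -prodS sd => /(addIr _).
have bx' : bdd x' by apply: bddD => //; exact: bdd_blk.
have : le_in (@bdd C K H) x x'.
  apply: xl; first split=> //.
    by rewrite /x' starD sx blkS starB sL -prodS sx.
  move=> d Dd'; have [bd _] := Dsa _ Dd'.
  apply: le_bdd => //; first exact: bddB.
  move=> j; have [<-|kj] := eqVneq k j.
    by rewrite !prodE x'k; apply: Lu; exists d.
  rewrite /x' !prodE blk_out // addr0.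
  by case: (xu _ Dd') => z _ /(congr1 (fun u : prodalg H => u j)) e; exists (z j).
by move=> /le_pos; rewrite x'k => /w_ge0; rewrite wB subr_ge0.
Qed.

End BlockState.

(** ** Projections span a block *)

Section ProjectionSpan.
Variable C : numClosedFieldType.

(** Polarization: a matrix unit is a combination of the projections onto the
    lines of e_p + i^k e_q. *)
Lemma mx_proj_span n (P : 'M[C]_n.+1 -> Prop) : P 0 ->
  (forall c x y, P x -> P y -> P (c *: x + y)) ->
  (forall q, star q = q -> q * q = q -> P q) -> forall x, P x.
Proof.
move=> P0 PL Pq.
have Psum (J : finType) (c : J -> C) (u : J -> 'M[C]_n.+1) :
    (forall j, P (u j)) -> P (\sum_j c j *: u j).
  by move=> Pu; elim/big_rec: _ => // j x _; exact: PL.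
suff Pd (p : 'I_n.+1 * 'I_n.+1) : P (delta_mx p.1 p.2).
  move=> x; rewrite [x]matrix_sum_delta pair_big /=.
  exact: (Psum _ (fun p : 'I_n.+1 * 'I_n.+1 => x p.1 p.2)).
case: p => q p /=; have [<-|pq] := eqVneq q p.
  apply: Pq; last by rewrite -mulmxE mul_delta_mx.
  by rewrite starmxE /adjmx trmx_delta map_delta_mx.
pose v (k : 'I_4) : 'rV[C]_n.+1 := delta_mx 0 p + 'i ^+ k *: delta_mx 0 q.
pose Q k : 'M[C]_n.+1 := 2^-1 *: (adjmx (v k) *m v k).
have nk (k : 'I_4) : 'i ^+ k * ('i ^+ k)^* = 1 :> C.
  by rewrite -normCK normrX normCi !expr1n.
have vE k s : v k 0 s = (s == p)%:R + 'i ^+ k * (s == q)%:R.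
  by rewrite /v !mxE !eqxx /=.
have vv k : v k *m adjmx (v k) = 2%:M.
  apply/matrixP=> a b; rewrite !ord1 mxE.
  transitivity (\sum_s v k 0 s * (v k 0 s)^*).
    by apply: eq_bigr => s _; rewrite /adjmx [X in _ * X = _]mxE [X in X^*]mxE.
  have qp : (p == q) = false by rewrite eq_sym (negbTE pq).
  rewrite (bigD1 p) //= (bigD1 q) //= big1; last first.
    by move=> s /andP[sp sq]; rewrite vE (negbTE sp) (negbTE sq) mulr0 addr0 mul0r.
  rewrite !vE !eqxx qp (negbTE pq) !mulr0 !mulr1 !addr0 add0r conjC1 mulr1 nk.
  by rewrite mxE eqxx mulr1n.
(* The factor 1/2 normalizes: e_p + i^k e_q has squared norm 2. *)
have -> : delta_mx q p = \sum_(k : 'I_4) (2^-1 * 'i ^+ k) *: Q k.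
  apply/matrixP=> s t; rewrite summxE.
  transitivity (4^-1 * \sum_(k < 4) 'i ^+ k *
     (((s == p) && (t == p))%:R + ((s == q) && (t == q))%:R * `|'i ^+ k| ^+ 2
      + ('i ^+ k)^* * ((s == q) && (t == p))%:R
      + 'i ^+ k * ((s == p) && (t == q))%:R) : C).
    by rewrite sum_i4 mulKf ?pnatr_eq0 // !mxE.
  rewrite mulr_sumr; apply: eq_bigr => k _.
  rewrite /Q !mxE big_ord_recl big_ord0 addr0 !mxE /=.
  rewrite rmorphD rmorphM /= !conjC_nat normCK -!mulnb !natrM.
  have -> : 4^-1 = 2^-1 * 2^-1 :> C by rewrite -invfM -natrM.
  by ring.
apply: Psum => k; apply: Pq.
  rewrite /Q starZ starmxE adjmxM adjmxK; congr (_ *: _).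
  by rewrite geC0_conj // invr_ge0 ler0n.
rewrite /Q -scalerAl -scalerAr -mulmxE; congr (_ *: _).
rewrite mulmxA -(mulmxA (adjmx _)) vv mul_mx_scalar -scalemxAl scalerA.
by rewrite mulVf ?scale1r // pnatr_eq0.
Qed.

Lemma matlike_proj_span (A : starAlgType C) (P : A -> Prop) : matlike A -> P 0 ->
  (forall c x y, P x -> P y -> P (c *: x + y)) ->
  (forall q, star q = q -> q * q = q -> P q) -> forall x, P x.
Proof.
case=> n [f [g fg]] P0 PL Pq x; have [[fK gK] fL fM fS] := fg.
rewrite -[x]fK; move: (f x) => {x}.
apply: mx_proj_span => [|c x y Px Py|q sq qq].
- by rewrite -(iso0 fg) fK.
- rewrite (_ : g _ = c *: g x + g y); first exact: PL.
  by apply: (can_inj fK); rewrite gK fL !gK.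
- apply: Pq; apply: (can_inj fK); first by rewrite fS gK.
  by rewrite fM gK.
Qed.

End ProjectionSpan.

(** ** Diagonal states *)

Section Diagonal.
Variables (C : numClosedFieldType) (I : pointedType) (F G : I -> fdalg C).
Hypotheses (Fm : forall i, matlike (F i)) (Gm : forall i, matlike (G i)).
Variable ident : forall i, F i -> G i.
Hypothesis ident_lin : forall i c (x y : F i),
  ident (c *: x + y) = c *: ident x + ident y.
Hypothesis identS : forall i (x : F i), ident (star x) = star (ident x).
Hypothesis ident_sq : forall i (x : F i), ident (x * x) = ident x * ident x.
Hypothesis ident1 : forall i, ident (1 : F i) = 1.

Let FG := ten_fam F G.
Let FGm k : matlike (FG k). Proof. exact: matlike_mten. Qed.

Variable mu : prodalg FG -> C^o.
Hypothesis mu_state : normal_state (@bdd C _ FG) mu.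
Hypothesis mu_diag : forall i (q : F i), star q = q -> q * q = q ->
  (mu (ten_el (blk q) (1 - blk (ident q))) = 0) /\
  (mu (ten_el (1 - blk q) (blk (ident q))) = 0).
Local Notation m x := (mu x : C).

Lemma ten_el_proj (p : prodalg F) (q : prodalg G) :
  star p = p -> p * p = p -> star q = q -> q * q = q ->
  star (ten_el p q) = ten_el p q /\ ten_el p q * ten_el p q = ten_el p q.
Proof. by move=> ps pp qs qq; rewrite ten_elS ten_elM ps pp qs qq. Qed.

Lemma compl_proj (A : starAlgType C) (p : A) : star p = p -> p * p = p ->
  star (1 - p) = 1 - p /\ (1 - p) * (1 - p) = 1 - p.
Proof.
move=> ps pp; rewrite starB star1 ps; split=> //.
by rewrite mulrBr mulr1 mulrBl mul1r pp subrr subr0.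
Qed.

Lemma mu_proj_null (q X : prodalg FG) : star q = q -> q * q = q -> mu q = 0 ->
  bdd X -> m (X * q) = 0 /\ m (q * X) = 0.
Proof.
move=> qs qq q0 bX; have bq := bdd_proj qs qq.
have n0 : m (star q * q) = 0 by rewrite qs qq.
split; first exact: (state_null_r FGm mu_state).
by rewrite -qs; exact: (state_null_l FGm mu_state).
Qed.

Definition legl i (a : F i) : prodalg FG := ten_el (blk a) 1.
Definition legr i (a : F i) : prodalg FG := ten_el 1 (blk (ident a)).

Lemma ident0 i : ident (0 : F i) = 0.
Proof. by have := ident_lin (-1) (0 : F i) 0; rewrite scaler0 addr0 scaleN1r addNr. Qed.

Lemma bdd_leg i (a : F i) : bdd (legl a) /\ bdd (legr a).
Proof.
move: a; apply: (matlike_proj_span (Fm i)) => [|c x y [b1 b2] [b3 b4]|q qs qq].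
- have -> : legl (0 : F i) = 0.
    by apply: prod_ext => k; rewrite /legl blk0 /ten_el ten0l.
  have -> : legr (0 : F i) = 0.
    by apply: prod_ext => k; rewrite /legr ident0 blk0 /ten_el ten0r.
  by split; exact: bdd0.
- by rewrite /legl /legr ident_lin !blk_lin ten_elPl ten_elPr; split; exact: bdd_lin.
have [qs' qq'] : star (ident q) = ident q /\ ident q * ident q = ident q.
  by rewrite -identS -ident_sq qs qq.
have bl : star (blk q) = blk q /\ blk q * blk q = blk q.
  by rewrite blkS blkM qs qq.
have br : star (blk (ident q)) = blk (ident q) /\
    blk (ident q) * blk (ident q) = blk (ident q).
  by rewrite blkS blkM qs' qq'.
by split; apply: bdd_proj; apply: (ten_el_proj _ _ _ _).1 || apply: (ten_el_proj _ _ _ _).2;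
  rewrite ?star1 ?mulr1 //; case: bl br => [? ?] [? ?].
Qed.

(** Since p (x) 1 - 1 (x) p = p (x) (1 - p) - (1 - p) (x) p, a diagonal state
    cannot tell the two legs apart: first for projections, which span. *)
Lemma diag_legs i (a : F i) X : bdd X ->
  m (X * legl a) = m (X * legr a) /\ m (legl a * X) = m (legr a * X).
Proof.
move=> bX; move: a; apply: (matlike_proj_span (Fm i)) => [|c x y [e1 e2] [e3 e4]|q qs qq].
- have -> : legl (0 : F i) = 0.
    by apply: prod_ext => k; rewrite /legl blk0 /ten_el ten0l.
  have -> : legr (0 : F i) = 0.
    by apply: prod_ext => k; rewrite /legr ident0 blk0 /ten_el ten0r.
  by [].
- have [bx bx'] := bdd_leg x; have [by_ by'] := bdd_leg y.
  have -> : legl (c *: x + y) = c *: legl x + legl y.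
    by rewrite /legl blk_lin ten_elPl.
  have -> : legr (c *: x + y) = c *: legr x + legr y.
    by rewrite /legr ident_lin blk_lin ten_elPr.
  rewrite !mulrDr !mulrDl -!scalerAr -!scalerAl.
  by rewrite !(state_lin mu_state) ?e1 ?e2 ?e3 ?e4 //; exact: bddM.
have [d1 d2] := mu_diag qs qq.
have [qs' qq'] : star (ident q) = ident q /\ ident q * ident q = ident q.
  by rewrite -identS -ident_sq qs qq.
have [bs bb] : star (blk q) = blk q /\ blk q * blk q = blk q.
  by rewrite blkS blkM qs qq.
have [bs' bb'] : star (blk (ident q)) = blk (ident q) /\
    blk (ident q) * blk (ident q) = blk (ident q).
  by rewrite blkS blkM qs' qq'.
have [cs cc] := compl_proj bs bb; have [cs' cc'] := compl_proj bs' bb'.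
set u := ten_el (blk q) (1 - blk (ident q)) in d1.
set v := ten_el (1 - blk q) (blk (ident q)) in d2.
have [us uu] : star u = u /\ u * u = u by exact: ten_el_proj.
have [vs vv] : star v = v /\ v * v = v by exact: ten_el_proj.
have bu := bdd_proj us uu; have bv := bdd_proj vs vv.
have e : legl q = u - v + legr q.
  rewrite /u /v /legl /legr; apply: prod_ext => k.
  rewrite !prodE /ten_el !prodE.
  have tB1 (A B : fdalg C) (x y : A) (z : B) : ten (x - y) z = ten x z - ten y z.
    by rewrite addrC -scaleN1r tenPl scaleN1r addrC.
  have tB2 (A B : fdalg C) (x : A) (y z : B) : ten x (y - z) = ten x y - ten x z.
    by rewrite addrC -scaleN1r tenPr scaleN1r addrC.
  by rewrite tB1 tB2 opprB addrA subrK addrNK.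
have [bl br] := bdd_leg q.
have [n1 n2] := mu_proj_null us uu d1 bX; have [n3 n4] := mu_proj_null vs vv d2 bX.
have buv := bddB FGm bu bv.
split.
  rewrite e mulrDr (stateD mu_state); [|exact: bddM|exact: bddM].
  rewrite mulrBr (stateB mu_state); [|exact: bddM|exact: bddM].
  by rewrite n1 n3 subrr add0r.
rewrite e mulrDl (stateD mu_state); [|exact: bddM|exact: bddM].
rewrite mulrBl (stateB mu_state); [|exact: bddM|exact: bddM].
by rewrite n2 n4 subrr add0r.
Qed.

(** 1_i (x) 1_j lies under the null projection 1_i (x) (1 - 1_i). *)
Lemma diag_off i j : i != j -> mu (@blk C _ FG (i, j) 1) = 0.
Proof.
move=> ij; have [q0 _] := @mu_diag i 1 (star1 _) (mulr1 1).
rewrite ident1 in q0.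
have b1 (K : pointedType) (H : K -> fdalg C) k : star (blk (1 : H k)) = blk (1 : H k) /\
    blk (1 : H k) * blk (1 : H k) = blk (1 : H k).
  by rewrite blkS blkM star1 mulr1.
have [s1 t1] := b1 _ F i; have [s2 t2] := b1 _ G i.
have [cs cc] := compl_proj s2 t2.
have [us uu] := ten_el_proj s1 t1 cs cc.
have bb : bdd (@blk C _ FG (i, j) 1) by exact: bdd_blk.
have [<- _] := mu_proj_null us uu q0 bb.
congr mu; rewrite blkMl mul1r; congr blk; rewrite /ten_el /= !prodE blkE blk_out //.
by rewrite subr0.
Qed.

(** On the block [(i, i)] a diagonal state only sees the product of the two
    legs, in either order: move the right leg across from the right, or from
    the left. *)
Lemma diag_block i (a b : F i) :
  m (@blk C _ FG (i, i) (ten a (ident b))) = m (@blk C _ FG (i, i) (ten (a * b) 1)) /\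
  m (@blk C _ FG (i, i) (ten a (ident b))) = m (@blk C _ FG (i, i) (ten (b * a) 1)).
Proof.
have bX : bdd (@blk C _ FG (i, i) (ten a 1)) by exact: bdd_blk.
have [e1 e2] := diag_legs b bX.
move: e1 e2; rewrite /legl /legr !Mblk !blkMl /ten_el /= !blkE !prodE !tenM.
by rewrite !mulr1 !mul1r => -> ->.
Qed.

Lemma diag_proj1 (prd : forall i, mten (F i) (G i) -> F i) (p : prodalg FG) :
  (forall i c X Y, prd i (c *: X + Y) = c *: prd i X + prd i Y) ->
  (forall i (a b : F i), prd i (ten a (ident b)) = a * b \/
                         prd i (ten a (ident b)) = b * a) ->
  (forall i (y : G i), exists b : F i, y = ident b) ->
  star p = p -> p * p = p -> (forall i, prd i (p (i, i)) = 1) -> mu p = 1.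
Proof.
move=> pl pt sj ps pp p1; apply: (state_proj1 FGm mu_state ps pp) => -[i j].
have bp := bdd_proj ps pp.
have bb : bdd (@blk C _ FG (i, j) 1) by exact: bdd_blk.
have b1 : star (@blk C _ FG (i, j) 1) = @blk C _ FG (i, j) 1 /\
    @blk C _ FG (i, j) 1 * @blk C _ FG (i, j) 1 = @blk C _ FG (i, j) 1.
  by rewrite blkS blkM star1 mulr1.
have [ij|ij] := eqVneq i j; last first.
  have o := diag_off ij.
  by have [-> _] := mu_proj_null b1.1 b1.2 o bp; rewrite o.
rewrite -ij Mblk mulr1.
have prd0 : prd i 0 = 0.
  by have := pl i (-1) 0 0; rewrite scaler0 addr0 scaleN1r addNr.
suff e (X : mten (F i) (G i)) :
    m (@blk C _ FG (i, i) X) = m (@blk C _ FG (i, i) (ten (prd i X) 1)).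
  by rewrite e p1.
elim/(@tens_ind C (F i) (G i)): X => [|c X Y IHX IHY|a y].
- by rewrite prd0 ten0l.
- have bz (Z : FG (i, i)) : bdd (blk Z) by exact: bdd_blk.
  rewrite pl tenPl !blk_lin !(state_lin mu_state) // ?IHX ?IHY //; exact: bz.
- have [b ->] := sj i y; have [e1 e2] := diag_block a b.
  by case: (pt i a b) => ->.
Qed.

End Diagonal.

(** * Star homomorphisms of full products *)

Section StarHom.
Variables (C : numClosedFieldType) (I J : pointedType).
Variables (F : I -> fdalg C) (G : J -> fdalg C).

Definition star_hom (f : prodalg F -> prodalg G) :=
  [/\ linear_on setT f, multiplicative_on setT f, star_on setT f & f 1 = 1].

Variables (f : prodalg F -> prodalg G).
Hypothesis fh : star_hom f.

Let fL c x y : f (c *: x + y) = c *: f x + f y.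
Proof. by case: fh => fl _ _ _; exact: fl. Qed.
Let fM x y : f (x * y) = f x * f y.
Proof. by case: fh => _ fm _ _; exact: fm. Qed.
Let fS x : f (star x) = star (f x).
Proof. by case: fh => _ _ fs _; exact: fs. Qed.
Let f1 : f 1 = 1. Proof. by case: fh. Qed.
Let f0 : f 0 = 0.
Proof. by have := fL (-1) 0 0; rewrite scaler0 addr0 scaleN1r addNr. Qed.
Let fZ c x : f (c *: x) = c *: f x.
Proof. by have := fL c x 0; rewrite !addr0 f0 addr0. Qed.
Let fB x y : f (x - y) = f x - f y.
Proof. by rewrite addrC -scaleN1r fL scaleN1r addrC. Qed.

(** A bound is an identity [c^2 - x^* x = w^* w], which [f] transports. *)
Lemma hom_bdd x : bdd x -> bdd (f x).
Proof.
move=> [c c0 cx]; exists c => //.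
have [w wx] : exists w : prodalg F, forall i, c ^+ 2 *: 1 - star (x i) * x i = star (w i) * w i.
  by exists (fun i => projT1 (cid2 (cx i))) => i; case: cid2.
have e : c ^+ 2 *: 1 - star x * x = star w * w by apply: prod_ext.
have := congr1 f e; rewrite fB fZ !fM !fS f1 => {}e j.
by exists (f w j) => //; have := congr1 (fun u : prodalg G => u j) e.
Qed.

Lemma hom_le x y : le_in (@bdd C I F) x y -> le_in (@bdd C J G) (f x) (f y).
Proof.
move=> [z bz e]; exists (f z); first exact: hom_bdd.
by rewrite -fB e fM fS.
Qed.

Lemma hom_sa x : selfadjoint (@bdd C I F) x -> selfadjoint (@bdd C J G) (f x).
Proof. by case=> bx sx; split; [exact: hom_bdd | rewrite -fS sx]. Qed.

End StarHom.

(** An isomorphism is normal for order-theoretic reasons. *)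
Lemma iso_wmorphism (C : numClosedFieldType) (I J : pointedType)
    (F : I -> fdalg C) (G : J -> fdalg C)
    (f : prodalg F -> prodalg G) (g : prodalg G -> prodalg F) :
  star_hom f -> star_hom g -> cancel f g -> cancel g f ->
  wmorphism (@bdd C I F) (@bdd C J G) f.
Proof.
move=> fh gh fK gK; have [fl fm fs f1] := fh.
split.
- by move=> x; exact: hom_bdd.
- by move=> c x y _ _; exact: fl.
- by move=> x y _ _; exact: fm.
- by move=> x _; exact: fs.
split=> // D x _ _ [xs xu xl]; split; first exact: hom_sa.
  by move=> _ [d Dd <-]; apply: hom_le => //; exact: xu.
move=> y ys yu; rewrite -[y]gK; apply: hom_le => //.
apply: xl; first exact: hom_sa.
by move=> d Dd; rewrite -[d]fK; apply: hom_le => //; apply: yu; exists d.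
Qed.

Lemma lin_closedT (C : numClosedFieldType) (A : starAlgType C) :
  lin_closed [set: A].
Proof. by []. Qed.

Lemma lin_closed_fin (C : numClosedFieldType) (I : pointedType) (F : I -> fdalg C) :
  lin_closed (@fin C I F).
Proof. by split; [exact: fin0 | exact: fin_lin]. Qed.

Section StarHomLegs.
Variables (C : numClosedFieldType) (I I' J : pointedType).
Variables (F : I -> fdalg C) (F' : I' -> fdalg C) (G : J -> fdalg C).
Variable f : prodalg F -> prodalg F'.
Hypothesis fh : star_hom f.

Lemma ten_map_l_hom : star_hom (@ten_map_l C I I' J F F' G f).
Proof.
have [fl fm fs f1] := fh; have Tl := @lin_closedT C (prodalg F).
split=> [c X Y _ _|X Y _ _|X _|].
- by apply: (ten_map_l_lin Tl fl _ _ _).2.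
- by apply: (ten_map_lM Tl fl _ fm _ _).2.
- by apply: (ten_map_lS Tl fl _ fs _).2.
- rewrite -[LHS]/(ten_map_l f (ten_el (1 : prodalg F) (1 : prodalg G))).
  by rewrite (ten_map_l_el Tl fl) // f1.
Qed.

Lemma ten_map_r_hom : star_hom (@ten_map_r C J I I' G F F' f).
Proof.
have [fl fm fs f1] := fh; have Tl := @lin_closedT C (prodalg F).
split=> [c X Y _ _|X Y _ _|X _|].
- by apply: (ten_map_r_lin Tl fl _ _ _).2.
- by apply: (ten_map_rM Tl fl _ fm _ _).2.
- by apply: (ten_map_rS Tl fl _ fs _).2.
- rewrite -[LHS]/(ten_map_r f (ten_el (1 : prodalg G) (1 : prodalg F))).
  by rewrite (ten_map_r_el Tl fl) // f1.
Qed.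

End StarHomLegs.

(** * Characters of a matrix algebra *)

(** A nonzero character only exists in size 1: off-diagonal matrix units square
    to zero, so a character kills them, hence the diagonal units, hence 1. *)
Lemma mx_character (C : numClosedFieldType) m (chi : 'M[C]_m.+1 -> C) :
  linear_for *%R chi -> (forall x y, chi (x * y) = chi x * chi y) ->
  (exists x, chi x != 0) -> forall x, x = chi x *: 1.
Proof.
move=> cl cm [x0 nx0].
have c0 : chi 0 = 0 by have := cl (-1) 0 0; rewrite scaler0 addr0 mulN1r addNr.
have cZ c x : chi (c *: x) = c * chi x by have := cl c x 0; rewrite !addr0 c0 addr0.
have c1 : chi 1 = 1.
  by apply: (mulfI nx0); rewrite -cm !mulr1.
case: m => [|m] in chi x0 nx0 cl cm c0 cZ c1 *.
  move=> x; have ex : x = x 0 0 *: 1.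
    by apply/matrixP=> i j; rewrite !ord1 !mxE mulr1.
  by rewrite [in chi x]ex cZ c1 mulr1.
have off i j : i != j -> chi (delta_mx i j) = 0.
  move=> ij; apply/eqP; rewrite -[_ == 0]orbb -mulf_eq0 -cm -mulmxE.
  by rewrite mul_delta_mx_cond (eq_sym j) (negbTE ij) mulr0n c0.
have /eqP := c1; rewrite (mxfun_sum cl) big1 ?(eq_sym 0) ?oner_eq0 // => i _.
rewrite big1 // => j _; have [<-|ij] := eqVneq i j; last by rewrite off ?mulr0.
rewrite -(mul_delta_mx (lift i ord0)) mulmxE cm off ?mul0r ?mulr0 //.
exact: neq_lift.
Qed.

(** * Discrete quantum groups *)

Section DQG.
Variables (R : realType) (I : pointedType) (n : I -> nat).
Local Notation C := R[i].
Local Notation M := (mat_fam C n).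
Local Notation MM := (ten_fam M M).
Local Notation Mop := (op_fam M).
Local Notation fin := (@fin C I M).

Lemma Mm i : matlike (M i). Proof. exact: matlike_matblock. Qed.
Lemma Mopm i : matlike (Mop i). Proof. by apply: matlike_mop; exact: Mm. Qed.

Variables (Delta : prodalg M -> prodalg MM) (eps : prodalg M -> C^o).
Hypothesis hG : discrete_quantum_group Delta eps.

Let monoid : discrete_quantum_monoid Delta eps. Proof. by case: hG. Qed.
Let hopf : multiplier_hopf_star_algebra Delta. Proof. by case: hG. Qed.
Let counit : is_counit Delta eps. Proof. by case: hG. Qed.

Let Dw : wmorphism (@bdd C I M) (@bdd C _ MM) Delta. Proof. by case: monoid. Qed.
Let ew : wmorphism (@bdd C I M) setT eps. Proof. by case: monoid. Qed.

Let fb x : fin x -> bdd x. Proof. exact: (fin_bdd Mm). Qed.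

Lemma DeltaM x y : bdd x -> bdd y -> Delta (x * y) = Delta x * Delta y.
Proof. by case: Dw => _ _ dm _ _; exact: dm. Qed.
Lemma DeltaL c x y : bdd x -> bdd y -> Delta (c *: x + y) = c *: Delta x + Delta y.
Proof. by case: Dw => _ dl _ _ _; exact: dl. Qed.
Lemma DeltaS x : bdd x -> Delta (star x) = star (Delta x).
Proof. by case: Dw => _ _ _ ds _; exact: ds. Qed.
Lemma Delta_bdd x : bdd x -> bdd (Delta x).
Proof. by case: Dw => db _ _ _ _; exact: db. Qed.
Lemma DeltaZ c x : bdd x -> Delta (c *: x) = c *: Delta x.
Proof.
have d0 : Delta 0 = 0.
  by have := DeltaL (-1) bdd0 bdd0; rewrite scaler0 addr0 scaleN1r addNr.
by move=> bx; have := DeltaL c bx bdd0; rewrite d0 !addr0.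
Qed.

Lemma epsM x y : bdd x -> bdd y -> eps (x * y) = (eps x : C) * eps y :> C.
Proof. by case: ew => _ _ em _ _; exact: em. Qed.
Lemma epsL c x y : bdd x -> bdd y -> eps (c *: x + y) = c * (eps x : C) + eps y :> C.
Proof. by case: ew => _ el _ _ _; exact: el. Qed.
Lemma epsS x : bdd x -> eps (star x) = (eps x : C)^* :> C.
Proof. by case: ew => _ _ _ es _; exact: es. Qed.
Lemma eps0 : eps 0 = 0 :> C.
Proof.
by have := epsL (-1) bdd0 bdd0; rewrite scaler0 addr0 mulN1r addNr.
Qed.

(** ** The Galois maps *)

Lemma galois1_fin a b : fin a -> fin b -> Defs.fin (Delta a * ten_el 1 b).
Proof.
case: hopf => _ _ _ [T [Tl TE Tb]] _ fa fb'.
by rewrite -TE //; apply: (set_bij_homo Tb); exact: fin_ten_el.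
Qed.

Lemma galois2_fin a b : fin a -> fin b -> Defs.fin (ten_el a 1 * Delta b).
Proof.
case: hopf => _ _ _ _ [T [Tl TE Tb]] fa fb'.
by rewrite -TE //; apply: (set_bij_homo Tb); exact: fin_ten_el.
Qed.

Lemma galois1_ind (P : prodalg MM -> Prop) : P 0 ->
  (forall c X Y, Defs.fin X -> Defs.fin Y -> P X -> P Y -> P (c *: X + Y)) ->
  (forall a b, fin a -> fin b -> P (Delta a * ten_el 1 b)) ->
  forall X, Defs.fin X -> P X.
Proof.
case: hopf => _ _ _ [T [Tl TE Tb]] _ P0 PL Pt X fX.
have [Y fY <-] := set_bij_surj Tb fX.
have T0 := linear_on0 (@lin_closed_fin C _ MM) Tl.
have Tf Z : Defs.fin Z -> Defs.fin (T Z) by exact: (set_bij_homo Tb).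
move: Y fY; apply: fin_ten_ind => [|c Y Z fY fZ PY PZ|a b fa fb']; first by rewrite T0.
  by rewrite Tl //; apply: PL => //; exact: Tf.
by rewrite TE //; exact: Pt.
Qed.

Lemma galois2_ind (P : prodalg MM -> Prop) : P 0 ->
  (forall c X Y, Defs.fin X -> Defs.fin Y -> P X -> P Y -> P (c *: X + Y)) ->
  (forall a b, fin a -> fin b -> P (ten_el a 1 * Delta b)) ->
  forall X, Defs.fin X -> P X.
Proof.
case: hopf => _ _ _ _ [T [Tl TE Tb]] P0 PL Pt X fX.
have [Y fY <-] := set_bij_surj Tb fX.
have T0 := linear_on0 (@lin_closed_fin C _ MM) Tl.
have Tf Z : Defs.fin Z -> Defs.fin (T Z) by exact: (set_bij_homo Tb).
move: Y fY; apply: fin_ten_ind => [|c Y Z fY fZ PY PZ|a b fa fb']; first by rewrite T0.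
  by rewrite Tl //; apply: PL => //; exact: Tf.
by rewrite TE //; exact: Pt.
Qed.

Lemma galois2_inj a b : fin a -> fin b -> ten_el a 1 * Delta b = 0 ->
  ten_el a b = 0 :> prodalg MM.
Proof.
case: hopf => _ _ _ _ [T [Tl TE Tb]] fa fb' e0.
have T0 := linear_on0 (@lin_closed_fin C _ MM) Tl.
apply: (set_bij_inj Tb); rewrite ?inE; first exact: fin_ten_el.
  exact: fin0.
by rewrite TE // e0 T0.
Qed.

(** ** The support of the counit *)

Lemma eps_neq0 : exists x, fin x /\ (eps x : C) != 0.
Proof.
apply/not_existsP => e0.
have {}e0 x : fin x -> eps x = 0 :> C.
  by move=> fx; apply/eqP/negPn/negP => ne; apply: (e0 x).
case: counit => _ _ cl _; pose u : prodalg M := blk (1 : M point).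
have fu : fin u by exact: fin_blk.
have := cl u u fu fu => /(congr1 (fun x : prodalg M => x point)).
rewrite /u prodE blkE mulr1 /ten_fun_l big1 => [|t _].
  by move/esym/eqP; rewrite oner_eq0.
by rewrite e0 ?scale0r //; apply: fin_slices_l; exact: galois1_fin.
Qed.

(** The counit is a nonzero character of A, hence nonzero on some block, whose
    size is then 1. *)
Lemma counit_support : exists e : prodalg M,
  [/\ fin e, star e = e, (eps e : C) = 1,
      (forall a, bdd a -> a * e = (eps a : C) *: e /\ e * a = (eps a : C) *: e)
    & forall x, ten_el x e = 0 :> prodalg MM -> x = 0].
Proof.
have [i [a0 na0]] : exists i (a : M i), (eps (blk a) : C) != 0.
  apply: contrapT => no; have [x [fx]] := eps_neq0; case/negP; apply/eqP.
  move: x fx; apply: fin_ind => [|c x y fx fy ex ey|i a]; first exact: eps0.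
    by rewrite epsL ?ex ?ey ?mulr0 ?addr0 //; exact: fb.
  by apply/eqP/negPn/negP => ne; apply: no; exists i, a.
have bb (a : M i) : bdd (blk a) by apply: fb; exact: fin_blk.
have chiE : forall a : M i, a = (eps (blk a) : C) *: 1.
  apply: (@mx_character C (n i) (fun a : M i => eps (blk a))); last by exists a0.
    by move=> c x y; rewrite blk_lin epsL.
  by move=> x y; rewrite -blkM epsM.
have e1 : eps (blk (1 : M i)) = 1 :> C.
  by apply: (mulfI na0); rewrite -epsM // blkM !mulr1.
have bl c : blk (c *: (1 : M i)) = c *: blk (1 : M i) :> prodalg M.
  by have := blk_lin c (1 : M i) 0; rewrite blk0 !addr0.
exists (blk (1 : M i)); split=> //; first exact: fin_blk.
- by rewrite blkS star1.
- move=> a ba; rewrite Mblk blkMl mulr1 mul1r.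
  suff -> : a i = (eps a : C) *: 1 by [].
  rewrite {1}[a i]chiE; congr (_ *: _).
  have -> : blk (a i) = a * blk (1 : M i) by rewrite Mblk mulr1.
  by rewrite epsM // e1 mulr1.
- move=> x x0; apply: prod_ext => k; apply: bcoef_inj => s.
  have := congr1 (fun X : prodalg MM => bcoef ((s, (0, 0)) : bas (MM (k, i))) (X (k, i))) x0.
  rewrite ten_elE ten_bcoef blkE !linear0.
  rewrite [X in _ * X](_ : _ = (1 : 'M[C]_((n i).+1)) 0 0) //.
  by rewrite mxE eqxx mulr1.
Qed.

End DQG.

Lemma star_mul_sa (C : numClosedFieldType) (A : starAlgType C) (d x y : A) :
  star d = d -> d * x = d * y -> star x * d = star y * d.
Proof. by move=> sd /(congr1 star); rewrite !starM sd. Qed.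

(** What the algebra of the antipode uses of a discrete quantum group: the
    surjectivity of the Galois maps, as two induction principles, and the
    injectivity of one of them against the support [e] of the counit. *)
Record quantum_core (C : numClosedFieldType) (I : pointedType) (F : I -> fdalg C)
    (Delta : prodalg F -> prodalg (ten_fam F F)) (eps : prodalg F -> C)
    (e : prodalg F) : Prop := QuantumCore {
  qcM : forall x y, fin x -> fin y -> Delta (x * y) = Delta x * Delta y;
  qcZ : forall c x, fin x -> Delta (c *: x) = c *: Delta x;
  qcS : forall x, fin x -> Delta (star x) = star (Delta x);
  qc_fin1 : forall a b, fin a -> fin b -> fin (Delta a * ten_el 1 b);
  qc_fin2 : forall a b, fin a -> fin b -> fin (ten_el a 1 * Delta b);
  qc_ind1 : forall P : prodalg (ten_fam F F) -> Prop, P 0 ->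
    (forall c X Y, fin X -> fin Y -> P X -> P Y -> P (c *: X + Y)) ->
    (forall a b, fin a -> fin b -> P (Delta a * ten_el 1 b)) ->
    forall X, fin X -> P X;
  qc_ind2 : forall P : prodalg (ten_fam F F) -> Prop, P 0 ->
    (forall c X Y, fin X -> fin Y -> P X -> P Y -> P (c *: X + Y)) ->
    (forall a b, fin a -> fin b -> P (ten_el a 1 * Delta b)) ->
    forall X, fin X -> P X;
  qce_fin : fin e;
  qce_star : star e = e;
  qce1 : eps e = 1;
  qce_r : forall a, fin a -> a * e = eps a *: e;
  qce_l : forall a, fin a -> e * a = eps a *: e;
  qce_inj : forall x, fin x -> ten_el x 1 * Delta e = 0 -> x = 0 }.

Section Antipode.
Variables (C : numClosedFieldType) (I : pointedType) (M : I -> fdalg C).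
Local Notation MM := (ten_fam M M).
Local Notation fin := (@fin C I M).
Variables (Delta : prodalg M -> prodalg MM) (eps : prodalg M -> C).
Variable e : prodalg M.
Hypothesis qc : quantum_core Delta eps e.

Let Fl := @lin_closed_fin C I M.
Let fe : fin e := qce_fin qc.

Lemma fin_cancel (x y : prodalg M) : (forall a, fin a -> a * x = a * y) -> x = y.
Proof.
move=> xy; apply: prod_ext => i.
have := xy _ (fin_blk (1 : M i)) => /(congr1 (fun z : prodalg M => z i)).
by rewrite !prodE blkE !mul1r.
Qed.

Lemma ten_el0l (b : prodalg M) : ten_el (0 : prodalg M) b = 0 :> prodalg MM.
Proof. by apply: prod_ext => k; rewrite /ten_el ten0l. Qed.

Lemma ten_elZl c (a b : prodalg M) : ten_el (c *: a) b = c *: ten_el a b :> prodalg MM.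
Proof. by have := ten_elPl c a 0 b; rewrite ten_el0l !addr0. Qed.
Lemma ten_el0r (a : prodalg M) : ten_el a (0 : prodalg M) = 0 :> prodalg MM.
Proof. by apply: prod_ext => k; rewrite /ten_el ten0r. Qed.
Lemma ten_elZr c (a b : prodalg M) : ten_el a (c *: b) = c *: ten_el a b :> prodalg MM.
Proof. by have := ten_elPr c a b 0; rewrite ten_el0r !addr0. Qed.

Section MoveLegs.
Variable S : prodalg M -> prodalg M.
Hypothesis Sl : linear_on fin S.

Lemma mult_fin_lin_l c X Y : Defs.fin X -> Defs.fin Y ->
  mult_map (ten_map_l S (c *: X + Y)) =
  c *: mult_map (ten_map_l S X) + mult_map (ten_map_l S Y).
Proof.
move=> fX fY; rewrite (ten_map_l_lin Fl Sl _ _ _).2 ?mult_map_lin //; exact: fin_slices_l.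
Qed.
Lemma mult_fin_lin_r c X Y : Defs.fin X -> Defs.fin Y ->
  mult_map (ten_map_r S (c *: X + Y)) =
  c *: mult_map (ten_map_r S X) + mult_map (ten_map_r S Y).
Proof.
move=> fX fY; rewrite (ten_map_r_lin Fl Sl _ _ _).2 ?mult_map_lin //; exact: fin_slices_r.
Qed.

(** [Delta e] absorbs [Delta c] up to [eps c], and the elements
    [(a (x) 1) Delta b] span: so any [X] in front of [Delta e] may be pushed to
    the left leg, at the price of the antipode. *)
Lemma push_right_leg X :
  (forall a b, fin a -> fin b ->
     mult_map (ten_map_r S (ten_el a 1 * Delta b)) = eps b *: a) ->
  Defs.fin X -> X * Delta e = ten_el (mult_map (ten_map_r S X)) 1 * Delta e.
Proof.
move=> SA; move: X; apply: (qc_ind2 qc) => [|c X Y fX fY eX eY|a b fa fb'].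
- have := mult_fin_lin_r (-1) fin0 fin0; rewrite scaler0 addr0 scaleN1r addNr => ->.
  by rewrite ten_el0l !mul0r.
- by rewrite (mult_fin_lin_r c fX fY) ten_elPl mulrDl mulrDl eY -(scalerAl c X) eX -(scalerAl c (ten_el _ _)).
rewrite (SA a b fa fb') -mulrA -(qcM qc fb' fe) (qce_r qc fb').
by rewrite (qcZ qc _ fe) ten_elZl -scalerAr -scalerAl.
Qed.

Lemma push_left_leg X :
  (forall a b, fin a -> fin b ->
     mult_map (ten_map_l S (Delta a * ten_el 1 b)) = eps a *: b) ->
  Defs.fin X -> Delta e * X = Delta e * ten_el 1 (mult_map (ten_map_l S X)).
Proof.
move=> SA; move: X; apply: (qc_ind1 qc) => [|c X Y fX fY eX eY|a b fa fb'].
- have := mult_fin_lin_l (-1) fin0 fin0; rewrite scaler0 addr0 scaleN1r addNr => ->.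
  by rewrite ten_el0r !mulr0.
- by rewrite (mult_fin_lin_l c fX fY) ten_elPr mulrDr mulrDr eY -(scalerAr c _ X) eX -(scalerAr c _ (ten_el _ _)).
rewrite (SA a b fa fb') mulrA -(qcM qc fe fa) (qce_l qc fa).
by rewrite (qcZ qc _ fe) ten_elZr -scalerAr -scalerAl.
Qed.

End MoveLegs.

(** ** A star-preserving antipode is an involutive anti-automorphism *)

Section KacAntipode.
Variable S : prodalg M -> prodalg M.
Hypotheses (Sf : forall x, fin x -> fin (S x)) (Sl : linear_on fin S).
Hypothesis Al : forall a b, fin a -> fin b ->
  mult_map (ten_map_l S (Delta a * ten_el 1 b)) = eps a *: b.
Hypothesis Ar : forall a b, fin a -> fin b ->
  mult_map (ten_map_r S (ten_el a 1 * Delta b)) = eps b *: a.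
Hypothesis Sstar : star_on fin S.

Let S_r a b : fin a -> fin b ->
  ten_el a b * Delta e = ten_el (a * S b) 1 * Delta e.
Proof.
move=> fa fb'.
rewrite (push_right_leg Sl Ar); last exact: fin_ten_el.
by rewrite (ten_map_r_el Fl Sl a fb') mult_map_el.
Qed.

Let S_l a b : fin a -> fin b ->
  Delta e * ten_el a b = Delta e * ten_el 1 (S a * b).
Proof.
move=> fa fb'.
rewrite (push_left_leg Sl Al); last exact: fin_ten_el.
by rewrite (ten_map_l_el Fl Sl b fa) mult_map_el.
Qed.

Let De_eq (x y : prodalg M) : fin x -> fin y ->
  ten_el x 1 * Delta e = ten_el y 1 * Delta e -> x = y.
Proof.
move=> fx fy xy; apply/eqP; rewrite -subr_eq0; apply/eqP/(qce_inj qc).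
  by rewrite addrC -scaleN1r; exact: fin_lin.
by rewrite addrC -scaleN1r ten_elPl mulrDl -scalerAl xy scaleN1r addNr.
Qed.

(** Both sides, multiplied by [a] on the left, turn [Delta e] into
    (a (x) b c) Delta e, by moving first [c] and then [b]. *)
Lemma antipodeM b c : fin b -> fin c -> S (b * c) = S c * S b.
Proof.
move=> fb' fc; apply: fin_cancel => a fa; have fbc : fin (b * c) by exact: finMr.
have fac : fin (a * S c) by exact: finMr.
apply: De_eq; [exact: finMr|exact: finMr|].
rewrite -(S_r fa fbc) -[in LHS](mul1r a) -ten_elM -mulrA (S_r fa fc).
by rewrite mulrA ten_elM mul1r mulr1 (S_r fac fb') mulrA.
Qed.

Let De_sa : star (Delta e) = Delta e.
Proof. by rewrite -(qcS qc fe) (qce_star qc). Qed.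

(** Move [a] from the left to the right leg with the adjoint of the left
    formula, and back with the right formula: the result is both
    c S(S(a)) S(b) and c a S(b).  The range of [S] is nondegenerate because the
    antipode identity writes every [y] as a sum of products S(u) v. *)
Lemma antipodeK a : fin a -> S (S a) = a.
Proof.
move=> fa.
have key c b : fin c -> fin b -> c * (S (S a)) * S b = c * a * S b.
  move=> fc fb'; have fSS := Sf (Sf fa).
  have fbS : fin (b * S a) by exact: finMr.
  have fca : fin (c * a) by exact: finMr.
  apply: De_eq; [exact: finMr (finMr _ fc)|exact: finMr fca|].
  have e1 : ten_el a b * Delta e = ten_el 1 (b * S a) * Delta e.
    have := star_mul_sa De_sa (S_l (finS fa) (finS fb')).
    rewrite (ten_elS (star a)) (ten_elS 1) (starM (S _)) star1 (starK a) (starK b).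
    by rewrite -(Sstar (finS fa)) starK.
  have -> : ten_el (c * S (S a) * S b) 1 * Delta e = ten_el c (b * S a) * Delta e.
    by rewrite (S_r fc fbS) (antipodeM fb' (Sf fa)) (mulrA c).
  rewrite -(S_r fca fb') -[in ten_el c _](mulr1 c) -[b * S a](mul1r (b * S a)) -ten_elM.
  by rewrite -mulrA -e1 mulrA ten_elM mul1r.
have kill z : (forall b, fin b -> z * S b = 0) -> forall y, fin y -> z * y = 0.
  move=> zS y fy; have := Al fe fy; rewrite (qce1 qc) scale1r => <-.
  have : Defs.fin (Delta e * ten_el 1 y) by exact: (qc_fin1 qc).
  move: (Delta e * ten_el 1 y); apply: fin_ten_ind => [|c X Y fX fY eX eY|u v fu fv].
  - have := mult_fin_lin_l Sl (-1) fin0 fin0.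
    by rewrite scaler0 addr0 scaleN1r addNr => ->; rewrite mulr0.
  - by rewrite (mult_fin_lin_l Sl) // mulrDr -scalerAr eX eY scaler0 addr0.
  - by rewrite (ten_map_l_el Fl Sl v fu) mult_map_el mulrA (zS _ fu) mul0r.
apply: fin_cancel => c fc; apply/eqP; rewrite -subr_eq0; apply/eqP.
apply: prod_ext => i.
have z0 : (c * S (S a) - c * a) * blk (1 : M i) = 0.
  apply: kill (fin_blk _) => b fb'.
  by rewrite mulrBl key // subrr.
by move: z0 => /(congr1 (fun z : prodalg M => z i)); rewrite prodE blkE mulr1.
Qed.

End KacAntipode.
End Antipode.

(** * From the antipode to a W*-morphism *)

Section Extension.
Variables (C : numClosedFieldType) (I : pointedType) (M : I -> fdalg C).
Hypothesis Mm : forall i, matlike (M i).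
Local Notation MM := (ten_fam M M).
Local Notation Mop := (op_fam M).
Local Notation fin := (@fin C I M).

Variable S : prodalg M -> prodalg M.
Hypotheses (Sf : forall x, fin x -> fin (S x)) (Sl : linear_on fin S).
Hypothesis SM : forall b c, fin b -> fin c -> S (b * c) = S c * S b.
Hypothesis SS : star_on fin S.
Hypothesis SK : forall a, fin a -> S (S a) = a.

Let one i : prodalg M := blk (1 : M i).
Let onef i : fin (one i). Proof. exact: fin_blk. Qed.
Let oneE i (x : prodalg M) : (one i * x) i = x i.
Proof. by rewrite prodE /one blkE mul1r. Qed.
Let oneC i (x : prodalg M) : one i * x = x * one i.
Proof. by rewrite /one Mblk blkMl mulr1 mul1r. Qed.
Let oneM i : one i * one i = one i.
Proof. by rewrite /one blkM mulr1. Qed.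

#[local] Hint Resolve onef : core.

Definition supp i : prodalg M := S (one i).

Lemma supp_fin i : fin (supp i). Proof. exact: Sf. Qed.
#[local] Hint Resolve supp_fin : core.

Lemma suppM i : supp i * supp i = supp i.
Proof. by rewrite /supp -SM // oneM. Qed.

Lemma suppC i x : supp i * x = x * supp i.
Proof.
have finC a : fin a -> supp i * a = a * supp i.
  by move=> fa; rewrite -(SK fa) /supp -!SM ?oneC //; exact: Sf.
apply: prod_ext => j; have := finC _ (fin_blk (x j)).
by move=> /(congr1 (fun z : prodalg M => z j)); rewrite !prodE blkE.
Qed.

(** [S] transports the central projection of the block [j] to the central
    projection [supp j]; what [S] moves into the block [j] is the part of [x]
    over [supp j], which is finitely supported for every [x]. *)
Definition ext (x : prodalg M) : prodalg M := fun j => S (x * supp j) j.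

Let xf j x : fin (x * supp j). Proof. by apply: finMl; exact: supp_fin. Qed.
#[local] Hint Resolve xf : core.

Lemma ext_fin a : fin a -> ext a = S a.
Proof.
move=> fa; apply: prod_ext => j.
by rewrite /ext SM // {1}/supp SK // oneE.
Qed.

Lemma ext_lin c x y : ext (c *: x + y) = c *: ext x + ext y.
Proof.
by apply: prod_ext => j; rewrite !prodE /ext mulrDl -scalerAl Sl.
Qed.

Lemma extM x y : ext (x * y) = ext y * ext x.
Proof.
apply: prod_ext => j; rewrite !prodE /ext -prodM -SM //.
have -> // : x * supp j * (y * supp j) = x * y * supp j.
by rewrite -mulrA (mulrA (supp j)) suppC -(mulrA y) suppM mulrA.
Qed.

Lemma extS x : ext (star x) = star (ext x).
Proof.
apply: prod_ext => j; rewrite prodE /ext.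
have sj : star (supp j) = supp j by rewrite /supp -SS // /one blkS star1.
have -> : star x * supp j = star (x * supp j) by rewrite starM sj suppC.
by rewrite SS.
Qed.

Lemma ext1 : ext 1 = 1.
Proof. by apply: prod_ext => j; rewrite /ext mul1r /supp SK // /one blkE. Qed.

(** [ext] is the extension of [S] to multipliers. *)
Lemma ext_MS x y : fin y -> ext x * S y = S (y * x).
Proof.
move=> fy; apply: prod_ext => j; rewrite prodE /ext -prodM -SM // mulrA.
have fyx : fin (y * x) by exact: finMr.
by rewrite SM // {1}/supp SK // oneE.
Qed.

Lemma extK : cancel ext ext.
Proof.
move=> x; apply: prod_ext => j.
have fx : fin (one j * x) by exact: finMr.
by rewrite {1}/ext /supp ext_MS // SK // oneE.
Qed.

Lemma ext_hom_op : @star_hom C I I M Mop ext.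
Proof.
split=> [c x y _ _|x y _ _|x _|]; [exact: ext_lin|exact: extM|exact: extS|exact: ext1].
Qed.
Lemma ext_hom_po : @star_hom C I I Mop M ext.
Proof.
split=> [c x y _ _|x y _ _|x _|]; [exact: ext_lin|exact: extM|exact: extS|exact: ext1].
Qed.

Lemma ext_wmorphism : wmorphism (@bdd C I M) (@bdd C I Mop) ext.
Proof. exact: iso_wmorphism ext_hom_op ext_hom_po extK extK. Qed.

(** ** Diagonal states on the image of the comultiplication *)

Variables (Delta : prodalg M -> prodalg MM) (eps : prodalg M -> C) (e : prodalg M).
Hypothesis Dbdd : forall a, bdd a -> bdd (Delta a).
Hypothesis DM : forall a b, bdd a -> bdd b -> Delta (a * b) = Delta a * Delta b.
Hypothesis qc : quantum_core Delta eps e.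
Hypothesis e_eps : forall a, bdd a -> a * e = eps a *: e.
Hypothesis Al : forall a b, fin a -> fin b ->
  mult_map (ten_map_l S (Delta a * ten_el 1 b)) = eps a *: b.
Hypothesis Ar : forall a b, fin a -> fin b ->
  mult_map (ten_map_r S (ten_el a 1 * Delta b)) = eps b *: a.

Let fe : fin e := qce_fin qc.
Let Fl := @lin_closed_fin C I M.
Let eM : e * e = e.
Proof. by rewrite (qce_r qc fe) (qce1 qc) scale1r. Qed.
Let fb x : fin x -> bdd x. Proof. exact: (fin_bdd Mm). Qed.

(** For a state to which the projection [f (Delta e)] looks like 1, the
    identity [Delta a Delta e = eps a Delta e] evaluates [f (Delta a)]. *)
Lemma state_of_counit (K : pointedType) (H : K -> fdalg C) (Hm : forall k, matlike (H k))
    (f : prodalg MM -> prodalg H) (mu : prodalg H -> C^o) :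
  star_hom f -> normal_state (@bdd C K H) mu -> mu (f (Delta e)) = 1 ->
  forall a, bdd a -> mu (f (Delta a)) = eps a.
Proof.
move=> fh ms me a ba; have [fl fm fs f1] := fh.
have be : bdd (f (Delta e)) by apply: hom_bdd => //; exact: Dbdd (fb fe).
have bX : bdd (f (Delta a)) by apply: hom_bdd => //; exact: Dbdd.
set E := f (Delta e) in me be *.
have Es : star E = E by rewrite /E -fs // -(qcS qc fe) (qce_star qc).
have EE : E * E = E by rewrite /E -fm // -(qcM qc fe fe) eM.
have bq : bdd (1 - E) by apply: bddB => //; exact: bdd1.
have q0 : mu (star (1 - E) * (1 - E)) = 0.
  have [-> ->] := compl_proj Es EE.
  by rewrite (stateB ms bdd1 be) me (state1 ms) subrr.
have := state_null_r Hm ms bX bq q0.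
rewrite mulrBr mulr1 (stateB ms) //; last exact: bddM.
move/eqP; rewrite subr_eq0 => /eqP ->.
have f0 : f 0 = 0.
  by have := fl (-1) 0 0 Logic.I Logic.I; rewrite scaler0 addr0 scaleN1r addNr.
have -> : f (Delta a) * E = eps a *: E.
  rewrite /E -fm // -(DM ba (fb fe)) e_eps // (qcZ qc _ fe).
  by have := fl (eps a) (Delta e) 0 Logic.I Logic.I; rewrite f0 !addr0.
by rewrite (stateZ ms) // me mulr1.
Qed.

Let De_mult_l j : block_mult (ten_map_l ext (Delta e) (j, j) : mten (M j) (M j)) = 1.
Proof.
have sl : slices_l fin (Delta e) by apply: col_fin_slices_l => b fb'; exact: (qc_fin1 qc fe fb').
have -> : ten_map_l ext (Delta e) (j, j) = ten_map_l S (Delta e) (j, j).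
  by apply: eq_bigr => t _; rewrite ext_fin.
rewrite -mult_mapE; have := Al fe (onef j).
rewrite (ten_map_lMel Fl Sl _ sl).2 mult_mapMr (qce1 qc) scale1r.
by move=> /(congr1 (fun x : prodalg M => x j)); rewrite -oneC oneE /one blkE.
Qed.

Let De_mult_r j : block_mult (ten_map_r ext (Delta e) (j, j) : mten (M j) (M j)) = 1.
Proof.
have sl : slices_r fin (Delta e) by apply: row_fin_slices_r => b fb'; exact: (qc_fin2 qc fb' fe).
have -> : ten_map_r ext (Delta e) (j, j) = ten_map_r S (Delta e) (j, j).
  by apply: eq_bigr => t _; rewrite ext_fin.
rewrite -mult_mapE; have := Ar (onef j) fe.
rewrite (ten_map_relM Fl Sl _ sl).2 mult_mapMl (qce1 qc) scale1r.
by move=> /(congr1 (fun x : prodalg M => x j)); rewrite oneE /one blkE.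
Qed.

Let Mopm i : matlike (Mop i). Proof. exact: matlike_mop. Qed.

Lemma diag_state_ext_l (mu : prodalg (ten_fam Mop M) -> C^o) :
  normal_state (@bdd C _ (ten_fam Mop M)) mu ->
  (forall p : prodalg Mop, projection (@bdd C I Mop) p ->
    mu (ten_el p ((1 - p : prodalg Mop) : prodalg M)) = 0) ->
  forall a, bdd a -> mu (ten_map_l ext (Delta a)) = eps a.
Proof.
move=> ms md; have fh := ten_map_l_hom M ext_hom_op.
apply: (state_of_counit _ fh ms) => [k|]; first exact: matlike_mten.
have [fl fm fs f1] := fh.
(* The condition on the diagonal blocks is [De_mult_l]. *)
apply: (@diag_proj1 C I Mop M Mopm Mm (fun i x => x) _ _ _ _ mu ms _
   (fun i X => block_mult (X : mten (M i) (M i)))) => //.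
- move=> i q qs qq.
  have bs : star (blk q) = blk q :> prodalg Mop by rewrite blkS qs.
  have bb : blk q * blk q = blk q :> prodalg Mop by rewrite blkM qq.
  have [cs cc] := compl_proj bs bb.
  split; first by apply: (md (blk q)); split=> //; exact: bdd_proj.
  have := md (1 - blk q); rewrite subKr; apply; split=> //; exact: bdd_proj.
- by move=> i c X Y; exact: (@block_mult_lin C (M i) c X Y).
- by move=> i a b; right; exact: (@block_mult_ten C (M i) a b).
- by move=> i y; exists y.
- by rewrite -fs // -(qcS qc fe) (qce_star qc).
- by rewrite -fm // -(qcM qc fe fe) eM.
Qed.

Lemma diag_state_ext_r (mu : prodalg (ten_fam M Mop) -> C^o) :
  normal_state (@bdd C _ (ten_fam M Mop)) mu ->
  (forall p : prodalg M, projection (@bdd C I M) p ->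
    mu (ten_el p ((1 - p : prodalg M) : prodalg Mop)) = 0) ->
  forall a, bdd a -> mu (ten_map_r ext (Delta a)) = eps a.
Proof.
move=> ms md; have fh := ten_map_r_hom M ext_hom_op.
apply: (state_of_counit _ fh ms) => [k|]; first exact: matlike_mten.
have [fl fm fs f1] := fh.
(* The condition on the diagonal blocks is [De_mult_r]. *)
apply: (@diag_proj1 C I M Mop Mm Mopm (fun i x => x) _ _ _ _ mu ms _
   (fun i X => block_mult (X : mten (M i) (M i)))) => //.
- move=> i q qs qq.
  have bs : star (blk q) = blk q :> prodalg M by rewrite blkS qs.
  have bb : blk q * blk q = blk q :> prodalg M by rewrite blkM qq.
  have [cs cc] := compl_proj bs bb.
  split; first by apply: (md (blk q)); split=> //; exact: bdd_proj.
  have := md (1 - blk q); rewrite subKr; apply; split=> //; exact: bdd_proj.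
- by move=> i c X Y; exact: (@block_mult_lin C (M i) c X Y).
- by move=> i a b; left; exact: (@block_mult_ten C (M i) a b).
- by move=> i y; exists y.
- by rewrite -fs // -(qcS qc fe) (qce_star qc).
- by rewrite -fm // -(qcM qc fe fe) eM.
Qed.

End Extension.

(** * From a W*-morphism to the antipode *)

Section Converse.
Variables (R : realType) (I : pointedType).
Local Notation C := R[i].
Variable M : I -> fdalg C.
Hypothesis Mm : forall i, matlike (M i).
Local Notation MM := (ten_fam M M).
Local Notation Mop := (op_fam M).
Local Notation fin := (@fin C I M).

Variable tau : forall i, M i -> C.
Hypothesis taul : forall i, linear_for *%R (@tau i).
Hypothesis tauC : forall i (x y : M i), tau (x * y) = tau (y * x).
Hypothesis tau_ge0 : forall i (x : M i), 0 <= tau (star x * x).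
Hypothesis tau_faithful : forall i (x : M i), tau (star x * x) = 0 -> x = 0.
Hypothesis tau1 : forall i, tau (1 : M i) = 1.

Let Mopm i : matlike (Mop i). Proof. exact: matlike_mop. Qed.
Let fb x : fin x -> bdd x. Proof. exact: (fin_bdd Mm). Qed.

Let tau0 i : tau (0 : M i) = 0.
Proof. by have := taul (-1) (0 : M i) 0; rewrite scaler0 addr0 mulN1r addNr. Qed.
Let tauZ i c (x : M i) : tau (c *: x) = c * tau x.
Proof. by have := taul c x 0; rewrite !addr0 tau0 addr0. Qed.
Let tauB i (x y : M i) : tau (x - y) = tau x - tau y.
Proof. by rewrite addrC -scaleN1r taul mulN1r addrC. Qed.

Lemma tau_star i (x : M i) : tau (star x) = (tau x)^*.
Proof.
apply: (block_fun_star Mm) => [|h [z ->]]; [exact: taul|exact: tau_ge0].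
Qed.

(** An element whose first two moments are those of the scalar [c] has variance
    zero under the faithful trace. *)
Lemma scalar_of_moments i (x : M i) c :
  tau x = c -> tau (star x * x) = c^* * c -> x = c *: 1.
Proof.
move=> x1 x2; apply/eqP; rewrite -subr_eq0; apply/eqP/tau_faithful.
rewrite starB starZ star1 mulrBl !mulrBr -!scalerAl -!scalerAr mul1r !mulr1.
by rewrite !tauB !tauZ x2 tau_star x1 tau1; ring.
Qed.

(** The product of the two legs, in the multiplication of [M]; on M^op (x) M and
    on M (x) M^op it is linear but not multiplicative. *)
Definition prd_l i (X : mten (Mop i) (M i)) : M i := block_mult (X : mten (M i) (M i)).
Definition prd_r i (X : mten (M i) (Mop i)) : M i := block_mult (X : mten (M i) (M i)).

Let prd_l_lin i c (X Y : mten (Mop i) (M i)) :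
  prd_l (c *: X + Y) = c *: prd_l X + prd_l Y.
Proof. exact: (@block_mult_lin C (M i) c X Y). Qed.
Let prd_r_lin i c (X Y : mten (M i) (Mop i)) :
  prd_r (c *: X + Y) = c *: prd_r X + prd_r Y.
Proof. exact: (@block_mult_lin C (M i) c X Y). Qed.
Let prd_l_ten i (a : Mop i) (b : M i) : prd_l (ten a b) = (a : M i) * b.
Proof. exact: (@block_mult_ten C (M i) a b). Qed.
Let prd_r_ten i (a : M i) (b : Mop i) : prd_r (ten a b) = a * (b : M i).
Proof. exact: (@block_mult_ten C (M i) a b). Qed.
Let prd_l0 i : prd_l (0 : mten (Mop i) (M i)) = 0.
Proof. by have := prd_l_lin (-1) (0 : mten (Mop i) (M i)) 0; rewrite scaler0 addr0 scaleN1r addNr. Qed.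
Let prd_r0 i : prd_r (0 : mten (M i) (Mop i)) = 0.
Proof. by have := prd_r_lin (-1) (0 : mten (M i) (Mop i)) 0; rewrite scaler0 addr0 scaleN1r addNr. Qed.

(** In M^op (x) M the product (x (x) y)(x' (x) y')^* has legs x'^* x and y y'^* ,
    and tr(x'^* x y y'^* ) = tr((x y)(x' y')^* ). *)
Lemma prd_l_sesqui i (X Y : mten (Mop i) (M i)) :
  tau (prd_l (X * star Y)) = tau (prd_l X * star (prd_l Y)).
Proof.
elim/(@tens_ind C (Mop i) (M i)): X => [|c X X' IH IH'|a b].
- by rewrite mul0r prd_l0 mul0r.
- rewrite mulrDl -(scalerAl c X (star Y)) (prd_l_lin c (X * star Y)) (prd_l_lin c X) taul.
  rewrite mulrDl -(scalerAl c (prd_l X)) taul.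
  by congr (_ * _ + _); [exact: IH | exact: IH'].
elim/(@tens_ind C (Mop i) (M i)): Y => [|c Y Y' IH IH'|a' b'].
- by rewrite star0 mulr0 prd_l0 star0 mulr0.
- rewrite starD (starZ c Y) mulrDr -(scalerAr c^* (ten a b) (star Y)) (prd_l_lin c^* (ten a b * star Y)) (prd_l_lin c Y) taul.
  rewrite starD starZ mulrDr -(scalerAr c^* _ (star (prd_l Y))) taul.
  by congr (_ * _ + _); [exact: IH | exact: IH'].
rewrite tenS tenM !prd_l_ten starM.
have -> : ((a * star a' : Mop i) : M i) = star (a' : M i) * (a : M i) by [].
by rewrite -mulrA tauC !mulrA.
Qed.

(** In M (x) M^op the product (x' (x) y')^* (x (x) y) has legs x'^* x and
    y y'^* , and tr(x'^* x y y'^* ) = tr((x' y')^* (x y)). *)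
Lemma prd_r_sesqui i (X Y : mten (M i) (Mop i)) :
  tau (prd_r (star Y * X)) = tau (star (prd_r Y) * prd_r X).
Proof.
elim/(@tens_ind C (M i) (Mop i)): X => [|c X X' IH IH'|a b].
- by rewrite mulr0 prd_r0 mulr0.
- rewrite mulrDr -(scalerAr c (star Y) X) (prd_r_lin c (star Y * X)) (prd_r_lin c X) taul.
  rewrite mulrDr -(scalerAr c _ (prd_r X)) taul.
  by congr (_ * _ + _); [exact: IH | exact: IH'].
elim/(@tens_ind C (M i) (Mop i)): Y => [|c Y Y' IH IH'|a' b'].
- by rewrite star0 mul0r prd_r0 star0 mul0r.
- rewrite starD (starZ c Y) mulrDl -(scalerAl c^* (star Y) (ten a b)) (prd_r_lin c^* (star Y * ten a b)) (prd_r_lin c Y) taul.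
  rewrite starD starZ mulrDl -(scalerAl c^* (star (prd_r Y))) taul.
  by congr (_ * _ + _); [exact: IH | exact: IH'].
rewrite tenS tenM !prd_r_ten starM.
have -> : ((star b' * b : Mop i) : M i) = (b : M i) * star (b' : M i) by [].
by rewrite mulrA tauC !mulrA.
Qed.

(** Diagonality: the product of the legs of p (x) (1 - p) is p (1 - p) = 0. *)
Lemma diag_vector_l i :
  normal_state (@bdd C _ (ten_fam Mop M)) (fun X => tau (prd_l (X (i, i))) : C^o) /\
  forall p : prodalg Mop, projection (@bdd C I Mop) p ->
    tau (prd_l (ten_el p ((1 - p : prodalg Mop) : prodalg M) (i, i))) = 0.
Proof.
split.
  apply: (@block_normal_state R _ (ten_fam Mop M) _ (i, i) (fun X => tau (prd_l X))).
  - by move=> k; exact: matlike_mten.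
  - by move=> c X Y; rewrite prd_l_lin taul.
  - move=> h [z ->]; rewrite -[z in _ * z]starK prd_l_sesqui.
    by rewrite -[X in X * _]starK tau_ge0.
  - by rewrite -[X in prd_l X]ten11 prd_l_ten mulr1 tau1.
move=> p [_ _ pp]; rewrite ten_elE prd_l_ten.
have pi : (p i : M i) * (p i : M i) = p i.
  exact: (congr1 (fun x : prodalg Mop => x i) pp).
rewrite [X in _ * X](_ : _ = 1 - (p i : M i)) //.
by rewrite mulrBr mulr1 pi subrr tau0.
Qed.

Lemma diag_vector_r i :
  normal_state (@bdd C _ (ten_fam M Mop)) (fun X => tau (prd_r (X (i, i))) : C^o) /\
  forall p : prodalg M, projection (@bdd C I M) p ->
    tau (prd_r (ten_el p ((1 - p : prodalg M) : prodalg Mop) (i, i))) = 0.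
Proof.
split.
  apply: (@block_normal_state R _ (ten_fam M Mop) _ (i, i) (fun X => tau (prd_r X))).
  - by move=> k; exact: matlike_mten.
  - by move=> c X Y; rewrite prd_r_lin taul.
  - by move=> h [z ->]; rewrite prd_r_sesqui tau_ge0.
  - by rewrite -[X in prd_r X]ten11 prd_r_ten mulr1 tau1.
move=> p [_ _ pp]; rewrite ten_elE prd_r_ten.
have pi : (p i : M i) * (p i : M i) = p i.
  exact: (congr1 (fun x : prodalg M => x i) pp).
rewrite [X in _ * X](_ : _ = 1 - (p i : M i)) //.
by rewrite mulrBr mulr1 pi subrr tau0.
Qed.

Variables (Delta : prodalg M -> prodalg MM) (eps : prodalg M -> C) (e : prodalg M).
Hypothesis qc : quantum_core Delta eps e.
Hypothesis epsM : forall x y, fin x -> fin y -> eps (x * y) = eps x * eps y.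
Hypothesis epsS : forall x, fin x -> eps (star x) = (eps x)^*.

Variable s : prodalg M -> prodalg Mop.
Hypotheses (sl : linear_on fin s) (sM : multiplicative_on fin s) (sS : star_on fin s).
Hypothesis s_l : forall phi : prodalg (ten_fam Mop M) -> C^o,
  normal_state (@bdd C _ (ten_fam Mop M)) phi ->
  (forall p : prodalg Mop, projection (@bdd C I Mop) p ->
    phi (ten_el p ((1 - p : prodalg Mop) : prodalg M)) = 0) ->
  forall a, fin a -> phi (ten_map_l s (Delta a)) = eps a.
Hypothesis s_r : forall phi : prodalg (ten_fam M Mop) -> C^o,
  normal_state (@bdd C _ (ten_fam M Mop)) phi ->
  (forall p : prodalg M, projection (@bdd C I M) p ->
    phi (ten_el p ((1 - p : prodalg M) : prodalg Mop)) = 0) ->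
  forall a, fin a -> phi (ten_map_r s (Delta a)) = eps a.

Let Fl := @lin_closed_fin C I M.
Let FM x y : fin x -> fin y -> fin (x * y). Proof. by move=> _; exact: finMl. Qed.
Let FS x : fin x -> fin (star x). Proof. exact: finS. Qed.
Let Dsl a : fin a -> slices_l fin (Delta a).
Proof. by move=> fa; apply: col_fin_slices_l => b fb'; exact: (qc_fin1 qc fa fb'). Qed.
Let Dsr a : fin a -> slices_r fin (Delta a).
Proof. by move=> fa; apply: row_fin_slices_r => b fb'; exact: (qc_fin2 qc fb' fa). Qed.

(** The vector states see the first two moments of the product of the legs of
    [(s (x) id) (Delta a)], because [(s (x) id) Delta] is multiplicative. *)
Lemma legs_product_l a i : fin a ->
  prd_l (ten_map_l s (Delta a) (i, i)) = eps a *: 1.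
Proof.
move=> fa; have fsa := finS fa; have fas := finMr (star a) fa.
have [ns nd] := diag_vector_l i.
have := s_l ns nd fa; have := s_l ns nd fas.
rewrite /= (qcM qc fa fsa) (qcS qc fa).
have [sls eS] := ten_map_lS Fl sl FS sS (Dsl fa).
have [_ ->] := ten_map_lM Fl sl FM sM (Dsl fa) sls.
rewrite eS prodE prodS prd_l_sesqui tauC epsM // epsS // => e2 e1.
by apply: scalar_of_moments; rewrite // e2 mulrC.
Qed.

Lemma legs_product_r a i : fin a ->
  prd_r (ten_map_r s (Delta a) (i, i)) = eps a *: 1.
Proof.
move=> fa; have fsa := finS fa; have fas := finMr a fsa.
have [ns nd] := diag_vector_r i.
have := s_r ns nd fa; have := s_r ns nd fas.
rewrite /= (qcM qc fsa fa) (qcS qc fa).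
have [sls eS] := ten_map_rS Fl sl FS sS (Dsr fa).
have [_ ->] := ten_map_rM Fl sl FM sM sls (Dsr fa).
rewrite eS prodE prodS prd_r_sesqui epsM // epsS // => e2 e1.
by apply: scalar_of_moments; rewrite // e2.
Qed.

Let slM : linear_on fin (s : prodalg M -> prodalg M).
Proof. exact: sl. Qed.

Lemma antipode_l a b : fin a -> fin b ->
  mult_map (ten_map_l (s : prodalg M -> prodalg M) (Delta a * ten_el 1 b)) = eps a *: b.
Proof.
move=> fa fb'; rewrite (ten_map_lMel Fl slM _ (Dsl fa)).2 mult_mapMr.
apply: prod_ext => i; rewrite prodE mult_mapE.
by rewrite [block_mult _](legs_product_l i fa) -scalerAl mul1r.
Qed.

Lemma antipode_r a b : fin a -> fin b ->
  mult_map (ten_map_r (s : prodalg M -> prodalg M) (ten_el a 1 * Delta b)) = eps b *: a.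
Proof.
move=> fa fb'; rewrite (ten_map_relM Fl slM _ (Dsr fb')).2 mult_mapMl.
apply: prod_ext => i; rewrite prodE mult_mapE.
by rewrite [block_mult _](legs_product_r i fb') -scalerAr mulr1.
Qed.

(** Below [1_j (x) 1], the element [(1 (x) 1_i) Delta e] is
    [(1_j s(1_i) (x) 1) Delta e], so [s(1_i)] has no more blocks than the finitely
    supported [(1 (x) 1_i) Delta e]. *)
Lemma morphism_fin a : fin a -> fin (s a : prodalg M).
Proof.
have fe := qce_fin qc.
have s1f i : fin (s (blk (1 : M i)) : prodalg M).
  set u := blk (1 : M i); have fu : fin u by exact: fin_blk.
  have us : star u = u by rewrite /u blkS star1.
  pose Y : prodalg MM := ten_el 1 u * Delta e.
  have fY : Defs.fin Y.
    have := finS (qc_fin1 qc fe fu).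
    by rewrite starM ten_elS star1 us -(qcS qc fe) (qce_star qc).
  have : finite_set (fst @` [set k | Y k != 0]) by exact: finite_image.
  apply: sub_finite_set => j /= nj; exists (j, i) => //=.
  apply: contra_neq nj => Yji.
  pose v : prodalg M := blk (1 : M j); have fv : fin v by exact: fin_blk.
  have vY : ten_el v u * Delta e = 0.
    have -> : ten_el v u * Delta e = ten_el v 1 * Y.
      by rewrite /Y mulrA ten_elM mulr1 mul1r.
    apply: prod_ext => -[k l]; rewrite !prodE ten_elE.
    have [jk|jk] := eqVneq j k; last by rewrite /v (blk_out _ jk) ten0l mul0r.
    have [il|il] := eqVneq i l; first by rewrite -jk -il Yji mulr0.
    by rewrite /Y prodM ten_elE /u (blk_out _ il) ten0r mul0r mulr0.
  have fvu : Defs.fin (ten_el v u : prodalg MM) by exact: fin_ten_el.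
  have fvs : fin (v * (s u : prodalg M)) by exact: finMr.
  have := push_right_leg qc slM antipode_r fvu.
  rewrite (ten_map_r_el Fl slM v fu) mult_map_el vY => /esym/(qce_inj qc fvs).
  by move=> /(congr1 (fun x : prodalg M => x j)); rewrite prodE /v blkE mul1r.
move: a; apply: fin_ind => [|c x y fx fy sx sy|i a].
- by rewrite (linear_on0 Fl slM); exact: fin0.
- by rewrite (sl c fx fy); exact: fin_lin.
have f1 : fin (blk (1 : M i)) by exact: fin_blk.
have fa : fin (blk a) by exact: fin_blk.
have -> : blk a = blk (1 : M i) * blk a by rewrite blkM mul1r.
by rewrite (sM f1 fa); exact: (@finMl _ _ M).
Qed.

End Converse.

(** * The normalized trace *)

Section NormalizedTrace.
Variables (C : numClosedFieldType) (m : nat).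

Definition ntr (x : 'M[C]_m.+1) : C := m.+1%:R^-1 * \tr x.

Let m0 : m.+1%:R != 0 :> C. Proof. by rewrite pnatr_eq0. Qed.

Lemma ntr_lin : linear_for *%R ntr.
Proof. by move=> c x y; rewrite /ntr linearP /= mulrDr mulrCA. Qed.

Lemma ntrC x y : ntr (x * y) = ntr (y * x).
Proof. by rewrite /ntr -!mulmxE mxtrace_mulC. Qed.

Lemma ntr1 : ntr 1 = 1.
Proof. by rewrite /ntr mxtrace1 mulVf. Qed.

Lemma ntr_sq x : ntr (star x * x) = m.+1%:R^-1 * \sum_i \sum_j `|x j i| ^+ 2.
Proof.
congr (_ * _); apply: eq_bigr => i _; rewrite -mulmxE mxE.
by apply: eq_bigr => j _; rewrite starmxE /adjmx mxE [X in X^* * _]mxE normCKC.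
Qed.

Lemma ntr_ge0 x : 0 <= ntr (star x * x).
Proof.
rewrite ntr_sq mulr_ge0 ?invr_ge0 ?ler0n //.
by apply: sumr_ge0 => i _; apply: sumr_ge0 => j _; exact: exprn_ge0.
Qed.

Lemma ntr_faithful x : ntr (star x * x) = 0 -> x = 0.
Proof.
rewrite ntr_sq => /eqP; rewrite mulf_eq0 invr_eq0 (negbTE m0) /= => /eqP s0.
have pi i : 0 <= \sum_j `|x j i| ^+ 2.
  by apply: sumr_ge0 => j _; exact: exprn_ge0.
apply/matrixP=> j i; rewrite mxE.
have /eqP := s0; rewrite psumr_eq0 // => /allP /(_ i (mem_index_enum _)) /= /eqP.
move/eqP; rewrite psumr_eq0 => [|k _]; last exact: exprn_ge0.
move=> /allP /(_ j (mem_index_enum _)) /=.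
by rewrite expf_eq0 /= normr_eq0 => /eqP.
Qed.

End NormalizedTrace.

Section CoreOfDQG.
Variables (R : realType) (I : pointedType) (n : I -> nat).
Local Notation C := R[i].
Local Notation M := (mat_fam C n).
Variables (Delta : prodalg M -> prodalg (ten_fam M M)) (eps : prodalg M -> C^o).
Hypothesis hG : discrete_quantum_group Delta eps.

Lemma dqg_core : exists e : prodalg M,
  quantum_core Delta (eps : prodalg M -> C) e /\
  forall a, bdd a -> a * e = (eps a : C) *: e.
Proof.
have fb (x : prodalg M) : fin x -> bdd x by exact: (fin_bdd (@Mm R I n)).
have [e [fe es e1 ea einj]] := counit_support hG.
exists e; split; last by move=> a /ea[].
split=> //.
- by move=> x y fx fy; apply: (DeltaM hG); exact: fb.
- by move=> c x fx; apply: (DeltaZ hG); exact: fb.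
- by move=> x fx; apply: (DeltaS hG); exact: fb.
- exact: (galois1_fin hG).
- exact: (galois2_fin hG).
- exact: (galois1_ind hG).
- exact: (galois2_ind hG).
- by move=> a fa; case: (ea a (fb a fa)).
- by move=> a fa; case: (ea a (fb a fa)).
- by move=> x fx /(galois2_inj hG fx fe) /einj.
Qed.

End CoreOfDQG.

Local Open Scope complex_scope.

Theorem theorem0p3 (R : realType) (I : pointedType) (n : I -> nat)
    (Delta : prodalg (mat_fam R[i] n) ->
             prodalg (ten_fam (mat_fam R[i] n) (mat_fam R[i] n)))
    (eps : prodalg (mat_fam R[i] n) -> R[i]^o)
    (hG : discrete_quantum_group Delta eps) :
  kac_type Delta eps <->
  exists s : prodalg (mat_fam R[i] n) -> prodalg (op_fam (mat_fam R[i] n)),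
    [/\ wmorphism (@bdd _ _ (mat_fam R[i] n))
          (@bdd _ _ (op_fam (mat_fam R[i] n))) s,
        (forall phi : prodalg (ten_fam (op_fam (mat_fam R[i] n))
                                 (mat_fam R[i] n)) -> R[i]^o,
           diagonal_state_l phi ->
           forall a, bdd a -> phi (ten_map_l s (Delta a)) = eps a)
      & (forall phi : prodalg (ten_fam (mat_fam R[i] n)
                                 (op_fam (mat_fam R[i] n))) -> R[i]^o,
           diagonal_state_r phi ->
           forall a, bdd a -> phi (ten_map_r s (Delta a)) = eps a)].
Proof.
have Mm := @Mm R I n; 
  have fb (x : prodalg (mat_fam R[i] n)) : fin x -> bdd x by exact: (fin_bdd Mm).
have [e [qc ea]] := dqg_core hG.
split=> [[S [Sf Sl Al Ar] SS]|[s [[sb sl sM sS _] s_l s_r]]].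
  have SM := antipodeM qc Sl Ar.
  have SK := antipodeK qc Sf Sl Al Ar SS.
  have Db a : bdd a -> bdd (Delta a) by exact: (Delta_bdd hG).
  have DM a b : bdd a -> bdd b -> Delta (a * b) = Delta a * Delta b.
    exact: (DeltaM hG).
  exists (ext S); split.
  - exact: (ext_wmorphism Sf Sl SM SS SK).
  - move=> phi [ns nd].
    exact: (diag_state_ext_l Mm Sf Sl SM SS SK Db DM qc ea Al ns nd).
  - move=> phi [ns nd].
    exact: (diag_state_ext_r Mm Sf Sl SM SS SK Db DM qc ea Ar ns nd).
have sl' : linear_on (@fin _ _ _) s by move=> c x y /fb bx /fb by_; exact: sl.
have sM' : multiplicative_on (@fin _ _ _) s by move=> x y /fb bx /fb by_; exact: sM.
have sS' : star_on (@fin _ _ _) s by move=> x /fb bx; exact: sS.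
have eM x y : fin x -> fin y -> (eps (x * y) : R[i]) = (eps x : R[i]) * eps y.
  by move=> /fb bx /fb by_; exact: (epsM hG).
have eS x : fin x -> (eps (star x) : R[i]) = Num.conj (eps x : R[i]).
  by move=> /fb bx; exact: (epsS hG).
pose tau i : mat_fam R[i] n i -> R[i] := @ntr R[i] (n i).
have tl i : linear_for *%R (@tau i) by exact: ntr_lin.
have tC i x y : @tau i (x * y) = @tau i (y * x) by exact: ntrC.
have t0 i x : 0 <= @tau i (star x * x) by exact: ntr_ge0.
have tf i x : @tau i (star x * x) = 0 -> x = 0 by exact: ntr_faithful.
have t1 i : @tau i 1 = 1 by exact: ntr1.
have sl2 phi ns nd a fa := s_l phi (conj ns nd) a (fb a fa).
have sr2 phi ns nd a fa := s_r phi (conj ns nd) a (fb a fa).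
exists (s : prodalg _ -> prodalg (mat_fam R[i] n)); last exact: sS'.
split.
- exact: (morphism_fin Mm tl tC t0 tf t1 qc eM eS sl' sM' sS' sr2).
- exact: sl'.
- exact: (antipode_l Mm tl tC t0 tf t1 qc eM eS sl' sM' sS' sl2).
- exact: (antipode_r Mm tl tC t0 tf t1 qc eM eS sl' sM' sS' sr2).
Qed.
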